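(* Let $g\in L^2(U)$, $U=[0,1]$, and let $F(q):L^2(U)\to\mathbb{R}\cup\{\infty\}$, $q\in\mathcal{Q}$, be the family of functionals defined in the context. Then: 1. For every $q\in\mathcal{Q}$ there is a minimizer of $F(q)$ in $L^2(U)$. 2. Let $q_s=(\gamma_s,\mu_s,t_s)\in\mathcal{Q}$, $s\in\mathbb{N}$, converge to $q=(\gamma,\mu,t)\in\mathcal{Q}$ as $s\to\infty$, and let $(f^*_s)_{s\in\mathbb{N}}$ be a sequence such that $f^*_s$ is a minimizer of $F(q_s)$ for each $s$. Then: (a) every subsequence of $(f^*_s)_{s\in\mathbb{N}}$ that converges in $L^2(U)$ converges to a minimizer of $F(q)$; (b) $(f^*_s)_{s\in\mathbb{N}}$ always contains a subsequence that converges in $L^2(U)$.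
   Context: $U=[0,1]$, $\|\cdot\|$ is the norm of $L^2(U)$ (real-valued functions, Lebesgue measure); elements of the function classes below are identified with their $L^2$-equivalence classes. $\mathcal{T}(U)$ is the set of right-continuous step functions on $U$ (finitely many jumps) that are continuous at $1$. For $n\in\mathbb{N}=\{1,2,\dots\}$, $\mathcal{T}_n(U)\subset\mathcal{T}(U)$ is the set of functions constant on each of the intervals $[\frac{\kappa}{n},\frac{\kappa+1}{n})$, $\kappa=0,\dots,n-2$, and $[\frac{n-1}{n},1]$; $\sigma_n$ is the $\sigma$-algebra generated by these intervals and $g_n=E(g\mid\sigma_n)\in\mathcal{T}_n(U)$, i.e. $g_n(\frac{\kappa}{n})=n\int_{\kappa/n}^{(\kappa+1)/n}g(s)\,ds$. $\mathrm{SBV}_2(U)$ is the set of $f\in L^2(U)$ that can be written $f=t+F$ with $t\in\mathcal{T}(U)$ and $F\in H^1((0,1))$; $t,F$ are unique up to an additive constant. For such $f$, $j(f)$ is the number of discontinuities of $t$ in $(0,1)$ and $f'$ denotes the Sobolev derivative of $F$. $\mathbb{T}=\{1/n: n\in\mathbb{N}\}\cup\{0\}\subset\mathbb{R}$ with the relative topology, and $\mathcal{Q}=[0,\infty)\times[0,\infty)\times\mathbb{T}$ with the product topology. For $(\gamma,\mu,t)\in\mathcal{Q}$, writing $t=1/n$ if $t>0$, define $F(\gamma,\mu,t)$ as follows. - $\gamma>0,\mu>0,t=1/n$ (Blake-Zisserman): $F(\gamma,\mu,t)(f)=\sum_{\kappa=0}^{n-2}\min\{\frac{n}{\mu^2}(f(\frac{\kappa+1}{n})-f(\frac{\kappa}{n}))^2,\gamma\}+\frac1n\sum_{\kappa=0}^{n-1}(f-g_n)^2(\frac{\kappa}{n})$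 if $f\in\mathcal{T}_n(U)$, and $\infty$ otherwise. - $\gamma>0,\mu>0,t=0$ (Mumford-Shah): $F(\gamma,\mu,t)(f)=\gamma j(f)+\frac{1}{\mu^2}\int_U|f'|^2ds+\|f-g\|^2$ if $f\in\mathrm{SBV}_2(U)$, and $\infty$ otherwise. - $\gamma>0,\mu=0,t=1/n$ (discrete Potts): $F(\gamma,\mu,t)(f)=\gamma\,|\{\kappa\in\{0,\dots,n-2\}: f(\frac{\kappa+1}{n})\ne f(\frac{\kappa}{n})\}|+\frac1n\sum_{\kappa=0}^{n-1}(f-g_n)^2(\frac{\kappa}{n})$ if $f\in\mathcal{T}_n(U)$, and $\infty$ otherwise. - $\gamma>0,\mu=0,t=0$ (continuous Potts): $F(\gamma,\mu,t)(f)=\gamma j(f)+\|f-g\|^2$ if $f\in\mathcal{T}(U)$, and $\infty$ otherwise. - $\gamma=0,\mu\ge0,t=1/n$: $F(\gamma,\mu,t)(f)=\frac1n\sum_{\kappa=0}^{n-1}(f-g_n)^2(\frac{\kappa}{n})$ if $f\in\mathcal{T}_n(U)$, and $\infty$ otherwise. - $\gamma=0,\mu\ge0,t=0$: $F(\gamma,\mu,t)(f)=\int_U(f-g)^2ds$. *)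

(* Defs.v *)
From HB Require Import structures.
From mathcomp Require Import all_boot all_order all_algebra.
From mathcomp Require Import all_classical all_reals all_analysis.

Set Implicit Arguments.
Unset Strict Implicit.
Unset Printing Implicit Defensive.
Import Order.TTheory GRing.Theory Num.Theory.
Import numFieldNormedType.Exports.

Local Open Scope classical_set_scope.
Local Open Scope ring_scope.

(* U = [0, 1] is modelled by the whole real line carrying the Lebesgue measure restricted
   to [0, 1]: values outside U never matter. *)
Definition lebU (R : realType) : {measure set (measurableTypeR R) -> \bar R} :=
  mrestr (@lebesgue_measure R) (measurable_itv `[0%R, 1%R]).
Arguments lebU {R}.

(* Elements are a.e.-equality classes; one coerces to a representative of
   itself, so function classes below are always tested up to ae_eq. *)
Definition L2U (R : realType) : Type := LspaceType2 (@lebU R).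

Definition L2cvg (R : realType) (f_ : nat -> L2U R) (f : L2U R) : Prop :=
  ('N[lebU]_2[(fun x => (f_ s x - f x)%:E)])%E @[s --> \oo] --> 0%E.

Definition sqdist (R : realType) (f g : L2U R) : \bar R :=
  (\int[lebU]_x ((f x - g x) ^+ 2)%:E)%E.

Definition of_class (R : realType) (C : set (R -> R)) (f : L2U R) : Prop :=
  exists2 h, C h & ae_eq lebU setT f h.

(* For the step function classes below, two members that are a.e. equal agree
   on [0, 1[, so the choice made by get is immaterial. *)
Definition repr_in (R : realType) (C : set (R -> R)) (f : L2U R) : R -> R :=
  get [set h | C h /\ ae_eq lebU setT f h].

Definition step_on_partition (R : realType) (t : R -> R) (s : seq R) : Prop :=
  forall i, (i < size s)%N -> exists c, forall x,
    nth 1 (0 :: s) i < x < nth 1 (0 :: s) i.+1 -> t x = c.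

Definition stepU (R : realType) : set (R -> R) := [set t |
  [/\ exists2 s, itv_partition 0 1 s & step_on_partition t s,
      forall x, 0 <= x < 1 -> t y @[y --> x^'+] --> t x
    & t y @[y --> 1^'-] --> t 1]].

Definition stepU_n (R : realType) (n : nat) : set (R -> R) := [set h |
  (forall k, (k.+1 < n)%N -> forall x, k%:R / n%:R <= x < k.+1%:R / n%:R ->
     h x = h (k%:R / n%:R)) /\
  (forall x, n.-1%:R / n%:R <= x <= 1 -> h x = h (n.-1%:R / n%:R))].

Definition test_function (R : realType) (phi : R -> R) : Prop :=
  (forall n x, derivable phi^`(n)%classic x 1) /\
  closure [set x | phi x != 0] `<=` `]0, 1[.

Definition weak_derivative (R : realType) (u v : R -> R) : Prop :=
  forall phi : R -> R, test_function phi ->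
    \int[lebU]_x (u x * phi^`()%classic x) = - \int[lebU]_x (v x * phi x).

Definition H1 (R : realType) : set (R -> R) := [set u |
  u \in Lfun lebU 2%:E /\
  exists2 v : R -> R, v \in Lfun lebU 2%:E & weak_derivative u v].

Definition sobolev_derivative (R : realType) (u : R -> R) : R -> R :=
  get [set v | v \in Lfun lebU 2%:E /\ weak_derivative u v].

Definition SBV_decomposition (R : realType) (f : L2U R) :
    set ((R -> R) * (R -> R)) := [set p |
  [/\ stepU p.1, H1 p.2 & ae_eq lebU setT f (fun x => p.1 x + p.2 x)]].

Definition SBV2 (R : realType) (f : L2U R) : Prop :=
  exists p, SBV_decomposition f p.

(* The decomposition is unique up to an additive constant (and, for the Sobolev
   part, null sets), so the choice made by get is immaterial for the number of
   jumps and for the class of the derivative. *)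
Definition jump_number (R : realType) (f : L2U R) : \bar R :=
  let t := (get (SBV_decomposition f)).1 in
  counting [set x | 0 < x < 1 /\ ~ {for x, continuous t}].

Definition SBV_derivative (R : realType) (f : L2U R) : R -> R :=
  sobolev_derivative (get (SBV_decomposition f)).2.

(* g_n(k/n), where g_n = E(g | sigma_n) *)
Definition cell_mean (R : realType) (g : L2U R) (n k : nat) : R :=
  n%:R * \int[lebU]_(s in `[k%:R / n%:R, k.+1%:R / n%:R]) g s.

Definition discrete_fidelity (R : realType) (g : L2U R) (n : nat) (h : R -> R)
    : R :=
  n%:R^-1 * \sum_(k < n) (h (k%:R / n%:R) - cell_mean g n k) ^+ 2.

Definition blake_zisserman (R : realType) (g : L2U R) (gamma mu : R) (n : nat)
    (f : L2U R) : \bar R :=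
  if `[< of_class (@stepU_n R n) f >] then
    let h := repr_in (@stepU_n R n) f in
    (\sum_(k < n.-1)
        Num.min (n%:R / mu ^+ 2 * (h (k.+1%:R / n%:R) - h (k%:R / n%:R)) ^+ 2)
                gamma
     + discrete_fidelity g n h)%:E
  else +oo%E.

Definition mumford_shah (R : realType) (g : L2U R) (gamma mu : R) (f : L2U R)
    : \bar R :=
  if `[< SBV2 f >] then
    (gamma%:E * jump_number f
     + (mu ^+ 2)^-1%:E * \int[lebU]_x (`|SBV_derivative f x| ^+ 2)%:E
     + sqdist f g)%E
  else +oo%E.

Definition discrete_potts (R : realType) (g : L2U R) (gamma : R) (n : nat)
    (f : L2U R) : \bar R :=
  if `[< of_class (@stepU_n R n) f >] then
    let h := repr_in (@stepU_n R n) f in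
    (gamma *
       #|[set k : 'I_n.-1 | h (k.+1%:R / n%:R) != h (k%:R / n%:R)]%SET|%:R
     + discrete_fidelity g n h)%:E
  else +oo%E.

Definition continuous_potts (R : realType) (g : L2U R) (gamma : R) (f : L2U R)
    : \bar R :=
  if `[< of_class (@stepU R) f >] then
    (gamma%:E * jump_number f + sqdist f g)%E
  else +oo%E.

Definition discrete_projection (R : realType) (g : L2U R) (n : nat) (f : L2U R)
    : \bar R :=
  if `[< of_class (@stepU_n R n) f >] then
    (discrete_fidelity g n (repr_in (@stepU_n R n) f))%:E
  else +oo%E.

(* Points (gamma, mu, t); the topology of Q is induced by that of R * R * R. *)
Definition Qset (R : realType) : set (R * R * R) := [set q |
  [/\ 0 <= q.1.1, 0 <= q.1.2
    & q.2 = 0 \/ exists2 n : nat, (0 < n)%N & q.2 = n%:R^-1]].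

(* For t = 1/n, Num.truncn t^-1 is n. *)
Definition Ffun (R : realType) (g : L2U R) (q : R * R * R) : L2U R -> \bar R :=
  let: (gamma, mu, t) := q in
  let n := Num.truncn t^-1 in
  if gamma == 0 then
    if t == 0 then fun f => sqdist f g else discrete_projection g n
  else if mu == 0 then
    if t == 0 then continuous_potts g gamma else discrete_potts g gamma n
  else
    if t == 0 then mumford_shah g gamma mu else blake_zisserman g gamma mu n.

Definition minimizer (R : realType) (Phi : L2U R -> \bar R) (f : L2U R)
    : Prop :=
  forall h, (Phi f <= Phi h)%E.

(* Main.v *)
Require Import Defs.
From HB Require Import structures.
From mathcomp Require Import all_boot all_order all_algebra.
From mathcomp Require Import all_classical all_reals all_analysis.
From mathcomp Require Import measurable_realfun ring lra.

(** Existence of minimizers and both convergence claims come from one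
compactness principle, [almost_minimizers_compact]: if q_s tends to q and the
value of F(q_s) at f_s exceeds the infimum by at most eps_s, with eps_s -> 0,
then a subsequence of f_s converges in L2 to a minimizer of F(q). A constant
sequence q_s gives existence, since the infimum is finite and so has almost
minimizers; exact minimizers are almost minimizers, which gives a convergent
subsequence; and a subsequence known to converge has, by the principle applied
to it, a further subsequence converging to a minimizer, which is its limit.

The principle is the direct method. What all the functionals with gamma > 0
share is the estimate [Ffun_lower]: a function of cost at most c has a
representative h, a finite list p of points and a nondecreasing A with values
in [0, E], such that (h y - h x)^2 <= mu^2 (y - x + 2 t) (A y - A x) as soon as
[x, y] misses p, and gamma |p| + E + fidelity <= c. On the continuum p is the
jump set and A the rescaled energy of the derivative; on a grid p marks the
bonds whose energy is truncated at gamma and A adds up the energies of the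
others. An estimate on increments survives pointwise limits, which are taken
along an ultrafilter ([rough_compact]). In the limit t = 0, and the estimate
characterizes step functions plus primitives of square-integrable functions:
[jump_removal] subtracts the jumps one at a time, and [ctrl_density] finds the
derivative as the L2 limit of dyadic difference quotients. Equicontinuity away
from p gives convergence almost everywhere of a subsequence, comparison with
the limit gives convergence of the norms, and [radon_riesz] makes it
convergence in L2.

The competitors needed for the comparison come from [recovery]: sampling a
function on the grid costs no more than the function itself, cell by cell.
When gamma tends to 0 with vanishing mesh, competitors that are steps close to
g force f_s to tend to g ([zero_gam_case]). When t > 0 the mesh is eventually
constant and everything happens in finite dimension ([fixed_mesh_case]).

The number of jumps and the derivative of an SBV function are read off an
unspecified decomposition. By [weak_derivative_primitive] its Sobolev part is
a primitive, and by [normal_form_unique] two decompositions have the same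
jumps and the same derivative. *)

Set Implicit Arguments.
Unset Strict Implicit.
Unset Printing Implicit Defensive.
Import Order.TTheory GRing.Theory Num.Theory.
Import numFieldNormedType.Exports.

Local Open Scope classical_set_scope.
Local Open Scope ring_scope.


(** * Square-integrable functions on the unit interval *)

Notation U01 := (`[0%R, 1%R]%classic).

Section L2.
Variable R : realType.
Implicit Types (u v w : R -> R).

Local Notation mu := (@lebesgue_measure R).

Lemma lebUE (A : set R) : lebU A = mu (A `&` U01).
Proof. by []. Qed.

Lemma lebU_setC : @lebU R (~` U01) = 0%E.
Proof. by rewrite lebUE setICl measure0. Qed.

Lemma integral_lebU (f : R -> \bar R) : measurable_fun setT f ->
  (\int[lebU]_x f x = \int[mu]_(x in U01) f x)%E.
Proof.
move=> mf.
transitivity (\int[@lebU R]_(x in U01) f x)%E; last first.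
  by apply: eq_measure_integral => A mA sA; rewrite lebUE setIidl.
have mU : measurable (U01 : set R) by exact: measurable_itv.
rewrite [RHS]integral_mkcond; apply: ae_eq_integral => //.
  apply/measurable_restrict => //.
  by apply: measurable_funTS.
exists (~` U01); split.
- exact: measurableC.
- by rewrite lebU_setC.
- move=> x /= /not_implyP[_ /eqP fx] xU; move: fx.
  by rewrite patchE mem_set ?eqxx.
Qed.

Lemma ae_lebU (P : set R) :
  (\forall x \ae (@lebU R), P x) <-> (\forall x \ae mu, U01 x -> P x).
Proof.
have mU : measurable (U01 : set R) by exact: measurable_itv.
split => -[N [mN N0 sN]].
- exists (N `&` U01); split; [exact: measurableI | by [] |].
  by move=> x /= /not_implyP[xU Px]; split => //; exact: sN.
- exists (N `|` ~` U01); split.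
  + by apply: measurableU => //; exact: measurableC.
  + rewrite [LHS]lebUE setIUl setICl setU0.
    apply: subset_measure0 N0 => //; exact: measurableI.
  + move=> x /= Px; have [xU|xU] := pselect (U01 x); last by right.
    by left; apply: sN => /= /(_ xU).
Qed.

(** Almost everywhere for [lebU], phrased with Lebesgue measure so that
results on integrals over intervals apply. *)
Definition ae01 (P : set R) := \forall x \ae mu, U01 x -> P x.

Lemma ae01_imp (P Q : set R) : (forall x, U01 x -> P x -> Q x) -> ae01 P -> ae01 Q.
Proof.
move=> PQ [N [mN N0 sN]]; exists N; split => // x /= Qx; apply: sN => /= Px.
by apply: Qx => xU; exact/PQ/Px.
Qed.

Lemma ae01W (P : set R) : (forall x, U01 x -> P x) -> ae01 P.
Proof.
move=> hP; exists set0; split; [exact: measurable0 | exact: measure0 |].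
by move=> x /= /not_implyP[xU]; case; exact: hP.
Qed.

Lemma ae01_all (P : nat -> set R) : (forall n, ae01 (P n)) ->
  ae01 (fun x => forall n, P n x).
Proof.
move=> aP; have /negligible_bigcup : forall n, mu.-negligible (~` (fun x => U01 x -> P n x)).
  by move=> n; exact: aP.
apply: negligibleS => x /= h.
apply: contrapT => h1; apply: h => xU n; apply: contrapT => h2; apply: h1.
by exists n => //= /(_ xU).
Qed.

Lemma ae01_and (P Q : set R) : ae01 P -> ae01 Q -> ae01 (P `&` Q).
Proof.
move=> aP aQ; have : ae01 (fun x => forall n, (fun n => if n is 0%N then P else Q) n x).
  by apply: ae01_all => -[|n].
by apply: ae01_imp => x _ h; split; [exact: (h 0%N)|exact: (h 1%N)].
Qed.

Lemma ae01_neq (a : R) : ae01 (fun x => x != a).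
Proof.
exists [set a]; split; first exact: measurable_set1.
- by rewrite lebesgue_measure_set1.
- by move=> x /= /not_implyP[_ /negP]; rewrite negbK => /eqP.
Qed.

Lemma ae01_seq (s : seq R) : ae01 (fun x => x \notin s).
Proof.
elim: s => [|a s IH]; first by apply: ae01W.
by apply: ae01_imp (ae01_and (ae01_neq a) IH) => x _ [xa xs]; rewrite inE negb_or xa.
Qed.

Lemma ae01_oo (P : set R) : (forall x, 0 < x < 1 -> P x) -> ae01 P.
Proof.
move=> hP; apply: ae01_imp (ae01_and (ae01_neq 0) (ae01_neq 1)) => x /=.
rewrite in_itv/= => /andP[x0 x1] [n0 n1]; apply: hP.
by rewrite !lt_neqAle x0 x1 eq_sym n0 n1.
Qed.

Definition sqn u : \bar R := (\int[mu]_(x in U01) ((u x) ^+ 2)%:E)%E.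

Definition inL2 u := measurable_fun setT u /\ (sqn u < +oo)%E.

(** The squared norm as a real number, to be used under [inL2] only: an
infinite norm is sent to 0. *)
Definition nsq u : R := fine (sqn u).

Lemma sqn_ge0 u : (0 <= sqn u)%E.
Proof. by apply: integral_ge0 => x _; rewrite lee_fin sqr_ge0. Qed.

Lemma nsq_ge0 u : 0 <= nsq u.
Proof. by rewrite fine_ge0 // sqn_ge0. Qed.

Lemma nsqE u : inL2 u -> (nsq u)%:E = sqn u.
Proof. by move=> [mu_ fu]; rewrite fineK // ge0_fin_numE // sqn_ge0. Qed.

Lemma measurable_sqr u : measurable_fun setT u ->
  measurable_fun setT (fun x => (u x ^+ 2)%:E).
Proof. by move=> mu_; apply/measurable_EFinP; apply: measurable_funX. Qed.

Lemma measurable_sqrU u (D : set R) : measurable_fun setT u ->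
  measurable_fun D (fun x => (u x ^+ 2)%:E).
Proof. by move=> mu_; apply: measurable_funTS; exact: measurable_sqr. Qed.

Lemma sqn_lebU u : measurable_fun setT u ->
  (\int[lebU]_x (u x ^+ 2)%:E)%E = sqn u.
Proof. by move=> mu_; rewrite integral_lebU //; exact: measurable_sqr. Qed.

Lemma inL2_Lfun u : (u \in Lfun (@lebU R) 2%:E) <-> inL2 u.
Proof.
split.
- move=> uL.
  have mu_ : measurable_fun setT u.
    by move: uL; rewrite inE => /andP[+ _]; rewrite inE.
  split => //; rewrite -sqn_lebU//.
  have /integrableP[_] := Lfun2_integrable_sqr uL.
  by under eq_integral => x _ do rewrite /= ger0_norm ?sqr_ge0//.
- move=> [mu_ ufin]; rewrite inE; apply/andP; split; rewrite inE//=.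
  rewrite /finite_norm unlock /Lnorm poweR_lty//.
  rewrite (_ : (\int[_]__ _)%E = sqn u)//.
  rewrite -sqn_lebU//; apply: eq_integral => x _ /=.
  by rewrite powR_mulrn// -normrX ger0_norm ?sqr_ge0.
Qed.

Lemma inL2_L2U (f : L2U R) : inL2 f.
Proof.
have mf : measurable_fun setT f by apply: measurable_funP.
have ff : finite_norm (@lebU R) 2%:E f by exact: Lebesgue_finite.
by apply/inL2_Lfun; rewrite inE; apply/andP; split; rewrite inE.
Qed.

Lemma sqn_L2norm u : measurable_fun setT u ->
  (('N[@lebU R]_2[EFin \o u]) = sqn u `^ 2^-1)%E.
Proof.
move=> mu_; rewrite unlock /Lnorm -sqn_lebU//; congr (_ `^ _)%E.
apply: eq_integral => x _ /=.
by rewrite powR_mulrn// -normrX ger0_norm ?sqr_ge0.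
Qed.

Lemma sqn_ae u v : measurable_fun setT u -> measurable_fun setT v ->
  ae01 (fun x => u x = v x) -> sqn u = sqn v.
Proof.
move=> mu_ mv uv; apply: ge0_ae_eq_integral => //.
- exact: measurable_sqrU.
- exact: measurable_sqrU.
- by move=> x _; rewrite lee_fin sqr_ge0.
- by move=> x _; rewrite lee_fin sqr_ge0.
- by apply: ae01_imp uv => x _ /= ->.
Qed.

Lemma le_sqn u v : measurable_fun setT u -> measurable_fun setT v ->
  ae01 (fun x => `|u x| <= `|v x|) -> (sqn u <= sqn v)%E.
Proof.
move=> mu_ mv uv; apply: ae_ge0_le_integral => //.
- by move=> x _; rewrite lee_fin sqr_ge0.
- exact: measurable_sqrU.
- by move=> x _; rewrite lee_fin sqr_ge0.
- exact: measurable_sqrU.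
- apply: ae01_imp uv => x _ /= uvx.
  rewrite lee_fin -[leLHS]real_normK ?num_real// -[leRHS]real_normK ?num_real//.
  by rewrite lerXn2r ?nnegrE.
Qed.

Lemma sqnZ (c : R) u : measurable_fun setT u ->
  sqn (fun x => c * u x) = ((c ^+ 2)%:E * sqn u)%E.
Proof.
move=> mu_; rewrite /sqn -ge0_integralZl_EFin ?sqr_ge0//.
- by apply: eq_integral => x _; rewrite exprMn EFinM.
- by move=> x _; rewrite lee_fin sqr_ge0.
- exact: measurable_sqrU.
Qed.

(** For a = 1 this is the parallelogram law; dropping the second term on the
left gives [nsqD_le] for every weight. *)
Lemma sqn_parallelogram (a : R) u v : a != 0 -> measurable_fun setT u -> measurable_fun setT v ->
  (sqn (u \+ v)%R + sqn ((fun x => a * u x) \- (fun x => a^-1 * v x))%R =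
   (1 + a ^+ 2)%:E * sqn u + (1 + a ^- 2)%:E * sqn v)%E.
Proof.
move=> a0 mu_ mv.
have m2 w : measurable_fun setT w -> measurable_fun (U01 : set R) (fun x => (w x ^+ 2)%:E).
  by move=> ?; exact: measurable_sqrU.
have p2 w x : (0 <= (w x ^+ 2)%:E :> \bar R)%E by rewrite lee_fin sqr_ge0.
have q2 b : (0 <= (1 + b ^+ 2)%:E :> \bar R)%E by rewrite lee_fin addr_ge0 ?sqr_ge0.
rewrite -exprVn /sqn -!ge0_integralZl_EFin ?addr_ge0 ?sqr_ge0//; try exact: m2.
rewrite -!ge0_integralD//;
  try (by move=> x _; rewrite mule_ge0);
  try (by apply: emeasurable_funM => //; exact: m2);
  try (by apply: m2; exact: measurable_funD);
  try (by apply: m2; apply: measurable_funB; exact: measurable_funM).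
by apply: eq_integral => x _ /=; rewrite -!EFinM -!EFinD; congr EFin; field.
Qed.

Lemma inL2D u v : inL2 u -> inL2 v -> inL2 (u \+ v).
Proof.
move=> [mu_ fu] [mv fv]; split; first exact: measurable_funD.
apply: (@le_lt_trans _ _ ((1 + 1 ^+ 2)%:E * sqn u + (1 + 1 ^- 2)%:E * sqn v)%E); last first.
  by rewrite lte_add_pinfty// lte_mul_pinfty// lee_fin addr_ge0// invr_ge0.
by rewrite -sqn_parallelogram ?oner_eq0// leeDl// sqn_ge0.
Qed.

Lemma inL2Z (c : R) u : inL2 u -> inL2 (fun x => c * u x).
Proof.
move=> [mu_ fu]; split; first exact: measurable_funM.
by rewrite sqnZ// lte_mul_pinfty// lee_fin sqr_ge0.
Qed.

Lemma inL2B u v : inL2 u -> inL2 v -> inL2 (u \- v).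
Proof.
move=> uL /(@inL2Z (-1)) vL; have := inL2D uL vL.
by under eq_fun do rewrite mulN1r.
Qed.

Lemma nsqZ (c : R) u : inL2 u -> nsq (fun x => c * u x) = c ^+ 2 * nsq u.
Proof. by move=> [mu_ fu]; rewrite /nsq sqnZ// fineM//= -nsqE. Qed.

Lemma nsqB_sym u v : nsq (u \- v) = nsq (v \- u).
Proof.
by rewrite /nsq /sqn; congr fine; apply: eq_integral => x _ /=; rewrite -sqrrN opprB.
Qed.

Lemma nsq_parallelogram (a : R) u v : a != 0 -> inL2 u -> inL2 v ->
  nsq (u \+ v) + nsq ((fun x => a * u x) \- (fun x => a^-1 * v x)) =
  (1 + a ^+ 2) * nsq u + (1 + a ^- 2) * nsq v.
Proof.
move=> a0 uL vL; apply: EFin_inj; rewrite !EFinD !EFinM !nsqE//.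
- by apply: sqn_parallelogram => //; [exact: uL.1|exact: vL.1].
- by apply: inL2B; exact: inL2Z.
- exact: inL2D.
Qed.

Lemma nsq_ae u v : inL2 u -> inL2 v -> ae01 (fun x => u x = v x) -> nsq u = nsq v.
Proof. by move=> uL vL uv; congr fine; apply: sqn_ae => //; [exact: uL.1|exact: vL.1]. Qed.

Lemma inL2_le u v : measurable_fun setT u -> inL2 v ->
  ae01 (fun x => `|u x| <= `|v x|) -> inL2 u.
Proof.
by move=> mu_ [mv fv] uv; split => //; apply: le_lt_trans fv; exact: le_sqn.
Qed.

Lemma inL2_cst (c : R) : inL2 (cst c).
Proof.
split; first exact: measurable_cst.
rewrite /sqn (_ : (\int[_]_(x in _) _)%E = (\int[mu]_(x in U01) cst (c ^+ 2)%:E x)%E)//.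
rewrite integral_cst//= lebesgue_measure_itv/= lte_fin ltr01.
by rewrite -EFinD -EFinM ltry.
Qed.

Lemma nsq_cst (c : R) : nsq (cst c) = c ^+ 2.
Proof.
rewrite /nsq /sqn (_ : (\int[_]_(x in _) _)%E = (\int[mu]_(x in U01) cst (c ^+ 2)%:E x)%E)//.
rewrite integral_cst//= lebesgue_measure_itv/= lte_fin ltr01.
by rewrite -EFinD -EFinM/= subr0 mulr1.
Qed.

Lemma inL2_bounded (M : R) u : measurable_fun setT u ->
  ae01 (fun x => `|u x| <= M) -> inL2 u.
Proof.
move=> mu_ uM; apply: (inL2_le mu_ (inL2_cst M)).
by apply: ae01_imp uM => x _ /= h; rewrite (le_trans h)// ler_norm.
Qed.

Lemma nsqD_le (d : R) u v : 0 < d -> inL2 u -> inL2 v ->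
  nsq (u \+ v) <= (1 + d) * nsq u + (1 + d^-1) * nsq v.
Proof.
move=> d0 uL vL; have a0 : Num.sqrt d != 0 by rewrite gt_eqF ?sqrtr_gt0.
have := nsq_parallelogram a0 uL vL; rewrite sqr_sqrtr ?(ltW d0)// => <-.
by rewrite lerDl nsq_ge0.
Qed.

Lemma nsqD_le2 u v : inL2 u -> inL2 v -> nsq (u \+ v) <= 2 * nsq u + 2 * nsq v.
Proof. by move=> uL vL; have := nsqD_le ltr01 uL vL; rewrite invr1. Qed.

Lemma fatou_sqn (w_ : nat -> R -> R) w : (forall n, measurable_fun setT (w_ n)) ->
  measurable_fun setT w -> ae01 (fun x => w_ n x @[n --> \oo] --> w x) ->
  (sqn w <= limn_einf (fun n => sqn (w_ n)))%E.
Proof.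
move=> mw_ mw cw.
have m2 n : measurable_fun (U01 : set R) (fun x => (w_ n x ^+ 2)%:E).
  exact: measurable_sqrU.
have p2 n (x : R) : U01 x -> (0 <= (w_ n x ^+ 2)%:E)%E by rewrite lee_fin sqr_ge0.
apply: le_trans (fatou mu (measurable_itv _) m2 p2).
apply: ae_ge0_le_integral => //.
- by move=> x _; rewrite lee_fin sqr_ge0.
- exact: measurable_sqrU.
- move=> x xU; rewrite -[limn_einf _]/(limf_einf _ \oo) limf_einfE.
  apply: (@le_trans _ _ (ereal_inf ((fun n => (w_ n x ^+ 2)%:E) @` setT))).
    by apply: le_ereal_inf_tmp => _ [n _ <-]; exact: p2.
  by apply: ereal_sup_ubound; exists setT => //; exact: filterT.
- apply: (@measurableT_comp _ _ _ _ _ _ -%E) => //.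
  apply: measurable_fun_limn_esup => n.
  by apply: (@measurableT_comp _ _ _ _ _ _ -%E) => //; exact: m2.
- apply: ae01_imp cw => x _ /= cwx.
  have : (w_ n x ^+ 2)%:E @[n --> \oo] --> (w x ^+ 2)%:E.
    by apply: cvg_EFin; [exact: nearW|apply: cvgM].
  by move/cvg_limn_einf_sup => [-> _].
Qed.

Lemma lt_limn_einf (a : \bar R) (s : nat -> \bar R) : (a < limn_einf s)%E ->
  \forall n \near \oo, (a < s n)%E.
Proof.
rewrite -[limn_einf _]/(limf_einf _ \oo) limf_einfE => /ereal_sup_gt[_ [V nV <-]] h.
apply: filterS nV => n Vn; apply: (lt_le_trans h).
by apply: ereal_inf_lbound; exists n.
Qed.

(** Fatou's lemma bounds nsq (u_n + u) below by 4 nsq u in the limit, and the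
parallelogram law then leaves nothing for nsq (u_n - u). *)
Lemma radon_riesz (u_ : nat -> R -> R) u : (forall n, inL2 (u_ n)) -> inL2 u ->
  ae01 (fun x => u_ n x @[n --> \oo] --> u x) ->
  (forall e, 0 < e -> \forall n \near \oo, nsq (u_ n) <= nsq u + e) ->
  nsq (u_ n \- u) @[n --> \oo] --> 0.
Proof.
move=> unL uL cu lim_le.
have dL n : inL2 (u_ n \- u) by exact: inL2B.
have sL n : inL2 (u_ n \+ u) by exact: inL2D.
(* the parallelogram law turns Fatou's bound on the sums into one on the differences *)
have F : ((4 * nsq u)%:E <= limn_einf (fun n => sqn (u_ n \+ u)%R))%E.
  rewrite (_ : 4 = 2 ^+ 2); last by ring.
  rewrite -nsqZ// nsqE; last exact: inL2Z.
  apply: fatou_sqn => [n||]; [exact: (sL n).1|exact: (inL2Z 2 uL).1|].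
  apply: ae01_imp cu => x _ /= cux.
  rewrite (_ : 2 * u x = u x + u x); last by ring.
  by apply: cvgD => //; exact: cvg_cst.
apply/cvgrPdist_lt => e e0.
have e2 : 0 < e / 4 by rewrite divr_gt0.
have lt4 : ((4 * nsq u - e / 4)%:E < limn_einf (fun n => sqn (u_ n \+ u)%R))%E.
  by apply: lt_le_trans F; rewrite lte_fin ltrBlDr ltrDl.
have : \forall n \near \oo, ((4 * nsq u - e / 4)%:E < sqn (u_ n \+ u)%R)%E.
  exact: lt_limn_einf.
move=> A; have B := lim_le _ e2; near=> n.
rewrite sub0r normrN ger0_norm ?nsq_ge0//.
have := nsq_parallelogram (oner_neq0 R) (unL n) uL; rewrite invr1 expr1n invr1.
under eq_fun do rewrite mul1r.
rewrite (_ : (fun x => 1 * u x) = u); last by apply/funext => x; rewrite mul1r.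
have : 4 * nsq u - e / 4 < nsq (u_ n \+ u).
  by rewrite -lte_fin nsqE//; near: n.
have : nsq (u_ n) <= nsq u + e / 4 by near: n.
lra.
Unshelve. all: by end_near. Qed.

Lemma L2cvgP (f_ : nat -> L2U R) (f : L2U R) :
  L2cvg f_ f <-> nsq (f_ n \- f) @[n --> \oo] --> 0.
Proof.
have dL n : inL2 (f_ n \- f) by apply: inL2B; exact: inL2_L2U.
have E n : 'N[@lebU R]_2[(fun x => (f_ n x - f x)%:E)]%E = (Num.sqrt (nsq (f_ n \- f)))%:E.
  rewrite [LHS](sqn_L2norm (dL n).1) -nsqE// poweR_EFin; congr EFin.
  by rewrite powR12_sqrt// nsq_ge0.
rewrite /L2cvg; under eq_fun do rewrite E.
split.
- move=> /fine_cvgP[_ /= h].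
  have : (Num.sqrt (nsq (f_ n \- f))) ^+ 2 @[n --> \oo] --> (0 : R) ^+ 2.
    by rewrite expr2; under eq_fun do rewrite expr2; exact: cvgM.
  rewrite expr0n /=; under eq_fun do rewrite sqr_sqrtr ?nsq_ge0//.
  by [].
- move=> h; apply: cvg_EFin; first exact: nearW.
  rewrite -(sqrtr0 R); apply: continuous_cvg => //; exact: sqrt_continuous.
Qed.

Lemma measurable_aeEqMfun (q : aeEqMfun (measurableTypeR R) (@lebU R)) :
  measurable_fun setT (q : R -> R).
Proof. by rewrite /aqEqMfun_to_fun; case: (repr q) => s [[h]]; exact: h. Qed.

Lemma L2U_of u : inL2 u -> exists f : L2U R, ae01 (fun x => f x = u x).
Proof.
move=> uL.
have mum : measurable_fun setT (u : measurableTypeR R -> measurableTypeR R) by exact: uL.1.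
pose m : {mfun (measurableTypeR R) >-> (measurableTypeR R)} :=
  HB.pack (u : measurableTypeR R -> measurableTypeR R)
  (@isMeasurableFun.Build _ _ (measurableTypeR R) (measurableTypeR R) u mum).
pose q : aeEqMfun (measurableTypeR R) (@lebU R) := (\pi m)%qT.
have qm : ae01 (fun x => q x = u x).
  have : (repr q = m %[mod aeEqMfun (measurableTypeR R) (@lebU R)])%qT by rewrite reprK.
  move=> /eqmodP /asboolP h; apply/ae_lebU.
  by case: h => N [mN N0 sN]; exists N; split => // x /= qu; apply: sN => /= /(_ I).
have qf : finite_norm (@lebU R) 2%:E q.
  have mq := measurable_aeEqMfun q.
  have /inL2_Lfun : inL2 q.
    by split => //; rewrite (sqn_ae mq uL.1 qm); exact: uL.2.
  by rewrite inE => /andP[_]; rewrite inE.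
pose f : L2U R := HB.pack q (@isFinLebesgue.Build _ _ _ (@lebU R) 2%:E (lee1n 2) q qf).
by exists f.
Qed.

End L2.

(** * Limits along an ultrafilter of indices *)

Section ultra.
Variable R : realType.
Variable U : set_system nat.
Hypothesis UU : UltraFilter U.
Hypothesis Uoo : \oo `<=` U.

Lemma ultra_bounded (f : nat -> R) (M : R) : U [set s | `|f s| <= M] ->
  exists l : R, f @ U --> l.
Proof.
move=> fM.
have := @segment_compact R (- M) M; rewrite compact_ultra.
have UfU : UltraFilter (f @ U).
  split; first exact: fmap_proper_filter.
  move=> G GG UG; rewrite eqEsubset; split => [A GA|]; last exact: UG.
  have [//|UnA] := in_ultra_setVsetC (f @^-1` A) UU.
  have /UG nA : (f @ U) (~` A) by exact: UnA.
  by have [y [/= nAy Ay]] := filter_ex (filterI nA GA).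
move=> /(_ (f @ U) UfU) [].
  suff : U (f @^-1` `[- M, M]) by [].
  by apply: filterS fM => s /=; rewrite in_itv/= -ler_norml.
by move=> l [_ cell]; exists l.
Qed.

Definition ulim (f : nat -> R) : R := lim (f @ U).

Lemma ulimP (f : nat -> R) (M : R) : U [set s | `|f s| <= M] -> f @ U --> ulim f.
Proof. by move=> /ultra_bounded[l cell]; rewrite /ulim (cvg_lim _ cell). Qed.

Lemma ultra_nat (N : nat -> nat) m : U [set s | (N s <= m)%N] ->
  exists n, U [set s | N s = n].
Proof.
elim: m => [|m IH] h.
  by exists 0%N; apply: filterS h => s /=; rewrite leqn0 => /eqP.
have [|] := in_ultra_setVsetC [set s | N s = m.+1] UU; first by exists m.+1.
move=> h'; apply: IH; apply: filterS (filterI h h') => s [/= h1 h2].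
by rewrite -ltnS ltn_neqAle h1 andbT; apply/eqP.
Qed.

(** A limit along an ultrafilter is not the limit of a subsequence, but the
k-th of countably many conditions can be imposed from the k-th step of a
subsequence; this is how convergence at countably many points is kept. *)
Lemma ultra_extract (P : nat -> set nat) : (forall k, U (P k)) ->
  exists sub : nat -> nat, {homo sub : i j / (i < j)%N} /\ forall k, P k (sub k).
Proof.
move=> UP.
have ex k m : exists s, P k s /\ (m < s)%N.
  have : U [set s | (m < s)%N] by apply: Uoo; exists m.+1.
  by move=> /(filterI (UP k)) /filter_ex[s [Ps ms]]; exists s.
pose next k m := projT1 (cid (ex k m)).
have nextP k m : P k (next k m) /\ (m < next k m)%N by exact: projT2 (cid (ex k m)).
pose sub := fix sub k := if k is k'.+1 then next k (sub k') else next 0%N 0%N.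
exists sub; split.
- apply: homo_ltn => [|k]; first exact: ltn_trans.
  exact: (nextP k.+1 (sub k)).2.
- by case => [|k]; [exact: (nextP _ _).1|exact: (nextP k.+1 (sub k)).1].
Qed.

End ultra.

(** * Removing jumps from a function with controlled increments *)

Section jumps.
Variable R : realType.
Implicit Types (h A F : R -> R) (p : seq R) (x y z M : R).

(** The intervals of radius r x around h x pairwise meet; the supremum of their
left ends lies in all of them. *)
Lemma interpolate (S : set R) h (r : R -> R) :
  (forall x y, S x -> S y -> h x - r x <= h y + r y) ->
  exists a, forall x, S x -> `|a - h x| <= r x.
Proof.
move=> H; pose E := [set h x - r x | x in S].
have [[x0 Sx0]|S0] := pselect (S !=set0); last first.
  by exists 0 => x Sx; exfalso; apply: S0; exists x.
have supE : has_sup E.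
  split; first by exists (h x0 - r x0), x0.
  by exists (h x0 + r x0) => _ [x Sx <-]; exact: H.
exists (sup E) => x Sx; rewrite ler_distl; apply/andP; split.
- by apply: sup_ubound; [exact: supE.2|exists x].
- by apply: ge_sup; [exact: supE.1|move=> _ [y Sy <-]; exact: H].
Qed.

Lemma sqr_le_norm (a b : R) : 0 <= b -> a ^+ 2 <= b ^+ 2 -> `|a| <= b.
Proof. by move=> b0; rewrite -[_ ^+ 2 in leLHS]real_normK ?num_real// ler_pXn2r ?nnegrE. Qed.

Lemma cvg_sqr (F : set_system nat) {FF : Filter F} (u_ : nat -> R) (l : R) :
  u_ j @[j --> F] --> l -> u_ j ^+ 2 @[j --> F] --> l ^+ 2.
Proof.
move=> cu; rewrite expr2 (_ : (fun s => u_ s ^+ 2) = (fun s => u_ s * u_ s)); first exact: cvgM.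
by apply/funext => s; rewrite expr2.
Qed.

(** The Cauchy-Schwarz inequality in dimension 2, for the square roots of the
a_i and the b_i. *)
Lemma sqr_sum_le (s t a1 b1 a2 b2 : R) :
  0 <= a1 -> 0 <= b1 -> 0 <= a2 -> 0 <= b2 ->
  s ^+ 2 <= a1 * b1 -> t ^+ 2 <= a2 * b2 -> (s + t) ^+ 2 <= (a1 + a2) * (b1 + b2).
Proof.
move=> a10 b10 a20 b20 hs ht.
have st : (s * t) ^+ 2 <= ((a1 * b2 + a2 * b1) / 2) ^+ 2.
  apply: (@le_trans _ _ ((a1 * b2) * (a2 * b1))).
    rewrite exprMn.
    rewrite (_ : a1 * b2 * (a2 * b1) = (a1 * b1) * (a2 * b2)); last by ring.
    by apply: ler_pM => //; exact: sqr_ge0.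
  rewrite -subr_ge0 (_ : _ - _ = ((a1 * b2 - a2 * b1) / 2) ^+ 2) ?sqr_ge0//.
  by field.
have {}st : s * t <= (a1 * b2 + a2 * b1) / 2.
  apply: (le_trans (ler_norm _)).
  rewrite -(@ler_pXn2r _ 2) ?nnegrE ?normr_ge0// ?real_normK ?num_real//.
  by rewrite divr_ge0// addr_ge0// mulr_ge0.
nra.
Qed.

Definition avoids p x y := forall z, z \in p -> ~ (x <= z <= y).

(** With A the energy of the derivative up to x and M = 1 this is the
Cauchy-Schwarz inequality for a primitive; [ctrl_density] is the converse. *)
Definition ctrl M h A x y := (h y - h x) ^+ 2 <= M * (y - x) * (A y - A x).

Definition jumpfun (cs : seq (R * R)) x := \sum_(c <- cs) (if c.1 <= x then c.2 else 0).

Lemma ctrl_trans M h A (a b c d : R) x y z : {homo A : x y / x <= y} -> 0 <= M ->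
  x <= z -> z <= y ->
  (b - a) ^+ 2 <= M * (z - x) * (A z - A x) ->
  (d - c) ^+ 2 <= M * (y - z) * (A y - A z) ->
  ((d - c) + (b - a)) ^+ 2 <= M * (y - x) * (A y - A x).
Proof.
move=> Am M0 xz zy h1 h2.
rewrite (_ : M * (y - x) * (A y - A x) =
  (M * (y - z) + M * (z - x)) * ((A y - A z) + (A z - A x))); last by ring.
by apply: sqr_sum_le => //; rewrite ?mulr_ge0 ?subr_ge0 ?Am.
Qed.

(** Of two points on the same side of z, the farther one has a radius
sqrt (M (z - x) (A z - A x)) that dominates the oscillation of h between
them, so [interpolate] applies. *)
Lemma ctrl_extend M h A (S : set R) z : {homo A : x y / x <= y} -> 0 <= M ->
  (forall x y, S x -> S y -> x < y -> ctrl M h A x y) ->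
  (forall x, S x -> x <= z) \/ (forall x, S x -> z <= x) ->
  exists a, forall x, S x -> (a - h x) ^+ 2 <= M * (z - x) * (A z - A x).
Proof.
move=> Am M0 H side; pose r2 x := M * (z - x) * (A z - A x).
have r2N x : r2 x = M * (x - z) * (A x - A z) by rewrite /r2; ring.
have r2_ge0 x : S x -> 0 <= r2 x.
  case: side => side /side xz; first by rewrite /r2 !mulr_ge0 ?subr_ge0 ?Am.
  by rewrite r2N !mulr_ge0 ?subr_ge0 ?Am.
have osc x y : S x -> S y -> (h y - h x) ^+ 2 <= r2 x + r2 y.
  wlog xy : x y / x < y => [W|] Sx Sy.
    have [xy|yx|->] := ltgtP x y; [exact: W| |by rewrite subrr expr0n addr_ge0 ?r2_ge0].
    by rewrite [r2 x + _]addrC -[_ ^+ 2]sqrrN opprB; exact: W.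
  apply: (le_trans (H x y Sx Sy xy)); case: side => side.
  - have yz := side y Sy; apply: (le_trans (y := r2 x)); last by rewrite lerDl r2_ge0.
    apply: ler_pM; rewrite ?mulr_ge0 ?subr_ge0 ?Am ?(ltW xy)//.
      by rewrite ler_wpM2l// lerB.
    by rewrite lerB// Am.
  - have zx := side x Sx; apply: (le_trans (y := r2 y)); last by rewrite lerDr r2_ge0.
    rewrite r2N; apply: ler_pM; rewrite ?mulr_ge0 ?subr_ge0 ?Am ?(ltW xy)//.
      by rewrite ler_wpM2l// lerB.
    by rewrite lerB// Am.
have [|a aP] := @interpolate S h (fun x => Num.sqrt (r2 x)).
  move=> x y Sx Sy; have s1 := sqrtr_ge0 (r2 x); have s2 := sqrtr_ge0 (r2 y).
  have : `|h y - h x| <= Num.sqrt (r2 x) + Num.sqrt (r2 y).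
    apply: sqr_le_norm; first exact: addr_ge0.
    apply: (le_trans (osc x y Sx Sy)).
    have e1 := sqr_sqrtr (r2_ge0 x Sx); have e2 := sqr_sqrtr (r2_ge0 y Sy).
    by rewrite -{1}e1 -{1}e2 sqrrD lerD2r lerDl mulrn_wge0// mulr_ge0.
  by rewrite ler_norml => /andP[]; lra.
exists a => x Sx; rewrite -/(r2 x) -[leRHS]sqr_sqrtr ?r2_ge0//.
by rewrite -real_normK ?num_real// lerXn2r ?nnegrE ?aP.
Qed.


(** Induction on the list: [ctrl_extend] provides one-sided limits a and b of h
at its first point z, and subtracting b - a to the right of z makes the
estimate hold across z while changing no increment on either side. *)
Lemma jump_removal M h A p : {homo A : x y / x <= y} -> 0 <= M ->
  (forall x y, 0 < x -> x < y -> y < 1 -> avoids p x y -> ctrl M h A x y) ->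
  exists (cs : seq (R * R)) F,
    [/\ (size cs <= size p)%N,
        forall c, c \in cs -> 0 < c.1 < 1,
        forall x, 0 < x < 1 -> x \notin p -> h x = jumpfun cs x + F x
      & forall x y, 0 < x -> x < y -> y < 1 -> ctrl M F A x y].
Proof.
move=> Am M0; elim: p h => [|z p IH] h H.
  exists [::], h; split => //.
  - by move=> x x01 _; rewrite /jumpfun big_nil add0r.
  - by move=> x y x0 xy y1; apply: H.
have [zp|/negP zp] := pselect ((z \in p) || ~~ (0 < z < 1)).
  have [|cs [F [scs c01 hF ctF]]] := IH h.
    move=> x y x0 xy y1 av; apply: H => // w; rewrite inE => /predU1P[->|]; last exact: av.
    case/orP: zp => [|z01]; first exact: av.
    move=> /andP[xz zy]; case/negP: z01.
    by rewrite (lt_le_trans x0 xz) (le_lt_trans zy y1).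
  exists cs, F; split => //; first exact: leqW.
  by move=> x x01; rewrite inE negb_or => /andP[_]; exact: hF.
move: zp; rewrite negb_or negbK => /andP[zp /andP[z0 z1]].
have split2 x y : ~ (x <= z <= y) -> avoids p x y -> avoids (z :: p) x y.
  by move=> nz av w; rewrite inE => /predU1P[->//|]; exact: av.
(* the value extending h to z from the left, and the one from the right *)
have [||a aP] := @ctrl_extend M h A [set x | 0 < x < z /\ avoids p x z] z Am M0.
- move=> x y /= [/andP[x0 _] ax] [/andP[_ yz] _] xy; apply: H => //; first exact: lt_trans z1.
  apply: split2; first by move=> /andP[_]; rewrite leNgt yz.
  by move=> w /ax nw /andP[xw wy]; apply: nw; rewrite xw (le_trans wy)// ltW.
- by left=> x /= [/andP[_ /ltW]].
have [||b bP] := @ctrl_extend M h A [set x | z < x < 1 /\ avoids p z x] z Am M0.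
- move=> x y /= [/andP[zx _] _] [/andP[_ y1] ay] xy; apply: H => //; first exact: lt_trans zx.
  apply: split2; first by move=> /andP[+ _]; rewrite leNgt zx.
  by move=> w /ay nw /andP[xw wy]; apply: nw; rewrite wy (le_trans _ xw)// ltW.
- by right=> x /= [/andP[/ltW]].
have aS x : 0 < x -> x < z -> avoids p x z -> (a - h x) ^+ 2 <= M * (z - x) * (A z - A x).
  by move=> x0 xz av; apply: aP; rewrite /= x0 xz.
have bS y : z < y -> y < 1 -> avoids p z y -> (h y - b) ^+ 2 <= M * (y - z) * (A y - A z).
  move=> zy y1 av; rewrite -[leLHS]sqrrN opprB.
  rewrite (_ : M * _ * _ = M * (z - y) * (A z - A y)); last by ring.
  by apply: bP; rewrite /= zy y1.
pose h' x := if x < z then h x else if x == z then a else h x - (b - a).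
have [|cs [F [scs c01 hF ctF]]] := IH h'.
  move=> x y x0 xy y1 av; rewrite /ctrl /h'.
  have [yz|zy|yz] := ltgtP y z.
  - rewrite (lt_trans xy yz); apply: H => //; apply: split2 => //.
    by move=> /andP[_]; rewrite leNgt yz.
  - have [xz|zx|xz] := ltgtP x z.
    + rewrite [X in X ^+ 2](_ : _ = (h y - b) + (a - h x)); last by ring.
      apply: (@ctrl_trans _ h A _ _ _ _ _ _ z) => //; [exact: ltW|exact: ltW| |].
      * by apply: aS => // w /av nw /andP[xw wz]; apply: nw; rewrite xw (le_trans wz)// ltW.
      * by apply: bS => // w /av nw /andP[zw wy]; apply: nw; rewrite wy (le_trans _ zw)// ltW.
    + rewrite [X in X ^+ 2](_ : _ = h y - h x); last by ring.
      apply: H => //; apply: split2 => //.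
      by move=> /andP[+ _]; rewrite leNgt zx.
    + rewrite [X in X ^+ 2](_ : _ = h y - b); last by ring.
      by rewrite xz; apply: bS => //; rewrite -xz.
  - by rewrite -yz xy; move: y1 xy av; rewrite yz => _ xz av; apply: aS.
exists ((z, b - a) :: cs), F; split => //.
- by move=> c; rewrite inE => /predU1P[->/=|]; [rewrite z0 z1|exact: c01].
- move=> x x01; rewrite inE negb_or => /andP[xz xp].
  have := hF x x01 xp; rewrite /h' /jumpfun big_cons /= (negbTE xz).
  case: (ltP x z) => _ E; first by rewrite add0r E.
  by rewrite -addrA -E; ring.
Qed.

End jumps.

(** * Primitives, energies and averages over cells *)

Section primitive.
Variable R : realType.
Implicit Types (u v w : R -> R) (a b x y : R).

Local Notation mu := (@lebesgue_measure R).

Definition integ01 v := mu.-integrable U01 (EFin \o v).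

Definition prim v x : R := \int[mu]_(s in `]0, x]) v s.

Lemma integ01_meas v : integ01 v -> measurable_fun (U01 : set R) v.
Proof. by move=> /measurable_int /measurable_EFinP. Qed.

Lemma inL2_sqr v : inL2 v -> integ01 (fun x => v x ^+ 2).
Proof.
move=> [mv fv]; apply/integrableP; split; first exact: measurable_sqrU.
by under eq_integral => x _ do rewrite /= ger0_norm ?sqr_ge0//.
Qed.

Lemma integ01D u v : integ01 u -> integ01 v -> integ01 (u \+ v).
Proof. by move=> iu iv; rewrite /integ01 (_ : _ \o _ = (EFin \o u) \+ (EFin \o v))%E//; apply: integrableD. Qed.

Lemma integ01Z c v : integ01 v -> integ01 (fun x => c * v x).
Proof. by move=> iv; apply: (@integrableZl _ _ _ mu U01 (measurable_itv _) c (EFin \o v)). Qed.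

Lemma integ01_cst c : integ01 (cst c).
Proof.
apply/integrableP; split; first by apply/measurable_EFinP; apply: measurable_cst.
rewrite (_ : (\int[_]_(x in _) _)%E = (\int[mu]_(x in U01) cst `|c|%:E x)%E)//.
rewrite integral_cst//= lebesgue_measure_itv/= lte_fin ltr01.
by rewrite -EFinD -EFinM ltry.
Qed.

Lemma integ01_le v w : measurable_fun (U01 : set R) v -> integ01 w ->
  (forall x, U01 x -> `|v x| <= w x) -> integ01 v.
Proof.
move=> mv iw vw; apply: (le_integrable _ _ _ iw) => //; first exact/measurable_EFinP.
by move=> x xU /=; rewrite lee_fin (le_trans (vw x xU))// ler_norm.
Qed.

Lemma inL2_integ01 v : inL2 v -> integ01 v.
Proof.
move=> vL; apply: (integ01_le _ (integ01D (integ01_cst 1) (inL2_sqr vL))).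
  by apply: measurable_funTS; exact: vL.1.
move=> x _ /=; rewrite -[v x ^+ 2]real_normK ?num_real//.
have := sqr_ge0 (`|v x| - 1); have := normr_ge0 (v x); nra.
Qed.

Lemma integ01_itv v a b : 0 <= a -> b <= 1 -> integ01 v ->
  mu.-integrable `]a, b] (EFin \o v).
Proof.
move=> a0 b1; apply: integrableS => // x /=; rewrite !in_itv/= => /andP[ax xb].
by rewrite (le_trans xb b1) (ltW (le_lt_trans a0 ax)).
Qed.

Lemma primB v a b : integ01 v -> 0 <= a -> a <= b -> b <= 1 ->
  prim v b - prim v a = \int[mu]_(s in `]a, b]) v s.
Proof.
move=> iv a0 ab b1; rewrite /prim Rintegral_itvB//.
- exact: integ01_itv.
Qed.

Lemma prim0 v : prim v 0 = 0.
Proof. by rewrite /prim set_itv_ge ?bnd_simp// Rintegral_set0. Qed.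

Lemma primD u v x : integ01 u -> integ01 v -> x <= 1 ->
  prim (u \+ v) x = prim u x + prim v x.
Proof. by move=> iu iv x1; rewrite /prim RintegralD//; exact: integ01_itv. Qed.

Lemma primZ c v x : integ01 v -> x <= 1 -> prim (fun s => c * v s) x = c * prim v x.
Proof. by move=> iv x1; rewrite /prim RintegralZl//; exact: integ01_itv. Qed.

Lemma primB_fun u v x : inL2 u -> inL2 v -> x <= 1 -> prim (u \- v) x = prim u x - prim v x.
Proof.
move=> uL vL x1.
have -> : u \- v = u \+ (fun y => -1 * v y) by apply/funext => y /=; rewrite mulN1r.
rewrite primD ?primZ ?mulN1r//; try exact: inL2_integ01.
by apply: inL2_integ01; apply: inL2Z.
Qed.

Lemma prim_cst c x : 0 <= x -> prim (cst c) x = c * x.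
Proof.
move=> x0; rewrite /prim Rintegral_cst//= lebesgue_measure_itv/= lte_fin.
case: ltP => [_|x0']; first by rewrite -EFinD subr0.
by have -> : x = 0; [apply/eqP; rewrite eq_le x0 x0'|rewrite mulr0].
Qed.

Definition energy v x : R := prim (fun s => v s ^+ 2) x.

Lemma ler_prim v a b : integ01 v -> (forall x, 0 <= v x) ->
  0 <= a -> a <= b -> b <= 1 -> prim v a <= prim v b.
Proof.
move=> iv v0 a0 ab b1; rewrite -subr_ge0 primB//.
by apply: Rintegral_ge0.
Qed.

Lemma energy1 v : inL2 v -> energy v 1 = nsq v.
Proof.
move=> vL; rewrite /energy /prim Rintegral_itv_obnd_cbnd//.
by apply: integ01_itv => //; exact: inL2_sqr.
Qed.

Lemma energy_homo v a b : inL2 v -> 0 <= a -> a <= b -> b <= 1 ->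
  energy v a <= energy v b.
Proof.
by move=> vL *; apply: ler_prim => //; [exact: inL2_sqr|move=> x; exact: sqr_ge0].
Qed.

(** Cauchy-Schwarz on ]a, b]: the square of v minus its mean has a nonnegative
integral. *)
Lemma prim_cs v a b : inL2 v -> 0 <= a -> a <= b -> b <= 1 ->
  (prim v b - prim v a) ^+ 2 <= (b - a) * (energy v b - energy v a).
Proof.
move=> vL a0 ab b1; have iv := inL2_integ01 vL.
have [<-|neab] := eqVneq a b; first by rewrite !subrr expr0n mul0r.
have ba : 0 < b - a by rewrite subr_gt0 lt_neqAle neab.
pose m := (prim v b - prim v a) / (b - a).
(* the integral of (v - m)^2 over ]a, b] is nonnegative, m being the mean of v there *)
have i1 := inL2_sqr vL.
have i2 := integ01Z (- (2 * m)) iv.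
have i3 := integ01_cst (m ^+ 2).
have i4 := integ01D (integ01D i1 i2) i3.
have := @ler_prim _ a b i4 _ a0 ab b1.
have h0 x : 0 <= (((fun x0 => v x0 ^+ 2) \+ (fun x0 => - (2 * m) * v x0)) \+ cst (m ^+ 2)) x.
  rewrite /= (_ : _ + _ = (v x - m) ^+ 2) ?sqr_ge0//; ring.
move=> /(_ h0).
have a1 : a <= 1 by exact: le_trans b1.
have b0 : 0 <= b by exact: le_trans ab.
rewrite !primD ?integ01D// !prim_cst// !primZ// -/(energy v a) -/(energy v b).
have mE : prim v b - prim v a = m * (b - a) by rewrite /m divfK// gt_eqF.
set ea := energy v a; set eb := energy v b.
move=> h; have : m ^+ 2 * (b - a) <= eb - ea.
  by move: h mE; set pa := prim v a; set pb := prim v b => h mE; nra.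
move=> h'; rewrite mE (_ : _ ^+ 2 = (b - a) * (m ^+ 2 * (b - a))); last by ring.
by rewrite ler_wpM2l// ltW.
Qed.

Lemma nsq_energy_ge0 v x : inL2 v -> 0 <= x <= 1 -> 0 <= energy v x <= nsq v.
Proof.
move=> vL /andP[x0 x1]; rewrite -energy1// energy_homo// andbT.
by rewrite -[leLHS](prim0 (fun s => v s ^+ 2)); apply: (energy_homo vL).
Qed.

Lemma EFin_prim v x : integ01 v -> x <= 1 ->
  ((prim v x)%:E = \int[mu]_(y in `]0%R, x]) (v y)%:E)%E.
Proof.
move=> iv x1; rewrite /prim /Rintegral fineK//; apply: integrable_fin_num.
  exact: measurable_itv.
exact: integ01_itv.
Qed.

Lemma prim_sqr_le v x : inL2 v -> 0 <= x <= 1 -> prim v x ^+ 2 <= nsq v.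
Proof.
move=> vL x01; have /andP[x0 x1] := x01; have /andP[e0 e1] := nsq_energy_ge0 vL x01.
have := prim_cs vL (lexx 0) x0 x1; rewrite prim0 /energy prim0 !subr0 -/(energy v x).
by move=> /le_trans; apply; apply: le_trans e1; rewrite ler_piMl.
Qed.

Lemma L1_le_L2 (e : R) u : 0 < e -> inL2 u -> nsq u <= e ^+ 2 ->
  (\int[mu]_(x in U01) `|u x|%:E <= e%:E)%E.
Proof.
move=> e0 uL ue; have aL : inL2 (fun x => `|u x|).
  apply: (inL2_le _ uL); first by apply: measurableT_comp => //; exact: uL.1.
  by apply: ae01W => x _; rewrite normr_id.
have au : nsq (fun x => `|u x|) = nsq u.
  by rewrite /nsq /sqn; congr fine; apply: eq_integral => x _; rewrite real_normK ?num_real.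
rewrite -integral_itv_obnd_cbnd; last first.
  by apply/measurable_EFinP; apply: measurable_funTS; exact: aL.1.
rewrite -(EFin_prim (inL2_integ01 aL))// lee_fin.
apply: le_trans (ler_norm _) _; apply: sqr_le_norm; first exact: ltW.
by apply: le_trans ue; rewrite -au prim_sqr_le// ler01 lexx.
Qed.

Lemma lebesgue_itv_oc a b : a <= b -> mu `]a, b] = (b - a)%:E.
Proof.
move=> ab; rewrite lebesgue_measure_itv/= lte_fin; case: ltP => // ba.
by have -> : a = b; [apply/eqP; rewrite eq_le ab|rewrite subrr].
Qed.

Definition cell (n : nat) x : nat := Num.truncn (n%:R * x).

Definition cellpt (n k : nat) : R := k%:R / n%:R.

Definition mean v (n k : nat) : R := n%:R * (prim v (cellpt n k.+1) - prim v (cellpt n k)).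

Lemma cell_itv n x : (0 < n)%N -> 0 <= x -> cellpt n (cell n x) <= x < cellpt n (cell n x).+1.
Proof.
move=> n0 x0; rewrite /cellpt ler_pdivrMr ?ltr0n// ltr_pdivlMr ?ltr0n// mulrC.
by apply: truncn_itv; rewrite mulr_ge0.
Qed.

Lemma cell_lt n x : (0 < n)%N -> 0 <= x -> x < 1 -> (cell n x < n)%N.
Proof.
move=> n0 x0 x1; have /andP[h _] := cell_itv n0 x0.
rewrite -(ltr_nat R); apply: (le_lt_trans (y := n%:R * x)).
  by rewrite mulrC -ler_pdivrMr ?ltr0n.
by rewrite -[ltRHS]mulr1 ltr_pM2l// ltr0n.
Qed.

Lemma cellptS n k : (0 < n)%N -> cellpt n k.+1 = cellpt n k + n%:R^-1.
Proof. by move=> n0; rewrite /cellpt -addn1 natrD mulrDl mul1r. Qed.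

Lemma cellpt_ge0 n k : 0 <= cellpt n k.
Proof. by rewrite divr_ge0. Qed.

Lemma cellpt_le n j k : (0 < n)%N -> (j <= k)%N -> cellpt n j <= cellpt n k.
Proof. by move=> n0 jk; rewrite ler_pM2r ?invr_gt0 ?ltr0n// ler_nat. Qed.

Lemma cellpt_lt n j k : (0 < n)%N -> (j < k)%N -> cellpt n j < cellpt n k.
Proof. by move=> n0 jk; rewrite ltr_pM2r ?invr_gt0 ?ltr0n// ltr_nat. Qed.

Lemma cellpt_nn n : (0 < n)%N -> cellpt n n = 1.
Proof. by move=> n0; rewrite /cellpt divff// pnatr_eq0 -lt0n. Qed.

Lemma cellpt0 n : cellpt n 0 = 0.
Proof. by rewrite /cellpt mul0r. Qed.

Lemma cellpt_le1 n k : (0 < n)%N -> (k <= n)%N -> cellpt n k <= 1.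
Proof. by move=> n0 kn; rewrite -(cellpt_nn n0) cellpt_le. Qed.

Lemma cell_unique n k x : (0 < n)%N -> cellpt n k <= x < cellpt n k.+1 -> cell n x = k.
Proof.
move=> n0 /andP[h1 h2]; apply: truncn_def.
by rewrite -ler_pdivrMl ?ltr0n// -ltr_pdivlMl ?ltr0n// ![n%:R^-1 * _]mulrC h1.
Qed.

Lemma cell_cellpt n k : (0 < n)%N -> cell n (cellpt n k) = k.
Proof. by move=> n0; apply: cell_unique => //; rewrite lexx cellpt_lt. Qed.

(** The cell that contains x is not centred at x, but it is a fixed proportion
of a ball around x, so the differentiation theorem for nicely shrinking sets
applies. *)
Lemma lebesgue_diff v : measurable_fun setT v -> integ01 v ->
  ae01 (fun x => mean v n (cell n x) @[n --> \oo] --> v x).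
Proof.
move=> mv iv; pose f := v \_ U01.
have mf : measurable_fun setT f.
  by apply/(measurable_restrictT _ (measurable_itv _)); exact: measurable_funTS.
have intf : mu.-integrable setT (EFin \o f).
  have := iv; rewrite /integ01 integrable_mkcond// restrict_EFin.
  by [].
have lf : locally_integrable setT f.
  by apply: integrable_locally => //; exact: openT.
(* for negative x there is no cell; any interval starting at x serves *)
pose lo x n := if 0 <= x then cellpt n.+1 (cell n.+1 x) else x.
pose E x n : set R := `]lo x n, lo x n + n.+1%:R^-1]%classic.
have lox x n : lo x n <= x < lo x n + n.+1%:R^-1.
  rewrite /lo; case: ifPn => x0; first by rewrite -cellptS// cell_itv.
  by rewrite lexx ltrDl invr_gt0 ltr0n.
have muE x n : mu (E x n) = (n.+1%:R^-1)%:E.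
  by rewrite /E lebesgue_itv_oc ?lerDl ?invr_ge0// addrC addKr.
have hE x : nicely_shrinking x (E x).
  split; first by move=> n; exact: measurable_itv.
  exists (4, fun n => (2 * n.+1%:R^-1)%:pos); split => //=.
  - rewrite -[X in _ --> X](mulr0 2); apply: cvgMr; exact: cvg_harmonic.
  - move=> n y; rewrite /E /= in_itv/= /ball/= => /andP[h1 h2].
    have /andP[h3 h4] := lox x n; have : 0 < n.+1%:R^-1 :> R by rewrite invr_gt0.
    move: h1 h2 h3 h4; set d : R := n.+1%:R^-1; set l := lo x n => h1 h2 h3 h4 d0.
    by rewrite ltr_norml; apply/andP; split; lra.
  - move=> n; rewrite muE lebesgue_measure_ball// -EFinM lee_fin.
    have d0 : 0 < n.+1%:R^-1 :> R by rewrite invr_gt0.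
    by rewrite le_eqVlt; apply/orP; left; apply/eqP; ring.
have [N [mN N0 sN]] := lebesgue_differentiation lf.
have : ae01 (fun x => lebesgue_pt f x).
  by exists N; split => // x /= h; apply: sN => /= h'; apply: h.
move=> /(ae01_and (ae01_neq 1)); apply: ae01_imp => x /=; rewrite in_itv/= => /andP[x0 x1] [n1 lx].
have := nice_lebesgue_differentiation hE lf lx.
have -> : f x = v x by rewrite /f patchE mem_set//= in_itv/= x0.
move=> h; rewrite -cvg_shiftS /=.
suff -> : (fun n => mean v n.+1 (cell n.+1 x)) = (fun n => fine ((mu (E x n))^-1 * \int[mu]_(y in E x n) (f y)%:E)%E).
  exact: fine_cvg.
apply/funext => n; rewrite muE inver ifF; last by apply/negbTE; rewrite invr_eq0 pnatr_eq0.
rewrite invrK /mean.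
have xlt1 : x < 1 by rewrite lt_neqAle n1.
rewrite primB ?cellpt_ge0 ?cellpt_le ?cellpt_le1 ?cell_lt//.
have EE : `]cellpt n.+1 (cell n.+1 x), cellpt n.+1 (cell n.+1 x).+1]%classic = E x n.
  by rewrite /E /lo x0 cellptS.
rewrite EE.
have -> : (\int[mu]_(y in E x n) (f y)%:E = \int[mu]_(y in E x n) (v y)%:E)%E.
  apply: eq_integral => y; rewrite inE -EE /= in_itv/= => /andP[y1 y2].
  rewrite /f patchE mem_set//= in_itv/=; apply/andP; split.
    by rewrite (le_trans _ (ltW y1))// cellpt_ge0.
  by rewrite (le_trans y2)// cellpt_le1// cell_lt.
have fin : (\int[mu]_(y in E x n) (v y)%:E)%E \is a fin_num.
  have b1 : cellpt n.+1 (cell n.+1 x).+1 <= 1 by rewrite cellpt_le1// cell_lt.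
  have := integ01_itv (cellpt_ge0 n.+1 (cell n.+1 x)) b1 iv.
  by rewrite EE; apply: integrable_fin_num; exact: measurable_itv.
by rewrite fineM.
Qed.

End primitive.

(** * Step functions on a grid, and completeness *)

Section steps.
Variable R : realType.
Implicit Types (u v w : R -> R) (a b x y : R) (s : nat -> R).

Local Notation mu := (@lebesgue_measure R).

Definition stepf (n : nat) s x : R :=
  \sum_(k < n) s k * \1_(`[cellpt R n k, cellpt R n k.+1[%classic) x.

Lemma stepfE n s x : (0 < n)%N -> 0 <= x < 1 -> stepf n s x = s (cell n x).
Proof.
move=> n0 /andP[x0 x1]; have fln := cell_lt n0 x0 x1.
rewrite /stepf (bigD1 (Ordinal fln))//= big1 ?addr0.
  by rewrite indicE mem_set ?mulr1//= in_itv/=; exact: cell_itv.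
move=> i /eqP ni; rewrite indicE memNset ?mulr0//= in_itv/= => /(cell_unique n0) E.
by apply: ni; apply: val_inj; rewrite /= E.
Qed.

Lemma measurable_stepf n s : measurable_fun setT (stepf n s).
Proof.
by apply: measurable_sum => k; apply: measurable_funM.
Qed.

Lemma stepf_bound n s x : `|stepf n s x| <= \sum_(k < n) `|s k|.
Proof.
apply: (le_trans (ler_norm_sum _ _ _)); apply: ler_sum => k _.
rewrite normrM -[leRHS]mulr1 ler_wpM2l// indicE.
by case: (_ \in _); rewrite ?normr1 ?normr0.
Qed.

Lemma inL2_stepf n s : inL2 (stepf n s).
Proof.
apply: (@inL2_bounded _ (\sum_(k < n) `|s k|)); first exact: measurable_stepf.
by apply: ae01W => x _; exact: stepf_bound.
Qed.

Lemma prim_stepf n s k : (0 < n)%N -> (k <= n)%N ->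
  prim (stepf n s) (cellpt R n k) = n%:R^-1 * \sum_(j < k) s j.
Proof.
move=> n0; elim: k => [|k IH] kn; first by rewrite cellpt0 prim0 big_ord0 mulr0.
have iS : integ01 (stepf n s) by apply: inL2_integ01; exact: inL2_stepf.
rewrite big_ord_recr/= mulrDr -IH ?(ltnW kn)//; apply/eqP; rewrite addrC -subr_eq; apply/eqP.
rewrite primB ?cellpt_ge0 ?cellpt_le ?cellpt_le1//.
rewrite -Rintegral_itv_bndo_bndc; last first.
  apply: integrableS (integ01_itv (cellpt_ge0 R n k) (cellpt_le1 R n0 kn) iS) => //.
  by apply: subset_itvl; rewrite bnd_simp.
rewrite (@eq_Rintegral _ _ _ _ _ (cst (s k))); last first.
  move=> x; rewrite inE/= in_itv/= => /andP[kx xk].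
  have xin : 0 <= x < 1.
    rewrite (le_trans (cellpt_ge0 R n k) (ltW kx)).
    by rewrite (lt_le_trans xk (cellpt_le1 R n0 kn)).
  by rewrite stepfE// (@cell_unique _ n k)// (ltW kx).
rewrite Rintegral_cst//= lebesgue_measure_itv/= lte_fin cellpt_lt//= cellptS// addrC addKr.
by rewrite mulrC.
Qed.

Lemma nsq_stepf n s : (0 < n)%N -> nsq (stepf n s) = n%:R^-1 * \sum_(k < n) s k ^+ 2.
Proof.
move=> n0; have sL := inL2_stepf n s.
rewrite -energy1// /energy -(prim_stepf (fun k => s k ^+ 2) n0 (leqnn n)) cellpt_nn//.
rewrite /prim -!Rintegral_itv_bndo_bndc; last 2 first.
- apply: integrableS (inL2_integ01 (inL2_stepf n (fun k => s k ^+ 2))) => //.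
  by apply: subset_itv; rewrite bnd_simp.
- apply: integrableS (inL2_sqr sL) => //.
  by apply: subset_itv; rewrite bnd_simp.
apply: eq_Rintegral => x; rewrite inE/= in_itv/= => /andP[x0 x1].
by rewrite !stepfE// (ltW x0).
Qed.

Lemma ae01_stepf n s : (0 < n)%N -> ae01 (fun x => stepf n s x = s (cell n x)).
Proof.
by move=> n0; apply: ae01_oo => x /andP[x0 x1]; rewrite stepfE// (ltW x0).
Qed.

Definition avg v (n : nat) := stepf n (mean v n).

(** Jensen's inequality on each cell, in the form of [prim_cs]. *)
Lemma nsq_avg_le v n : (0 < n)%N -> inL2 v -> nsq (avg v n) <= nsq v.
Proof.
move=> n0 vL; rewrite nsq_stepf// -energy1//.
have -> : energy v 1 = energy v (cellpt R n n) - energy v (cellpt R n 0).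
  by rewrite cellpt_nn// cellpt0 /energy prim0 subr0.
rewrite -(big_mkord xpredT (fun k => mean v n k ^+ 2)) -(telescope_sumr (fun k => energy v (cellpt R n k)))//.
rewrite mulr_sumr !big_mkord; apply: ler_sum => k _.
have := prim_cs vL (cellpt_ge0 R n k) (cellpt_le R n0 (leqnSn k)) (cellpt_le1 R n0 (ltn_ord k)).
rewrite (_ : cellpt R n k.+1 - cellpt R n k = n%:R^-1) => [h|]; last first.
  by rewrite cellptS// addrC addKr.
rewrite /mean exprMn expr2 !mulrA mulVf ?mul1r ?pnatr_eq0 -?lt0n//.
by rewrite -mulrA -expr2 -ler_pdivlMl ?ltr0n.
Qed.

(** Averages converge almost everywhere and do not increase the norm, so
[radon_riesz] applies. *)
Lemma avg_cvg v : inL2 v -> nsq (avg v n.+1 \- v) @[n --> \oo] --> 0.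
Proof.
move=> vL; apply: radon_riesz => //.
- by move=> n; exact: inL2_stepf.
- apply: ae01_imp (ae01_and (ae01_neq 1) (lebesgue_diff vL.1 (inL2_integ01 vL))) => x /=.
  rewrite in_itv/= => /andP[x0 x1] [n1 h]; move: h; rewrite -cvg_shiftS /=.
  under eq_fun do rewrite -(@stepfE _ _ x)// ?x0 ?lt_neqAle ?n1 ?x1//.
  by [].
- by move=> e e0; near=> n; rewrite (le_trans (nsq_avg_le _ vL))// lerDl ltW.
Unshelve. all: by end_near. Qed.

Lemma inL2_fatou (w_ : nat -> R -> R) w (c : R) : (forall n, inL2 (w_ n)) ->
  measurable_fun setT w -> ae01 (fun x => w_ n x @[n --> \oo] --> w x) ->
  (\forall n \near \oo, nsq (w_ n) <= c) -> inL2 w /\ nsq w <= c.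
Proof.
move=> w_L mw cw wc.
have c0 : 0 <= c.
  have [n /= h] := filter_ex wc; exact: le_trans (nsq_ge0 _) h.
suff h : (sqn w <= c%:E)%E.
  have wL : inL2 w by split => //; apply: le_lt_trans h _; exact: ltry.
  by split => //; rewrite -lee_fin nsqE.
apply: le_trans (fatou_sqn (fun n => (w_L n).1) mw cw) _.
rewrite leNgt; apply/negP => /lt_limn_einf h.
have [n /= [h1 h2]] := filter_ex (filterI wc h).
by move: h2; rewrite -nsqE// lte_fin ltNge h1.
Qed.

(** The increments are summable in L1, hence absolutely summable at almost
every point. *)
Lemma fast_cvg (u_ : nat -> R -> R) : (forall n, inL2 (u_ n)) ->
  (forall n, nsq (u_ n.+1 \- u_ n) <= (2^-1 ^+ n) ^+ 2) ->
  exists2 u : R -> R, measurable_fun setT u & ae01 (fun x => u_ n x @[n --> \oo] --> u x).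
Proof.
move=> uL fast; pose d n := u_ n.+1 \- u_ n.
have dL n : inL2 (d n) by exact: inL2B.
have e0 n : 0 < 2^-1 ^+ n :> R by rewrite exprn_gt0.
have md n : measurable_fun (U01 : set R) (fun x => `|d n x|%:E).
  by apply/measurable_EFinP; apply: measurableT_comp => //; apply: measurable_funTS; exact: (dL n).1.
have intG : (\int[mu]_(x in U01) (\sum_(n <oo) `|d n x|%:E) < +oo)%E.
  rewrite integral_nneseries//.
  apply: (@le_lt_trans _ _ (\sum_(n <oo) (2^-1 ^+ n)%:E)%E).
    apply: lee_nneseries => [n _ _|n _]; first exact: integral_ge0.
    exact: (L1_le_L2 (e0 n) (dL n) (fast n)).
  have h : series (fun n => 2^-1 ^+ n : R) @ \oo --> (2 : R).
    have := @cvg_geometric_series R 1 (2^-1) _; rewrite ger0_norm// => /(_ _).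
    rewrite (_ : 1 / (1 - 2^-1) = 2); last by field.
    rewrite (_ : geometric 1 2^-1 = (fun n => 2^-1 ^+ n)); last by apply/funext => n; rewrite /= mul1r.
    by apply; rewrite invf_lt1 ?ltr1n.
  rewrite (_ : (\sum_(n <oo) (2^-1 ^+ n)%:E)%E = 2%:E) ?ltry//.
  apply/cvg_lim => //; rewrite (_ : (fun _ => _) = EFin \o series (fun n => 2^-1 ^+ n : R)).
    by apply: cvg_EFin => //; exact: nearW.
  by apply/funext => n /=; rewrite /series/= sumEFin.
have iG : mu.-integrable (U01 : set R) (fun x => \sum_(n <oo) `|d n x|%:E)%E.
  apply/integrableP; split; last first.
    by under eq_integral => x _ do rewrite gee0_abs ?nneseries_ge0//.
  have := @ge0_emeasurable_sum _ _ R (U01 : set R) (fun n x => `|d n x|%:E) xpredT.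
  by apply => // k _; exact: md.
(* a limit superior is measurable, and it is the limit where there is one *)
pose u x := fine (limn_esup (fun n => (u_ n x)%:E)).
have mu' : measurable_fun setT u.
  apply: measurableT_comp => //; apply: measurable_fun_limn_esup => n.
  by apply/measurable_EFinP; exact: (uL n).1.
exists u => //.
have h : ae01 (fun x => (\sum_(n <oo) `|d n x|%:E)%E \is a fin_num).
  have [|N [mN N0 sN]] := integrable_ae _ iG; first exact: measurable_itv.
  by exists N; split => // x /= hx; apply: sN.
apply: ae01_imp h => x _ /= fx.
suff [l ul] : exists l : R, u_ n x @[n --> \oo] --> l.
  suff -> : u x = l by [].
  rewrite /u; have /cvg_limn_einf_sup[_ ->] // : (u_ n x)%:E @[n --> \oo] --> l%:E.
  by apply: cvg_EFin => //; exact: nearW.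
have cs : cvgn (series (fun n => d n x)).
  apply: normed_cvg; apply: nondecreasing_is_cvgn.
    by apply: nondecreasing_series => n _ _; exact: normr_ge0.
  exists (fine (\sum_(n <oo) `|d n x|%:E)%E) => _ [n _ <-].
  rewrite -lee_fin fineK// /series/= -sumEFin.
  by apply: nneseries_lim_ge => k _.
move/cvg_ex : cs => [l sl]; exists (l + u_ 0%N x).
rewrite (_ : (fun n => u_ n x) = (fun n => series (fun n => d n x) n + u_ 0%N x)).
  by apply: cvgD => //; exact: cvg_cst.
apply/funext => n; rewrite /series/= /d /= telescope_sumr//.
by rewrite subrK.
Qed.

Lemma L2_complete (u_ : nat -> R -> R) : (forall n, inL2 (u_ n)) ->
  (forall e, 0 < e -> exists N, forall m n, (N <= m)%N -> (N <= n)%N ->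
     nsq (u_ m \- u_ n) <= e) ->
  exists2 u, inL2 u & nsq (u_ n \- u) @[n --> \oo] --> 0.
Proof.
move=> uL C.
have e0 n : 0 < (2^-1 ^+ n) ^+ 2 :> R by rewrite !exprn_gt0.
pose N n := projT1 (cid (C _ (e0 n))).
have NP n : forall m k, (N n <= m)%N -> (N n <= k)%N -> nsq (u_ m \- u_ k) <= (2^-1 ^+ n) ^+ 2.
  by rewrite /N; case: cid.
pose sub := fix sub k := if k is k'.+1 then maxn (sub k').+1 (N k) else N 0%N.
have subN k : (N k <= sub k)%N by case: k => //= k; rewrite leq_maxr.
have subS k : (sub k < sub k.+1)%N by rewrite /= leq_maxl.
have subid k : (k <= sub k)%N.
  by elim: k => // k IH; exact: leq_ltn_trans IH (subS k).
have [||u mu_ cu] := @fast_cvg (u_ \o sub).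
  by move=> n; exact: uL.
  by move=> n /=; apply: NP; [exact: leq_trans (subN n) (ltnW (subS n))|exact: subN].
have bound e : 0 < e -> exists N, forall n, (N <= n)%N -> inL2 (u \- u_ n) /\ nsq (u \- u_ n) <= e.
  move=> e1; have [N0 N0P] := C e e1; exists N0 => n Nn.
  apply: (@inL2_fatou (fun k => u_ (sub k) \- u_ n)).
  - by move=> k; exact: inL2B.
  - by apply: measurable_funB => //; exact: (uL n).1.
  - by apply: ae01_imp cu => x _ /= h; apply: cvgB => //; exact: cvg_cst.
  - by exists N0 => // k /= N0k; apply: N0P => //; exact: leq_trans N0k (subid k).
exists u.
  have [N0 /(_ N0 (leqnn _))[h _]] := bound 1 ltr01.
  have := inL2D h (uL N0).
  by rewrite (_ : u \- _ \+ _ = u)//; apply/funext => x /=; rewrite subrK.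
apply/cvgrPdist_le => e e1; have [N0 N0P] := bound e e1.
exists N0 => // n /= Nn; rewrite sub0r normrN ger0_norm ?nsq_ge0// nsqB_sym.
by have [] := N0P n Nn.
Qed.

End steps.

(** * Functions with controlled increments are primitives *)

Section density.
Variable R : realType.
Implicit Types (F A h v : R -> R) (a b x y M : R).

Lemma ctrl_endpoints M F A : {homo A : x y / x <= y} -> 0 <= M ->
  (forall x y, 0 < x -> x < y -> y < 1 -> ctrl M F A x y) ->
  exists F', (forall x, 0 < x < 1 -> F' x = F x) /\
    forall x y, 0 <= x -> x <= y -> y <= 1 -> ctrl M F' A x y.
Proof.
move=> Am M0 H.
have [||a a2] := @ctrl_extend R M F A [set x | 0 < x < 1] 0 Am M0.
- by move=> x y /andP[x0 _] /andP[_ y1] xy; exact: H.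
- by right=> x /andP[/ltW].
have [||b b2] := @ctrl_extend R M F A [set x | 0 < x < 1] 1 Am M0.
- by move=> x y /andP[x0 _] /andP[_ y1] xy; exact: H.
- by left=> x /andP[_ /ltW].
have {}b2 x : 0 < x < 1 -> (b - F x) ^+ 2 <= M * (1 - x) * (A 1 - A x) by exact: b2.
have {}a2 x : 0 < x < 1 -> (F x - a) ^+ 2 <= M * (x - 0) * (A x - A 0).
  move=> /a2; rewrite -[leLHS]sqrrN opprB; congr (_ <= _); ring.
pose F' x := if x == 0 then a else if x == 1 then b else F x.
exists F'; split.
  move=> x /andP[x0 x1]; rewrite /F' ifF ?ifF//; apply/negbTE; first by rewrite lt_eqF.
  by rewrite gt_eqF.
move=> x y x0 xy y1; rewrite /ctrl /F'.
have [->|nexy] := eqVneq x y; first by rewrite !subrr expr0n/= mulr0.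
have {nexy} xy : x < y by rewrite lt_neqAle nexy.
have [yE|yn0] := eqVneq y 0; first by move: (le_lt_trans x0 xy); rewrite yE ltxx.
have [xE|xn0] := eqVneq x 0; last first.
  have {x0 xn0} x0 : 0 < x by rewrite lt_neqAle eq_sym xn0.
  have [xE|_] := eqVneq x 1; first by move: (lt_le_trans xy y1); rewrite xE ltxx.
  have [->|yn1] := eqVneq y 1; last by apply: H => //; rewrite lt_neqAle yn1.
  by apply: b2; rewrite x0 (lt_le_trans xy y1).
rewrite xE in xy *; have [->|yn1] := eqVneq y 1; last first.
  by apply: a2; rewrite xy lt_neqAle yn1.
have h2 : 0 < (2^-1 : R) < 1 by rewrite invr_gt0 ltr0n invf_lt1 ?ltr1n.
rewrite (_ : b - a = (b - F 2^-1) + (F 2^-1 - a)); last by ring.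
apply: (@ctrl_trans _ M F A _ _ _ _ _ _ 2^-1) => //.
- by case/andP: h2 => _ /ltW.
- exact: a2.
- exact: b2.
Qed.

Lemma sum_mul (N r : nat) (f : nat -> R) :
  \sum_(k < N * r) f k = \sum_(i < N) \sum_(j < r) f (i * r + j)%N.
Proof.
elim: N => [|N IH]; first by rewrite mul0n !big_ord0.
rewrite big_ord_recr/= -IH mulSn addnC -(big_mkord xpredT) (@big_cat_nat _ _ _ (N * r))//=; last exact: leq_addr.
rewrite big_mkord; congr (_ + _).
rewrite -{1}[(N * r)%N]add0n big_addn addKn big_mkord.
by apply: eq_bigr => j _; rewrite addnC.
Qed.

Definition slope F (n k : nat) := n%:R * (F (cellpt R n k.+1) - F (cellpt R n k)).

Lemma cellpt_mul n r k : (0 < r)%N -> cellpt R (n * r) (k * r) = cellpt R n k.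
Proof.
move=> r0; rewrite /cellpt !natrM invfM mulrACA divff ?mulr1//.
by rewrite pnatr_eq0 -lt0n.
Qed.

Lemma slope_bound M F A n : {homo A : x y / x <= y} -> 0 <= M -> (0 < n)%N ->
  (forall x y, 0 <= x -> x <= y -> y <= 1 -> ctrl M F A x y) ->
  nsq (stepf n (slope F n)) <= M * (A 1 - A 0).
Proof.
move=> Am M0 n0 H; rewrite nsq_stepf//.
have -> : A 1 - A 0 = \sum_(k < n) (A (cellpt R n k.+1) - A (cellpt R n k)).
  rewrite -(big_mkord xpredT (fun k => A (cellpt R n k.+1) - A (cellpt R n k))).
  by rewrite (telescope_sumr (fun k => A (cellpt R n k)))// cellpt_nn// cellpt0.
rewrite !mulr_sumr; apply: ler_sum => k _.
have := H _ _ (cellpt_ge0 R n k) (cellpt_le R n0 (leqnSn k)) (cellpt_le1 R n0 (ltn_ord k)).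
rewrite /ctrl (_ : cellpt R n k.+1 - cellpt R n k = n%:R^-1) => [h|]; last first.
  by rewrite cellptS// addrC addKr.
rewrite /slope exprMn expr2 !mulrA mulVf ?mul1r ?pnatr_eq0 -?lt0n//.
rewrite -mulrA -expr2 -ler_pdivlMl ?ltr0n// (le_trans h)//.
by rewrite le_eqVlt; apply/orP; left; apply/eqP; ring.
Qed.

(** The slope on a coarse cell is the mean of the slopes on the fine cells
inside it, so the coarse step function is orthogonal to the difference. *)
Lemma slope_orth F n r : (0 < n)%N -> (0 < r)%N ->
  nsq (stepf (n * r) (slope F (n * r)) \- stepf n (slope F n)) =
  nsq (stepf (n * r) (slope F (n * r))) - nsq (stepf n (slope F n)).
Proof.
move=> n0 r0; have nr0 : (0 < n * r)%N by rewrite muln_gt0 n0.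
pose s k := slope F (n * r) k - slope F n (k %/ r).
transitivity (nsq (stepf (n * r) s)).
  apply: nsq_ae; [apply: inL2B; exact: inL2_stepf|exact: inL2_stepf|].
  apply: ae01_oo => x /andP[x0 x1] /=; have x01 : 0 <= x < 1 by rewrite (ltW x0).
  rewrite !stepfE// /s; congr (_ - slope F n _).
  apply: cell_unique => //.
  have /andP[h1 h2] := cell_itv nr0 (ltW x0).
  rewrite -!(cellpt_mul n _ r0) (le_trans _ h1) ?cellpt_le// ?leq_divM//.
  by rewrite (lt_le_trans h2)// cellpt_le// ltn_ceil.
rewrite !nsq_stepf//.
rewrite (sum_mul n r (fun k => s k ^+ 2)) (sum_mul n r (fun k => slope F (n * r) k ^+ 2)).
rewrite !mulr_sumr -sumrB; apply: eq_bigr => i _.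
set m := slope F n i.
have E j : (j < r)%N -> slope F n ((i * r + j) %/ r) = m.
  by move=> jr; rewrite divnMDl// divn_small// addn0.
have S1 : \sum_(j < r) slope F (n * r) (i * r + j) = r%:R * m.
  rewrite /slope -mulr_sumr.
  rewrite -(big_mkord xpredT (fun j => F (cellpt R (n * r) (i * r + j).+1) - F (cellpt R (n * r) (i * r + j)))).
  under eq_bigr do rewrite -addnS.
  rewrite (telescope_sumr (fun j => F (cellpt R (n * r) (i * r + j))))// addn0.
  by rewrite -mulSnr !cellpt_mul// /m /slope natrM mulrA [r%:R * _]mulrC.
have -> : \sum_(j < r) s (i * r + j)%N ^+ 2 = \sum_(j < r)
    (slope F (n * r) (i * r + j) ^+ 2 + (- (2 * m) * slope F (n * r) (i * r + j) + m ^+ 2)).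
  by apply: eq_bigr => j _; rewrite /s E//; ring.
rewrite big_split/= big_split/= -mulr_sumr S1 sumr_const card_ord -mulr_natl natrM invfM.
have nr : (n%:R : R) != 0 by rewrite pnatr_eq0 -lt0n.
have rr : (r%:R : R) != 0 by rewrite pnatr_eq0 -lt0n.
by field; rewrite nr rr.
Qed.

(** A small perturbation changes the squared norm little, uniformly on bounded
sets; this replaces the triangle inequality for the norm. *)
Lemma nsq_perturb (c e : R) : 0 <= c -> 0 < e -> exists2 d, 0 < d &
  forall w z : R -> R, inL2 w -> inL2 z -> nsq w <= c -> nsq z <= d -> nsq (w \+ z) <= c + e.
Proof.
move=> c0 e0; pose t := e / (2 * (c + 1)).
have c1 : 0 < c + 1 by rewrite ltr_wpDl.
have t0 : 0 < t by rewrite divr_gt0// mulr_gt0.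
have t1 : 0 < 1 + t^-1 by rewrite addr_gt0// invr_gt0.
exists (e / 2 / (1 + t^-1)); first by rewrite !divr_gt0.
move=> w z wL zL wc zd; apply: (le_trans (nsqD_le t0 wL zL)).
have h1 : (1 + t^-1) * nsq z <= e / 2 by rewrite mulrC -ler_pdivlMr.
have h2 : (1 + t) * nsq w <= (1 + t) * c by rewrite ler_wpM2l// addr_ge0// ltW.
have h3 : t * c <= e / 2.
  rewrite /t invfM mulrA -mulrA ler_piMr//; first by rewrite divr_ge0// ltW.
  by rewrite mulrC ler_pdivrMr// mul1r lerDl.
have h4 : (1 + t) * c = c + t * c by ring.
by move: h1 h2 h3; rewrite h4; lra.
Qed.

Lemma nsq_cvg_le (F : set_system nat) (FF : ProperFilter F) (u : nat -> R -> R) v (c : R) :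
  (forall n, inL2 (u n)) -> inL2 v -> nsq (u n \- v) @[n --> F] --> 0 ->
  (\forall n \near F, nsq (u n) <= c) -> nsq v <= c.
Proof.
move=> uL vL cv uc.
have c0 : 0 <= c by have [n h] := filter_ex uc; exact: le_trans (nsq_ge0 _) h.
apply/ler_addgt0Pr => e e0; have [d d0 H] := nsq_perturb c0 e0.
have [n [h1 h2]] := filter_ex (filterI uc (cvgr_lt _ cv _ d0)).
rewrite (_ : v = u n \+ (fun x => -1 * (u n \- v) x)); last first.
  by apply/funext => x /=; ring.
apply: H => //; first by apply: inL2Z; exact: inL2B.
by rewrite nsqZ ?sqrrN ?expr1n ?mul1r ?ltW//; exact: inL2B.
Qed.

(** The difference quotients on dyadic grids form a martingale that is bounded
in L2. Their norms increase to a limit, so orthogonality makes them a Cauchy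
sequence. The primitive of the limit agrees with F at dyadic points, and both
are continuous. *)
Lemma ctrl_density M F A : {homo A : x y / x <= y} -> 0 <= M ->
  (forall x y, 0 <= x -> x <= y -> y <= 1 -> ctrl M F A x y) ->
  exists v, [/\ inL2 v, nsq v <= M * (A 1 - A 0) &
    forall x, 0 <= x <= 1 -> F x = F 0 + prim v x].
Proof.
move=> Am M0 H.
have C0 : 0 <= M * (A 1 - A 0) by rewrite mulr_ge0// subr_ge0 Am.
have two n : (0 < 2 ^ n)%N by rewrite expn_gt0.
pose u n := stepf (2 ^ n) (slope F (2 ^ n)).
have uL n : inL2 (u n) by exact: inL2_stepf.
have orth m n : (m <= n)%N -> nsq (u n \- u m) = nsq (u n) - nsq (u m).
  by move=> mn; rewrite /u -(subnKC mn) expnD; apply: slope_orth.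
have ub n : nsq (u n) <= M * (A 1 - A 0) by exact: slope_bound.
have nd : nondecreasing_seq (fun n => nsq (u n)).
  by move=> m n mn; rewrite -subr_ge0 -orth// nsq_ge0.
have cu : cvgn (fun n => nsq (u n)).
  by apply: nondecreasing_is_cvgn => //; exists (M * (A 1 - A 0)) => _ [n _ <-].
have [v vL cv] : exists2 v, inL2 v & nsq (u n \- v) @[n --> \oo] --> 0.
  apply: L2_complete => // e e0.
  move/cvg_cauchy : cu => /cauchy_ballP /(_ e e0).
  move=> [[P Q] /= [[N1 _ h1] [N2 _ h2]] h].
  exists (maxn N1 N2) => m n; rewrite !geq_max => /andP[m1 m2] /andP[n1 n2].
  wlog mn : m n m1 m2 n1 n2 / (n <= m)%N.
    by move=> W; case: (leqP n m) => nm; [exact: W|rewrite nsqB_sym; apply: W => //; exact: ltnW].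
  rewrite orth//; have := h (nsq (u m), nsq (u n)) (conj (h1 m m1) (h2 n n2)).
  rewrite /ball/= => /ltW; apply: le_trans; exact: ler_norm.
have primuv n x : 0 <= x -> x <= 1 -> (prim (u n) x - prim v x) ^+ 2 <= nsq (u n \- v).
  move=> x0 x1; rewrite -primB_fun//; apply: prim_sqr_le; first exact: inL2B.
  by rewrite x0.
have primd m k : (k <= 2 ^ m)%N -> prim v (cellpt R (2 ^ m) k) = F (cellpt R (2 ^ m) k) - F 0.
  move=> km; have q1 : cellpt R (2 ^ m) k <= 1 by exact: cellpt_le1.
  have pu n : (m <= n)%N -> prim (u n) (cellpt R (2 ^ m) k) = F (cellpt R (2 ^ m) k) - F 0.
    move=> mn; have r0 : (0 < 2 ^ (n - m))%N by [].
    have e : (2 ^ n = 2 ^ m * 2 ^ (n - m))%N by rewrite -expnD subnKC.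
    have E : cellpt R (2 ^ m) k = cellpt R (2 ^ n) (k * 2 ^ (n - m)).
      by rewrite e cellpt_mul.
    rewrite E prim_stepf//; last by rewrite e leq_pmul2r.
    rewrite /slope -mulr_sumr mulrA mulVf ?mul1r ?pnatr_eq0 -?lt0n//.
    rewrite -(big_mkord xpredT (fun j => F (cellpt R (2 ^ n) j.+1) - F (cellpt R (2 ^ n) j))).
    by rewrite (telescope_sumr (fun j => F (cellpt R (2 ^ n) j)))// cellpt0.
  apply/eqP; rewrite -subr_eq0 -sqrf_eq0 eq_le sqr_ge0 andbT.
  apply: (cvgr_to_ge cv); near=> n; have mn : (m <= n)%N by near: n; exists m.
  have := primuv n (cellpt R (2 ^ m) k) (cellpt_ge0 _ _ _) q1.
  by rewrite pu// -[_ ^+ 2 in leLHS]sqrrN opprB.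
have vC : nsq v <= M * (A 1 - A 0).
  by apply: (nsq_cvg_le _ uL vL cv); exact: nearW.
exists v; split => //.
move=> x /andP[x0 x1]; apply/eqP; rewrite -subr_eq0 -sqrf_eq0 eq_le sqr_ge0 andbT.
set C := M * (A 1 - A 0) in C0 ub vC.
have hC : 4 * C * n.+1%:R^-1 @[n --> \oo] --> 0.
  by rewrite -[X in _ --> X](mulr0 (4 * C)); apply: cvgMr; exact: cvg_harmonic.
apply: (cvgr_to_ge hC); near=> n.
pose z := cellpt R (2 ^ n) (cell (2 ^ n) x).
have /andP[zx z1] := cell_itv (two n) x0; rewrite cellptS// -/z in zx z1.
have z0 : 0 <= z by exact: cellpt_ge0.
have pz : prim v z = F z - F 0.
  apply: primd; rewrite -(ler_nat R) (le_trans (y := (2 ^ n)%:R * x))//.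
    by rewrite mulrC -ler_pdivrMr ?ltr0n.
  by rewrite ler_piMr.
have nn : (2 ^ n)%:R^-1 <= n.+1%:R^-1 :> R.
  by rewrite lef_pV2 ?posrE ?ltr0n// ler_nat ltn_expl.
have xz : x - z <= n.+1%:R^-1 by apply: le_trans nn; rewrite lerBlDl ltW.
have c1 : (F x - F z) ^+ 2 <= C * n.+1%:R^-1.
  apply: (le_trans (H z x z0 zx x1)).
  rewrite mulrAC /C; apply: ler_pM => //; rewrite ?mulr_ge0 ?subr_ge0 ?Am//.
  by rewrite ler_wpM2l// lerB// Am.
have c2 : (prim v x - prim v z) ^+ 2 <= C * n.+1%:R^-1.
  apply: (le_trans (prim_cs vL z0 zx x1)); rewrite mulrC.
  apply: ler_pM => //; rewrite ?subr_ge0 ?energy_homo//.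
  apply: le_trans vC; rewrite -energy1//.
  rewrite lerBlDr (le_trans (energy_homo vL x0 x1 (lexx _)))// lerDl.
  by rewrite -[leLHS](prim0 (fun s => v s ^+ 2)); exact: (energy_homo vL (lexx 0) z0 (le_trans zx x1)).
have -> : F x - (F 0 + prim v x) = (F x - F z) - (prim v x - prim v z) by rewrite pz; ring.
move: c1 c2; set a := F x - F z; set b := prim v x - prim v z; set c := C * _.
move=> c1 c2; rewrite (_ : 4 * C * _ = 4 * c); last by rewrite /c mulrA.
have := sqr_ge0 (a + b); nra.
Unshelve. all: by end_near. Qed.

End density.

(** * Smooth bumps *)

Section smooth.
Variable R : realType.
Implicit Types (f g u v : R -> R) (a b c x y : R).

Local Notation mu := (@lebesgue_measure R).

(** The flat functions x^-k exp (-1/x): the derivatives of exp (-1/x) are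
linear combinations of them. *)
Definition flat (k : nat) x : R := if 0 < x then x^-1 ^+ k * expR (- x^-1) else 0.

Lemma flat_ge0 k x : 0 <= flat k x.
Proof.
rewrite /flat; case: ifPn => // x0.
by rewrite mulr_ge0 ?expR_ge0// exprn_ge0// invr_ge0 ltW.
Qed.

(** The term of order k + 1 of the exponential series at 1/x is at most
exp (1/x). *)
Lemma flat_le k x : flat k x <= (k.+1)`!%:R * `|x|.
Proof.
rewrite /flat; case: ifPn => [x0|_]; last by rewrite mulr_ge0.
have y0 : 0 < x^-1 by rewrite invr_gt0.
have := expR_ge1Dxn k (ltW y0); set y := x^-1 in y0 *.
have f0 : 0 < (k.+1)`!%:R :> R by rewrite ltr0n fact_gt0.
move=> h; have {}h : y ^+ k.+1 <= (k.+1)`!%:R * expR y.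
  rewrite -ler_pdivrMl// mulrC (le_trans _ h)// lerDr; exact: ler01.
rewrite expRN ler_pdivrMr ?expR_gt0// gtr0_norm//.
have -> : x = y^-1 by rewrite /y invrK.
rewrite mulrAC ler_pdivlMr// -exprSr; exact: h.
Qed.

Lemma is_derive_flat k x : is_derive x 1 (flat k) (- k%:R * flat k.+1 x + flat k.+2 x).
Proof.
have [x0|x0|->] := ltgtP x 0.
- have -> : - k%:R * flat k.+1 x + flat k.+2 x = 0.
    by rewrite /flat ltNge (ltW x0)/= mulr0 addr0.
  have h0 : is_derive x 1 (cst 0 : R -> R) (0 : R) by exact: is_derive_cst.
  apply: near_eq_is_derive h0.
  by near=> y; rewrite /flat ltNge ifF//; apply/negbTE; rewrite negbK ltW//; near: y; exact: lt_nbhsl.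
- pose f : R -> R := (fun y => y^-1) ^+ k * (expR \o (fun y => - y^-1)).
  have xn0 : x != 0 by rewrite gt_eqF.
  have dV : is_derive x 1 (fun y : R => y^-1) (- x ^- 2).
    have := @is_deriveV R id x 1 1 xn0 (is_derive_id x 1).
    by rewrite /GRing.scale/= mulr1.
  have dN : is_derive x 1 (fun y : R => - y^-1) (x ^- 2).
    have := is_deriveN dV; rewrite opprK; exact.
  have dE := @is_derive1_comp R expR (fun y => - y^-1) x _ _ (is_derive_expR _) dN.
  have dX := is_deriveX k dV.
  have dM := is_deriveM dX dE.
  apply: (@near_eq_is_derive _ _ _ f).
    near=> y; rewrite /flat ifT; last by near: y; exact: lt_nbhsr.
    by rewrite /f /= exprfctE.
  apply: (is_derive_eq dM).
  rewrite /flat x0 /= exprfctE /GRing.scale/=.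
  case: k {f dX dM} => [|k]; rewrite -!exprVn.
    by rewrite expr0 !mul0r mulr0 addr0 mul1r oppr0 mul0r add0r mulrC.
  by rewrite /= !exprS; ring.
- have -> : - k%:R * flat k.+1 0 + flat k.+2 0 = 0.
    by rewrite /flat ltxx mulr0 addr0.
  have h : h^-1 *: (flat k (h *: 1 + 0) - flat k 0) @[h --> (0 : R)^'] --> (0 : R).
    have E h : h != 0 -> `|h^-1 *: (flat k (h *: 1 + 0) - flat k 0)| <= k.+2`!%:R * `|h|.
      move=> h0; rewrite [h *: 1]mulr1 addr0 {2}/flat ltxx subr0 /GRing.scale/=.
      apply: le_trans (flat_le k.+1 h); rewrite /flat; case: ifPn => [hp|_]; last by rewrite mulr0 normr0.
      by rewrite mulrA -exprS ger0_norm// mulr_ge0 ?expR_ge0// exprn_ge0// invr_ge0 ltW.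
    apply/cvgr0Pnorm_le => e e0; near=> h.
    apply: le_trans (E h _) _; first by near: h; exact: nbhs_dnbhs_neq.
    have f0 : 0 < k.+2`!%:R :> R by rewrite ltr0n fact_gt0.
    rewrite -ler_pdivlMl//; near: h; apply: dnbhs0_le.
    by rewrite mulr_gt0// invr_gt0.
  by split; [apply/cvg_ex; exists 0; exact: h|apply/cvg_lim => //; exact: h].
Unshelve. all: by end_near. Qed.

(** Closed under differentiation by construction, hence made of smooth
functions. *)
Inductive smooth_alg : (R -> R) -> Prop :=
| smooth_zero : smooth_alg (fun=> 0)
| smooth_flat k a b : smooth_alg (fun x => flat k (a * x + b))
| smooth_lin c f g : smooth_alg f -> smooth_alg g -> smooth_alg (fun x => c * f x + g x)
| smooth_mul f g : smooth_alg f -> smooth_alg g -> smooth_alg (fun x => f x * g x).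

Lemma smooth_alg_deriv f : smooth_alg f ->
  exists2 g, smooth_alg g & forall x, is_derive x 1 f (g x).
Proof.
elim=> [|k a b|c {}f g _ [f' sf df] _ [g' sg dg]|{}f g sf [f' sf' df] sg [g' sg' dg]].
- by exists (fun=> 0); [exact: smooth_zero|move=> x; exact: is_derive_cst].
- exists (fun x => (- (a * k%:R)) * flat k.+1 (a * x + b) + (a * flat k.+2 (a * x + b) + 0)).
    by apply: smooth_lin; [exact: smooth_flat|apply: smooth_lin; [exact: smooth_flat|exact: smooth_zero]].
  move=> x; have dA : is_derive x 1 (fun y : R => a * y + b) a.
    have := is_deriveD (is_deriveZ a (is_derive_id x 1)) (is_derive_cst b x 1).
    by rewrite addr0 /GRing.scale/= mulr1; exact.
  have dC := @is_derive1_comp R (flat k) (fun y => a * y + b) x _ _ (is_derive_flat k _) dA.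
  apply: (is_derive_eq dC).
  by ring.
- exists (fun x => c * f' x + g' x); first exact: smooth_lin.
  move=> x; exact: (is_deriveD (is_deriveZ c (df x)) (dg x)).
- exists (fun x => 1 * (f x * g' x) + g x * f' x).
    by apply: smooth_lin; exact: smooth_mul.
  by move=> x; rewrite mul1r; exact: (is_deriveM (df x) (dg x)).
Qed.

Lemma smooth_alg_derive1 f : smooth_alg f -> smooth_alg (f^`()%classic) /\ forall x, derivable f x 1.
Proof.
move=> /smooth_alg_deriv[g sg dg]; split; last by move=> x; case: (dg x).
suff -> : (f^`()%classic) = g by [].
by apply/funext => x; rewrite derive1E; case: (dg x) => _ ->.
Qed.

Lemma smooth_alg_derivable f n x : smooth_alg f -> derivable (f^`(n)%classic) x 1.
Proof.
move=> sf; suff h : smooth_alg (f^`(n)%classic) by exact: (smooth_alg_derive1 h).2.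
by elim: n => // n IH; rewrite derive1nS; exact: (smooth_alg_derive1 IH).1.
Qed.

Lemma smooth_alg_continuous f : smooth_alg f -> continuous f.
Proof.
move=> sf x; apply: differentiable_continuous; apply/derivable1_diffP.
exact: (smooth_alg_derive1 sf).2.
Qed.

(** A product of two functions, one flat to the left of a and one to the right
of b; m sharpens it towards the indicator of ]a, b[. *)
Definition bumpf a b (m : R) x := flat 0 (m * x + (- (m * a))) * flat 0 ((- m) * x + m * b).

Lemma smooth_bump a b m : smooth_alg (bumpf a b m).
Proof. by apply: smooth_mul; exact: smooth_flat. Qed.

Lemma flat0_le1 x : flat 0 x <= 1.
Proof.
rewrite /flat; case: ifPn => // x0; rewrite expr0 mul1r -expR0 ler_expR.
by rewrite oppr_le0 invr_ge0 ltW.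
Qed.

Lemma bump_ge0 a b m x : 0 <= bumpf a b m x.
Proof. by rewrite mulr_ge0 ?flat_ge0. Qed.

Lemma bump_le1 a b m x : bumpf a b m x <= 1.
Proof. by rewrite mulr_ile1 ?flat_ge0 ?flat0_le1. Qed.

Lemma bump_out a b m x : 0 < m -> ~~ (a < x < b) -> bumpf a b m x = 0.
Proof.
move=> m0; rewrite negb_and -!leNgt => /orP[xa|bx].
  by rewrite /bumpf {1}/flat ltNge -mulrBr pmulr_rle0// subr_le0 xa mul0r.
rewrite /bumpf {2}/flat ltNge (_ : - m * x + m * b = m * (b - x)); last by ring.
by rewrite pmulr_rle0// subr_le0 bx mulr0.
Qed.

Lemma flat0_cvg t : 0 < t -> flat 0 (n.+1%:R * t) @[n --> \oo] --> (1 : R).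
Proof.
move=> t0; rewrite (_ : (fun _ => _) = (fun n => expR (- (t^-1 * n.+1%:R^-1)))); last first.
  by apply/funext => n; rewrite /flat ifT ?mulr_gt0// expr0 mul1r invfM mulrC.
rewrite -[X in _ --> X]expR0; apply: continuous_cvg; first exact: continuous_expR.
rewrite -[X in _ --> X]oppr0; apply: cvgN; rewrite -[X in _ --> X](mulr0 t^-1).
by apply: cvgMr; exact: cvg_harmonic.
Qed.

Lemma bump_cvg a b x : bumpf a b n.+1%:R x @[n --> \oo] --> (\1_(`]a, b[%classic) x : R).
Proof.
rewrite indicE; have [xab|nxab] := boolP (a < x < b).
  rewrite mem_set ?in_itv//=; have /andP[ax xb] := xab.
  rewrite -[X in _ --> X](mulr1 1); apply: cvgM.
    under eq_fun do rewrite -mulrBr; apply: flat0_cvg; by rewrite subr_gt0.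
  have E (n : nat) : - n.+1%:R * x + n.+1%:R * b = n.+1%:R * (b - x) by ring.
  under eq_fun do rewrite E.
  by apply: flat0_cvg; rewrite subr_gt0.
rewrite memNset; last by rewrite /= in_itv/=; exact/negP.
under eq_fun => n do rewrite bump_out//; exact: cvg_cst.
Qed.

Lemma continuous_integ01 f : continuous f -> integ01 f.
Proof.
move=> cf; apply: continuous_compact_integrable; first exact: segment_compact.
exact: continuous_subspaceT.
Qed.

Lemma continuous_measurable f : continuous f -> measurable_fun setT f.
Proof. exact: continuous_measurable_fun. Qed.

Lemma integ01M f g (C : R) : integ01 f -> measurable_fun setT g -> (forall x, U01 x -> `|g x| <= C) ->
  integ01 (fun x => f x * g x).
Proof.
move=> iF mg gC; apply: (@integ01_le R _ (fun x => C * `|f x|)).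
- by apply: measurable_funM; [exact: integ01_meas|exact: measurable_funTS].
- apply: integ01Z; apply: (integ01_le _ (w := fun x => `|f x|)).
  + by apply: measurableT_comp => //; exact: integ01_meas.
  + exact: (integrable_norm iF).
  + by move=> x _; rewrite normr_id.
- by move=> x xU; rewrite normrM mulrC ler_wpM2r// gC.
Qed.

End smooth.

(** * Primitives and their weak derivatives *)

Section weak.
Variable R : realType.
Implicit Types (f g u v w phi psi : R -> R) (a b c x y : R).

Local Notation mu := (@lebesgue_measure R).

Lemma avoids_near (s : seq R) x : x \notin s -> exists2 d, 0 < d & avoids s (x - d) (x + d).
Proof.
elim: s => [|z s IH]; first by exists 1.
rewrite inE negb_or => /andP[xz /IH[d d0 av]].
have z0 : 0 < `|x - z| by rewrite normr_gt0 subr_eq0.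
exists (Num.min d (`|x - z| / 2)); first by rewrite lt_min d0 divr_gt0.
move=> y; rewrite inE => /predU1P[->|ys] /andP[h1 h2].
  have : `|x - z| <= `|x - z| / 2.
    have m : Num.min d (`|x - z| / 2) <= `|x - z| / 2 by rewrite ge_min lexx orbT.
    by rewrite ler_norml; apply/andP; split; lra.
  lra.
apply: (av y ys); have m : Num.min d (`|x - z| / 2) <= d by rewrite ge_min lexx.
by apply/andP; split; lra.
Qed.

(** The cells around a point off s end up missing s, so the means of v on them
vanish; they tend to v almost everywhere. *)
Lemma prim_locally_cst (s : seq R) v : measurable_fun setT v -> integ01 v ->
  (forall a b, 0 < a -> a < b -> b < 1 -> avoids s a b -> prim v a = prim v b) ->
  ae01 (fun x => v x = 0).
Proof.
move=> mv iv H; have := ae01_and (ae01_seq (0 :: 1 :: s)) (lebesgue_diff mv iv).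
apply: ae01_imp => x /=; rewrite in_itv/= => /andP[x0 x1] [xs cv].
have [d d0 av] := avoids_near xs.
have x0' : 0 < x by rewrite lt_neqAle x0 andbT eq_sym; move: xs; rewrite !inE !negb_or => /and3P[].
have x1' : x < 1 by rewrite lt_neqAle x1 andbT; move: xs; rewrite !inE !negb_or => /and3P[].
have c0 : mean v n (cell n x) @[n --> \oo] --> (0 : R).
  apply: cvg_near_cst; near=> n.
  have n0 : (0 < n)%N by near: n; exists 1%N.
  have nd : n%:R^-1 < d.
    near: n; exists (Num.truncn d^-1).+1 => // n /= dn.
    have n0 : (0 < n)%N by exact: leq_trans dn.
    rewrite invf_plt ?posrE ?ltr0n//; apply: (lt_le_trans (truncnS_gt _)).
    by rewrite ler_nat.
  have /andP[h1 h2] := cell_itv n0 x0.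
  have h3 := cellptS R (cell n x) n0.
  have av' := av 0 (mem_head _ _).
  have av1 := av 1 (mem_behead (s := [:: 0, 1 & s]) (mem_head _ _)).
  have l0 : x - d < cellpt R n (cell n x) by move: h2; rewrite h3; set t := _^-1 in nd *; lra.
  have l1 : cellpt R n (cell n x).+1 < x + d by rewrite h3; set t := _^-1 in nd *; lra.
  have d0x : 0 < x - d.
    by rewrite ltNge; apply/negP => h; apply: av'; rewrite h addr_ge0// ltW.
  have d1x : x + d < 1.
    rewrite ltNge; apply/negP => h; apply: av1; rewrite h andbT.
    by rewrite lerBlDr (le_trans x1)// lerDl ltW.
  rewrite /mean (H (cellpt R n (cell n x)) (cellpt R n (cell n x).+1)) ?subrr ?mulr0//.
  - exact: lt_trans l0.
  - exact: cellpt_lt.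
  - exact: lt_trans d1x.
  - move=> z zs /andP[z1 z2]; apply: (av z); first by rewrite !inE zs !orbT.
    by rewrite (le_trans (ltW l0) z1) (le_trans z2 (ltW l1)).
exact: (cvg_unique _ cv c0).
Unshelve. all: by end_near. Qed.

Definition clamp x : R := Num.max 0 (Num.min 1 x).

Lemma clamp_id x : 0 <= x <= 1 -> clamp x = x.
Proof. by move=> /andP[x0 x1]; rewrite /clamp min_r// max_r. Qed.

Lemma clamp01 x : 0 <= clamp x <= 1.
Proof. by rewrite /clamp le_max lexx/= ge_max ler01 ge_min lexx. Qed.

Lemma clamp_homo : {homo clamp : x y / x <= y}.
Proof.
by move=> x y xy; rewrite /clamp ge_max !le_max lexx/= ?orbT le_min !ge_min lexx xy !orbT.
Qed.

Lemma clamp_lip x y : x <= y -> clamp y - clamp x <= y - x.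
Proof.
move=> xy; rewrite /clamp /Num.max /Num.min.
by do !case: ifPn; rewrite -?leNgt => *; lra.
Qed.

(** The primitive, extended by constants outside [0, 1] so as to be continuous
on the whole line. *)
Definition cprim v x := prim v (clamp x).

Lemma cprimE v x : 0 <= x <= 1 -> cprim v x = prim v x.
Proof. by move=> x01; rewrite /cprim clamp_id. Qed.

Lemma cprim_cs v x y : inL2 v -> x <= y ->
  (cprim v y - cprim v x) ^+ 2 <= (y - x) * (energy v (clamp y) - energy v (clamp x)).
Proof.
move=> vL xy; have /andP[x0 x1] := clamp01 x; have /andP[y0 y1] := clamp01 y.
apply: (le_trans (prim_cs vL x0 (clamp_homo xy) y1)).
by rewrite ler_wpM2r ?clamp_lip// subr_ge0 energy_homo// clamp_homo.
Qed.

Lemma cprim_continuous v : inL2 v -> continuous (cprim v).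
Proof.
move=> vL x; apply/cvgrPdist_le => e e0.
have c0 : 0 < nsq v + 1 by rewrite ltr_wpDl// nsq_ge0.
have H a b : a <= b -> (cprim v b - cprim v a) ^+ 2 <= (b - a) * (nsq v + 1).
  move=> ab; apply: (le_trans (cprim_cs vL ab)); rewrite ler_wpM2l ?subr_ge0//.
  have /andP[_ h1] := nsq_energy_ge0 vL (clamp01 b).
  have /andP[h2 _] := nsq_energy_ge0 vL (clamp01 a); lra.
near=> y; rewrite -(@ler_pXn2r _ 2) ?nnegrE ?(ltW e0)// real_normK ?num_real//.
have : `|x - y| <= e ^+ 2 / (nsq v + 1).
  by near: y; apply: cvgr_dist_le; rewrite ?divr_gt0 ?exprn_gt0//; exact: cvg_id.
rewrite ler_pdivlMr// => h.
have [xy|yx] := leP x y.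
  apply: le_trans h; rewrite -[_ ^+ 2]sqrrN opprB distrC ger0_norm ?subr_ge0//.
  exact: H.
by apply: le_trans h; rewrite ger0_norm ?subr_ge0 ?(ltW yx)//; apply: H; exact: ltW.
Unshelve. all: by end_near. Qed.

Lemma cprim_bound v x : inL2 v -> `|cprim v x| <= nsq v + 1.
Proof.
move=> vL; have h : `|cprim v x| ^+ 2 <= nsq v.
  by rewrite real_normK ?num_real// prim_sqr_le ?clamp01.
have := sqr_ge0 (`|cprim v x| - 1); have := nsq_ge0 v; have := normr_ge0 (cprim v x); nra.
Qed.

Lemma inL2_cprim v : inL2 v -> inL2 (cprim v).
Proof.
move=> vL; apply: (@inL2_bounded _ (nsq v + 1)).
  by apply: continuous_measurable; exact: cprim_continuous.
by apply: ae01W => x _; exact: cprim_bound.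
Qed.

Lemma derivable_continuous f : (forall x, derivable f x 1) -> continuous f.
Proof.
by move=> df x; apply: differentiable_continuous; apply/derivable1_diffP; exact: df.
Qed.

Lemma continuous_bounded01 f : continuous f -> exists C : R, forall x, U01 x -> `|f x| <= C.
Proof.
move=> cf; have cn : {within `[0, 1], continuous (fun x => `|f x|)}.
  apply: continuous_subspaceT => x; apply: continuous_comp; first exact: cf.
  exact: norm_continuous.
have [c _ h] := EVT_max ler01 cn.
by exists `|f c| => x xU; apply: h; exact: xU.
Qed.

(** All that is used of a test function: it is C1 and vanishes at 1. *)
Lemma test_function_smooth phi : test_function phi -> exists psi,
  [/\ phi^`()%classic = psi, forall x, is_derive x 1 phi (psi x), continuous phi,
      continuous psi & phi 1 = 0].
Proof.
move=> [dphi sphi]; have d0 : forall x, derivable phi x 1 by exact: (dphi 0%N).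
have d1 : forall x, derivable (phi^`()%classic) x 1 by move=> x; have := dphi 1%N x; rewrite derive1n1.
exists (phi^`()%classic); split.
- by [].
- by move=> x; rewrite derive1E; exact: derivableP.
- exact: (derivable_continuous d0).
- exact: (derivable_continuous d1).
- apply: contrapT => /eqP h.
  have : `]0, 1[%classic (1 : R) by apply: sphi; apply: subset_closure.
  by rewrite /= in_itv/= ltxx andbF.
Qed.

Lemma RintegralU f : measurable_fun setT f ->
  \int[lebU]_x f x = \int[mu]_(x in U01) f x.
Proof. by move=> mf; rewrite /Rintegral integral_lebU//; exact/measurable_EFinP. Qed.

Lemma FTC2_right phi psi y : (forall x, is_derive x 1 phi (psi x)) -> continuous phi ->
  continuous psi -> y <= 1 ->
  (\int[mu]_(x in `[y, 1%R]) (psi x)%:E = (phi 1 - phi y)%:E)%E.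
Proof.
move=> dp cphi cp; rewrite le_eqVlt => /predU1P[->|y1].
  by rewrite set_itv1 integral_set1 subrr.
rewrite EFinB; apply: continuous_FTC2.
- exact: y1.
- exact: continuous_subspaceT.
- split; first by move=> x _; case: (dp x).
  + by apply: cvg_at_right_filter; exact: cphi.
  + by apply: cvg_at_left_filter; exact: cphi.
- by move=> x _; rewrite derive1E; exact: derive_val.
Qed.

(** The two iterated integrals of this function on the triangle y <= x are the
two sides of [weak_prim]. *)
Definition tri_kernel v psi (p : R * R) : R :=
  (psi \_ (U01 : set R)) p.1 * ((v \_ (`]0, 1]%classic : set R)) p.2 * \1_[set q : R * R | q.2 <= q.1] p).

Lemma tri_kernel_x v psi x y : 0 <= x <= 1 ->
  tri_kernel v psi (x, y) = ((fun y => psi x * v y) \_ (`]0, x]%classic : set R)) y.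
Proof.
move=> x01; have tri : ((x, y) \in [set q : R * R | q.2 <= q.1]) = (y <= x).
  by apply/idP/idP; rewrite inE.
rewrite /tri_kernel /= !patchE indicE tri !mem_setE !in_itv/= x01.
have /andP[x0 x1] := x01.
have [yx|yx] := leP y x; last by rewrite andbF !mulr0.
by rewrite (le_trans yx x1) !andbT mulr1; case: ifP => // _; rewrite mulr0.
Qed.

Lemma tri_kernel_y v psi x y : 0 < y <= 1 ->
  tri_kernel v psi (x, y) = ((fun x => v y * psi x) \_ (`[y, 1]%classic : set R)) x.
Proof.
move=> y01; have tri : ((x, y) \in [set q : R * R | q.2 <= q.1]) = (y <= x).
  by apply/idP/idP; rewrite inE.
rewrite /tri_kernel /= !patchE indicE tri !mem_setE !in_itv/= y01.
have /andP[y0 y1] := y01.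
have [yx|yx] := leP y x; last by rewrite !mulr0.
rewrite (le_trans (ltW y0) yx)/= mulr1; case: ifP => _; first by rewrite mulrC.
by rewrite mul0r.
Qed.

Lemma tri_kernel_out v psi x y : ~~ (0 <= x <= 1) \/ ~~ (0 < y <= 1) -> tri_kernel v psi (x, y) = 0.
Proof.
rewrite /tri_kernel /= !patchE !mem_setE !in_itv/=.
by move=> [/negbTE ->|/negbTE ->]; rewrite ?mul0r ?mulr0.
Qed.

Lemma measurable_triangle : measurable [set q : R * R | q.2 <= q.1].
Proof.
rewrite (_ : [set q | _] = (fun q : R * R => q.1 - q.2) @^-1` `[0, +oo[).
  by rewrite -[X in measurable X]setTI; apply: measurable_funB.
by apply/seteqP; split => q /=; rewrite in_itv/= andbT subr_ge0.
Qed.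

Lemma integrable_tri_kernel v psi : inL2 v -> continuous psi ->
  (mu \x mu)%E.-integrable setT (EFin \o tri_kernel v psi).
Proof.
move=> vL cp; have iv := inL2_integ01 vL.
pose w := psi \_ (U01 : set R); pose v' := v \_ (`]0, 1]%classic : set R).
have mw : measurable_fun setT w.
  apply/(measurable_restrictT _ (measurable_itv _)); apply: measurable_funTS.
  exact: continuous_measurable.
have mv' : measurable_fun setT v'.
  apply/(measurable_restrictT _ (measurable_itv _)); apply: measurable_funTS; exact: vL.1.
have mf : measurable_fun setT (tri_kernel v psi).
  apply: measurable_funM; first exact: measurableT_comp.
  apply: measurable_funM; first exact: measurableT_comp.
  by apply: measurable_indic; exact: measurable_triangle.
have mEf : measurable_fun setT (EFin \o tri_kernel v psi) by exact/measurable_EFinP.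
have iw : mu.-integrable setT (EFin \o w).
  by rewrite /w -restrict_EFin -integrable_mkcond//; exact: continuous_integ01.
have iv' : mu.-integrable setT (EFin \o v').
  by rewrite /v' -restrict_EFin -integrable_mkcond//; exact: integ01_itv.
pose I := \int[mu]_y `|v' y|.
have I0 : 0 <= I by apply: Rintegral_ge0.
have IE : (\int[mu]_y `|v' y|%:E = I%:E)%E.
  by rewrite /I /Rintegral fineK//; apply: integrable_fin_num => //; exact: (integrable_norm iv').
apply/integrable12ltyP => //.
apply: (@le_lt_trans _ _ (\int[mu]_x (`|w x| * I)%:E)%E); last first.
  under eq_integral do rewrite EFinM.
  rewrite ge0_integralZr//; last by apply/measurable_EFinP; apply: measurableT_comp.
  rewrite lte_mul_pinfty// ?integral_ge0//; last by rewrite ltry.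
  by rewrite ge0_fin_numE ?integral_ge0//; case/integrableP: iw.
apply: ge0_le_integral => //.
- by move=> x _; apply: integral_ge0.
- have := @measurable_fun_fubini_tonelli_F _ _ _ _ R mu (fun p => `|(EFin \o tri_kernel v psi) p|%E).
  by apply => //; apply: measurableT_comp.
- by apply/measurable_EFinP; apply: measurable_funM => //; exact: measurableT_comp.
- move=> x _; rewrite EFinM -IE -ge0_integralZl_EFin//; last first.
    by apply/measurable_EFinP; apply: measurableT_comp.
  apply: ge0_le_integral => //.
  + apply: measurableT_comp => //; apply/measurable_EFinP.
    exact: (measurableT_comp mf (measurable_pair1 x)).
  + by apply: measurable_funeM; apply/measurable_EFinP; apply: measurableT_comp.
  + move=> y _; rewrite -EFinM lee_fin /tri_kernel normrM ler_wpM2l// normrM ler_piMr//.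
    by rewrite indicE; case: (_ \in _); rewrite ?normr1 ?normr0.
Qed.

(** Fubini on the triangle 0 < y <= x <= 1: phi y is minus the integral of psi
over [y, 1]. *)
Lemma weak_prim v phi psi : inL2 v -> (forall x, is_derive x 1 phi (psi x)) ->
  continuous phi -> continuous psi -> phi 1 = 0 ->
  \int[mu]_(x in U01) (prim v x * psi x) = - \int[mu]_(x in U01) (v x * phi x).
Proof.
move=> vL dp cphi cp phi1; have iv := inL2_integ01 vL.
pose f := EFin \o tri_kernel v psi.
have L x : (\int[mu]_y f (x, y) = (((fun x => prim v x * psi x) \_ (U01 : set R)) x)%:E)%E.
  rewrite patchE mem_setE in_itv/=; case: ifPn => [x01|xU]; last first.
    rewrite -[RHS](@integral0 _ _ R mu setT); apply: eq_integral => y _.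
    by rewrite /f /= tri_kernel_out//; left.
  have /andP[x0 x1] := x01; have ix := integ01_itv (lexx 0) x1 iv.
  transitivity (\int[mu]_(y in `]0%R, x]) ((psi x)%:E * (v y)%:E))%E.
    rewrite [RHS]integral_mkcond; apply: eq_integral => y _.
    by rewrite /f /= tri_kernel_x// !patchE; case: ifP => // _; rewrite EFinM.
  rewrite (integralZl _ ix); last exact: measurable_itv.
  by rewrite -(EFin_prim iv x1) -EFinM mulrC.
have Rr y : (\int[mu]_x f (x, y) = (- ((fun y => v y * phi y) \_ (`]0, 1]%classic : set R)) y)%:E)%E.
  rewrite patchE mem_setE in_itv/=; case: ifPn => [y01|yU]; last first.
    rewrite oppr0 -[RHS](@integral0 _ _ R mu setT); apply: eq_integral => x _.
    by rewrite /f /= tri_kernel_out//; right.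
  have /andP[y0 y1] := y01.
  transitivity (\int[mu]_(x in `[y, 1%R]) ((v y)%:E * (psi x)%:E))%E.
    rewrite [RHS]integral_mkcond; apply: eq_integral => x _.
    by rewrite /f /= tri_kernel_y// !patchE; case: ifP => // _; rewrite EFinM.
  have iy : mu.-integrable `[y, 1] (EFin \o psi).
    apply: continuous_compact_integrable; first exact: segment_compact.
    exact: continuous_subspaceT.
  rewrite (integralZl _ iy); last exact: measurable_itv.
  rewrite (FTC2_right dp cphi cp y1) -EFinM; by rewrite phi1 sub0r mulrN.
transitivity (fine (\int[mu]_x \int[mu]_y f (x, y))%E).
  rewrite Rintegral_mkcond /Rintegral; congr fine; apply: eq_integral => x _.
  by rewrite L.
rewrite (@Fubini _ _ _ _ R mu mu f (integrable_tri_kernel vL cp)).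
transitivity (\int[mu]_y (-1 * ((fun y => v y * phi y) \_ (`]0, 1]%classic : set R)) y)).
  by rewrite /Rintegral; congr fine; apply: eq_integral => y _; rewrite Rr mulN1r.
have [C hC] := continuous_bounded01 cphi.
have ivp : integ01 (fun y => v y * phi y).
  by apply: (integ01M iv _ hC); exact: continuous_measurable.
have ivp1 := integ01_itv (lexx 0) (lexx 1) ivp.
rewrite RintegralZl; [|exact: measurableT|]; last by rewrite -restrict_EFin -integrable_mkcond.
by rewrite mulN1r -Rintegral_mkcond Rintegral_itv_obnd_cbnd.
Qed.

Lemma weak_derivative_cprim v : inL2 v -> weak_derivative (cprim v) v.
Proof.
move=> vL phi /test_function_smooth[psi [-> dp cphi cp phi1]].
rewrite !RintegralU.
- rewrite -(weak_prim vL dp cphi cp phi1); apply: eq_Rintegral => x.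
  by rewrite inE/= in_itv/= => x01; rewrite cprimE.
- by apply: measurable_funM; [exact: vL.1|exact: continuous_measurable].
- apply: measurable_funM; first exact: (inL2_cprim vL).1.
  exact: continuous_measurable.
Qed.

End weak.

(** * Functions with a weak derivative are primitives *)

Section duBois.
Variable R : realType.
Implicit Types (f g u v w z phi psi theta : R -> R) (a b c x y m : R).

Local Notation mu := (@lebesgue_measure R).

Lemma bump_integral_cvg v a b : integ01 v -> 0 < a -> a < b -> b < 1 ->
  \int[mu]_(x in U01) (v x * bumpf a b n.+1%:R x) @[n --> \oo] -->
  \int[mu]_(x in `]a, b]) v x.
Proof.
move=> iv a0 ab b1.
have mv := integ01_meas iv.
have mb n : measurable_fun (U01 : set R) (bumpf a b n.+1%:R).
  by apply: measurable_funTS; apply: continuous_measurable; apply: smooth_alg_continuous; exact: smooth_bump.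
have iab : mu.-integrable `]a, b] (EFin \o v).
  by apply: integ01_itv => //; exact: ltW.
pose f_ (n : nat) x := (v x * bumpf a b n.+1%:R x)%:E.
pose f x := (v x * \1_(`]a, b[%classic) x)%:E.
have mf_ n : measurable_fun (U01 : set R) (f_ n).
  by apply/measurable_EFinP; apply: measurable_funM.
have mf : measurable_fun (U01 : set R) f.
  by apply/measurable_EFinP; apply: measurable_funM.
have ff : ae01 (fun x => f_ n x @[n --> \oo] --> f x).
  apply: ae01W => x _; apply: cvg_EFin; first exact: nearW.
  by apply: cvgM; [exact: cvg_cst|exact: bump_cvg].
have fg : ae01 (fun x => forall n, (`|f_ n x| <= `|v x|%:E)%E).
  apply: ae01W => x _ n; rewrite /f_ lee_fin normrM ler_piMr//.
  by rewrite ger0_norm ?bump_ge0 ?bump_le1.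
have fg' : \forall x \ae mu, forall n, U01 x -> (`|f_ n x| <= `|v x|%:E)%E.
  by case: fg => N [mN N0 sN]; exists N; split => // x /= h; apply: sN => /= h'; apply: h => n xU; exact: h'.
have [_ _ cf] := @dominated_convergence _ _ R mu U01 (measurable_itv _) f_ f _ mf_ mf ff (integrable_norm iv) fg'.
have E : (\int[mu]_(x in U01) f x = (\int[mu]_(x in `]a, b]) v x)%:E)%E.
  rewrite -Rintegral_itv_bndo_bndc; last first.
    by apply: integrableS iab => //; apply: subset_itvl; rewrite bnd_simp.
  rewrite /Rintegral fineK; last first.
    apply: integrable_fin_num; first exact: measurable_itv.
    by apply: integrableS iab => //; apply: subset_itvl; rewrite bnd_simp.
  have sab : (`]a, b[ : set R) `<=` U01.
    move=> x /=; rewrite !in_itv/= => /andP[ax xb].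
    by rewrite (ltW (lt_trans a0 ax)) (ltW (lt_trans xb b1)).
  rewrite -{1}(setIidr sab) integral_mkcondr; apply: eq_integral => x _.
  by rewrite /f patchE indicE; case: ifP => // _; rewrite ?mulr1 ?mulr0.
rewrite E in cf; exact: (fine_cvg cf).
Qed.

(** The primitive of theta is zero before a, and after b because theta has
integral zero. *)
Lemma test_function_primitive theta a b : smooth_alg theta -> 0 < a -> a < b -> b < 1 ->
  (forall x, ~~ (a < x < b) -> theta x = 0) -> \int[mu]_(x in U01) theta x = 0 ->
  exists2 phi, test_function phi & phi^`()%classic = theta.
Proof.
move=> st a0 ab b1 t0 it0; have ct := smooth_alg_continuous st.
have E01 : theta = theta \_ (U01 : set R).
  apply/funext => x; rewrite patchE mem_setE in_itv/=; case: ifPn => // x01; apply: t0.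
  apply: contra x01 => /andP[ax xb].
  by rewrite (ltW (lt_trans a0 ax)) (ltW (lt_trans xb b1)).
have iT : mu.-integrable setT (EFin \o theta).
  by rewrite E01 -restrict_EFin -integrable_mkcond//; exact: continuous_integ01.
pose phi x := \int[mu]_(t in `]-oo, x]) theta t.
have dphi x : derivable phi x 1 /\ phi^`()%classic x = theta x.
  apply: (@continuous_FTC1 _ _ -oo%O x (x + 1)); [by rewrite ltrDl| |exact: ltNyr|exact: ct].
  by apply: integrableS iT.
have dE : phi^`()%classic = theta by apply/funext => x; case: (dphi x).
exists phi => //; split.
- move=> [|n] x; first by rewrite derive1n0; exact: (dphi x).1.
  have -> : phi^`(n.+1)%classic = theta^`(n)%classic by rewrite /derive1n iterSr dE.
  exact: smooth_alg_derivable.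
- apply: (@subset_trans _ (closure `[a, b])).
    apply: closure_subset => x /=; apply: contraNP; rewrite in_itv/= => xab; apply/eqP.
    rewrite /phi; have [xa|ax] := leP x a.
      rewrite (@eq_Rintegral _ _ _ _ _ (cst 0)).
        by rewrite /Rintegral integral0.
      move=> t; rewrite inE/= in_itv/= => tx; apply: t0.
      by rewrite negb_and -leNgt (le_trans tx xa).
    have bx : b < x by rewrite ltNge; apply/negP => xb; apply: xab; rewrite (ltW ax).
    rewrite Rintegral_mkcond -[RHS]it0 [RHS]Rintegral_mkcond; apply: eq_Rintegral => t _.
    rewrite -E01 patchE mem_setE in_itv/=; case: ifPn => //; rewrite -ltNge => xt.
    by rewrite t0// negb_and -!leNgt (ltW (lt_trans bx xt)) orbT.
  rewrite (_ : closure _ = `[a, b]%classic); last first.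
    by apply/esym/closure_id; exact: itv_closed.
  move=> x /=; rewrite !in_itv/= => /andP[ax xb].
  by rewrite (lt_le_trans a0 ax) (le_lt_trans xb b1).
Qed.

(** Subtracting the right multiple of one fixed bump from any other bump gives
a function of integral zero, to which w is orthogonal. So w - c is orthogonal
to all bumps, and its integral over every interval vanishes. *)
Lemma du_bois_reymond w : inL2 w ->
  (forall phi, test_function phi -> \int[mu]_(x in U01) (w x * phi^`()%classic x) = 0) ->
  exists c, ae01 (fun x => w x = c).
Proof.
move=> wL H; have iw := inL2_integ01 wL.
have ib a b (n : nat) : integ01 (bumpf a b n.+1%:R).
  by apply: continuous_integ01; apply: smooth_alg_continuous; exact: smooth_bump.
have iwb a b (n : nat) v : integ01 v -> integ01 (fun x => v x * bumpf a b n.+1%:R x).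
  move=> iv; apply: (@integ01M R _ _ 1 iv).
    by apply: continuous_measurable; apply: smooth_alg_continuous; exact: smooth_bump.
  by move=> x _; rewrite ger0_norm ?bump_ge0 ?bump_le1.
have q0 : 0 < (4^-1 : R) by rewrite invr_gt0.
have q1 : (4^-1 : R) < 3/4 by lra.
have q2 : (3/4 : R) < 1 by lra.
have [m I0] : exists m : nat, \int[mu]_(x in U01) bumpf 4^-1 (3/4) m.+1%:R x != 0.
  have := bump_integral_cvg (integ01_cst 1) q0 q1 q2.
  rewrite Rintegral_cst//= lebesgue_itv_oc ?(ltW q1)//= mul1r.
  have q : 0 < (3 / 4 - 4^-1 : R) by lra.
  move=> /cvgr_gt /(_ _ q) /filter_ex[m hm]; exists m.
  rewrite gt_eqF// (lt_le_trans hm)// le_eqVlt; apply/orP; left; apply/eqP.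
  by apply: eq_Rintegral => x _ /=; rewrite mul1r.
set psi0 := bumpf 4^-1 (3/4) m.+1%:R in I0.
pose I := \int[mu]_(x in U01) psi0 x.
pose c := (\int[mu]_(x in U01) (w x * psi0 x)) / I.
exists c.
pose z := w \+ cst (- c).
have iz : integ01 z by apply: integ01D => //; exact: integ01_cst.
have mz : measurable_fun setT z by apply: measurable_funD => //; exact: wL.1.
suff : ae01 (fun x => z x = 0) by apply: ae01_imp => x _ /eqP; rewrite /z /= subr_eq0 => /eqP.
apply: (@prim_locally_cst R [::]) => // a b a0 ab b1 _.
apply/eqP; rewrite eq_sym -subr_eq0 primB ?ltW//; apply/eqP.
have cz := bump_integral_cvg iz a0 ab b1.
have c0 : \int[mu]_(x in U01) (z x * bumpf a b n.+1%:R x) @[n --> \oo] --> (0 : R).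
  apply: cvg_near_cst; apply: nearW => n; set psi := bumpf a b n.+1%:R.
  pose k := (\int[mu]_(x in U01) psi x) / I.
  pose theta x := (- k) * psi0 x + psi x.
  have st : smooth_alg theta by apply: smooth_lin; exact: smooth_bump.
  have mU : measurable (U01 : set R) by exact: measurable_itv.
  have [|||||phi tphi dphi] := @test_function_primitive theta (Num.min a 4^-1) (Num.max b (3/4)) st.
  - by rewrite lt_min a0.
  - by rewrite lt_max !gt_min ab.
  - by rewrite gt_max b1.
  - move=> x xab; rewrite /theta /psi0 /psi !bump_out ?mulr0 ?addr0//.
      by apply: contra xab => /andP[h1 h2]; rewrite gt_min lt_max h1 h2.
    by apply: contra xab => /andP[h1 h2]; rewrite gt_min lt_max h1 h2 !orbT.
  - rewrite /theta RintegralD//; [|exact: (integ01Z _ (ib _ _ _))|exact: ib].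
    rewrite RintegralZl//; last exact: ib.
    by rewrite -/I /k mulNr divfK// addNr.
  have := H phi tphi; rewrite dphi.
  have -> : \int[mu]_(x in U01) (w x * theta x) =
     - k * (\int[mu]_(x in U01) (w x * psi0 x)) + \int[mu]_(x in U01) (w x * psi x).
    rewrite -RintegralZl//; last exact: iwb.
    rewrite -RintegralD//; [|exact: (integ01Z _ (iwb _ _ _ _ iw))|exact: iwb].
    by apply: eq_Rintegral => x _; rewrite /theta; ring.
  have -> : \int[mu]_(x in U01) (z x * psi x) =
     \int[mu]_(x in U01) (w x * psi x) + - c * (\int[mu]_(x in U01) psi x).
    rewrite -RintegralZl//; last exact: ib.
    rewrite -RintegralD//; [|exact: iwb|exact: (integ01Z _ (ib _ _ _))].
    by apply: eq_Rintegral => x _; rewrite /z /=; ring.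
  move=> h; rewrite -[RHS]h addrC; congr (_ + _); rewrite !mulNr; congr (- _).
  by rewrite /c /k [LHS]mulrC mulrCA [LHS]mulrC.
exact: (cvg_unique _ cz c0).
Qed.

Lemma weak_derivative_primitive u v : inL2 u -> inL2 v -> weak_derivative u v ->
  exists c, ae01 (fun x => u x = c + prim v x).
Proof.
move=> uL vL uv; have cL := inL2_cprim vL.
have [|c hc] := @du_bois_reymond (u \- cprim v) (inL2B uL cL).
  move=> phi tphi; have [psi [dE dp cphi cp phi1]] := test_function_smooth tphi.
  have := uv phi tphi; have := weak_derivative_cprim vL tphi; rewrite !dE.
  have [C hC] := continuous_bounded01 cp.
  have mpsi := continuous_measurable cp.
  rewrite !RintegralU; last 3 first.
  - by apply: measurable_funM => //; exact: uL.1.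
  - by apply: measurable_funM; [exact: vL.1|exact: continuous_measurable].
  - by apply: measurable_funM => //; exact: cL.1.
  move=> h1 h2; transitivity (\int[mu]_(x in U01) (u x * psi x) - \int[mu]_(x in U01) (cprim v x * psi x)).
    rewrite -RintegralB//.
    - by apply: eq_Rintegral => x _ /=; rewrite mulrBl.
    - exact: (integ01M (inL2_integ01 uL) mpsi hC).
    - exact: (integ01M (inL2_integ01 cL) mpsi hC).
  by rewrite h1 h2 subrr.
exists c; apply: ae01_imp hc => x xU /= h.
by rewrite -cprimE//; move/eqP: h; rewrite subr_eq => /eqP.
Qed.

End duBois.

(** * Normal form of step functions *)

Section stepfun.
Variable R : realType.
Implicit Types (cs : seq (R * R)) (t u v w F : R -> R) (a b x y : R) (s : seq R).

Local Notation mu := (@lebesgue_measure R).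

(** The left limit of [jumpfun] at x. *)
Definition jumpfunl cs x := \sum_(c <- cs) (if c.1 < x then c.2 else 0).

Definition jumps cs : seq R := map fst cs.

Definition normal_jumps cs :=
  [/\ forall c, c \in cs -> 0 < c.1 < 1, forall c, c \in cs -> c.2 != 0 & uniq (jumps cs)].

Lemma mem_jumps cs c : c \in cs -> c.1 \in jumps cs.
Proof. by move=> cin; apply/mapP; exists c. Qed.

Lemma jumps_itv cs x : (forall c, c \in cs -> 0 < c.1 < 1) -> x \in jumps cs -> 0 < x < 1.
Proof. by move=> H /mapP[c cin ->]; exact: H. Qed.

Lemma jumpfun_cst cs x y : x <= y -> (forall c, c \in cs -> ~ (x < c.1 <= y)) ->
  jumpfun cs x = jumpfun cs y.
Proof.
move=> xy H; rewrite /jumpfun big_seq [RHS]big_seq; apply: eq_bigr => c cin.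
have := H c cin; case: (leP c.1 x) => cx; first by rewrite (le_trans cx xy).
by case: (leP c.1 y) => // cy [].
Qed.

Lemma jumpfun_right cs x : \forall y \near x^'+, jumpfun cs y = jumpfun cs x.
Proof.
have [d d0 hd] : exists2 d, 0 < d & avoids [seq z <- jumps cs | z != x] (x - d) (x + d).
  by apply: avoids_near; rewrite mem_filter eqxx.
near=> y; apply/esym/jumpfun_cst.
  by apply: ltW; near: y; exact: nbhs_right_gt.
move=> c cin /andP[xc cy]; apply: (hd c.1).
  by rewrite mem_filter gt_eqF// mem_jumps.
have yd : y <= x + d by apply: ltW; near: y; apply: nbhs_right_lt; rewrite ltrDl.
by rewrite (le_trans cy yd) (le_trans _ (ltW xc))// gerBl ltW.
Unshelve. all: by end_near. Qed.

Lemma jumpfun_left cs x : \forall y \near x^'-, jumpfun cs y = jumpfunl cs x.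
Proof.
have [d d0 hd] : exists2 d, 0 < d & avoids [seq z <- jumps cs | z != x] (x - d) (x + d).
  by apply: avoids_near; rewrite mem_filter eqxx.
near=> y; rewrite /jumpfun /jumpfunl big_seq [RHS]big_seq; apply: eq_bigr => c cin.
have yx : y < x by near: y; exact: nbhs_left_lt.
have [cy|yc] := leP c.1 y; first by rewrite (le_lt_trans cy yx).
have [cx|//] := ltP c.1 x; exfalso; apply: (hd c.1).
  by rewrite mem_filter lt_eqF// mem_jumps.
have yd : x - d <= y by apply: ltW; near: y; apply: nbhs_left_gt; rewrite gtrBl.
by rewrite (le_trans yd (ltW yc)) (le_trans (ltW cx))// lerDl ltW.
Unshelve. all: by end_near. Qed.

Lemma jumpfun_size cs x : uniq (jumps cs) -> x \in jumps cs ->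
  exists2 c, c \in cs & c.1 = x /\ jumpfun cs x - jumpfunl cs x = c.2.
Proof.
elim: cs => [//|c cs IH] /= /andP[cn un]; rewrite inE => /orP[/eqP ->|xin].
  exists c; rewrite ?mem_head//; split=> //; rewrite /jumpfun /jumpfunl !big_cons lexx ltxx add0r.
  rewrite (_ : \sum_(j <- cs) _ = \sum_(j <- cs) (if j.1 < c.1 then j.2 else 0)) ?addrK//.
  rewrite big_seq [RHS]big_seq; apply: eq_bigr => d din; rewrite le_eqVlt.
  by case: eqP => //= E; move: cn; rewrite -E mem_jumps.
have [d din [<- e]] := IH un xin; exists d; rewrite ?inE ?din ?orbT//; split=> //.
rewrite -e /jumpfun /jumpfunl !big_cons.
have : c.1 != d.1 by apply: contraNneq cn => ->; exact: mem_jumps.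
rewrite le_eqVlt => /negPf -> /=; set u := if _ then _ else _.
by rewrite opprD addrACA subrr add0r.
Qed.

Lemma jumpfunl_nojump cs x : x \notin jumps cs -> jumpfunl cs x = jumpfun cs x.
Proof.
move=> xn; rewrite /jumpfun /jumpfunl big_seq [RHS]big_seq; apply: eq_bigr => c cin.
by rewrite le_eqVlt; case: eqP => // E; move: xn; rewrite -E mem_jumps.
Qed.

Lemma jumpfun_near cs x : x \notin jumps cs -> \forall y \near x, jumpfun cs y = jumpfun cs x.
Proof.
move=> xn; have [d d0 hd] := avoids_near xn; near=> y.
have : y \in `]x - d, x + d[ by near: y; apply: near_in_itvoo; rewrite in_itv/= gtrBl ltrDl d0.
rewrite in_itv/= => /andP[/ltW y1 /ltW y2].
have [yx|xy] := leP y x.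
  apply: jumpfun_cst => // c cin /andP[h1 h2]; apply: (hd _ (mem_jumps cin)).
  by rewrite (le_trans y1 (ltW h1)) (le_trans h2)// lerDl ltW.
apply/esym/jumpfun_cst; first exact: ltW.
move=> c cin /andP[h1 h2]; apply: (hd _ (mem_jumps cin)).
by rewrite (le_trans h2 y2) andbT (le_trans _ (ltW h1))// gerBl ltW.
Unshelve. all: by end_near. Qed.

Lemma near_left01 x : 0 < x <= 1 -> \forall y \near x^'-, 0 < y < 1.
Proof.
move=> /andP[x0 x1]; near=> y; apply/andP; split.
  by near: y; exact: nbhs_left_gt.
by apply: (lt_le_trans _ x1); near: y; exact: nbhs_left_lt.
Unshelve. all: by end_near. Qed.

(** Induction on the partition, which is peeled from the left: right-continuity
ties the value at a breakpoint to the next interval, and a breakpoint where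
nothing jumps is dropped. *)
Lemma step_normal t a s : 0 <= a -> path <%R a s -> last a s = 1 ->
  (forall i, (i < size s)%N -> exists c, forall x,
    nth 1 (a :: s) i < x < nth 1 (a :: s) i.+1 -> t x = c) ->
  (forall x, 0 <= x < 1 -> t y @[y --> x^'+] --> t x) ->
  exists c0 cs, [/\ forall c, c \in cs -> a < c.1 < 1, forall c, c \in cs -> c.2 != 0,
     uniq (jumps cs) & forall x, a < x < 1 -> t x = c0 + jumpfun cs x].
Proof.
elim: s a => [|b s IH] a a0 /=.
  move=> _ -> _ _; exists 0, [::]; split=> // x /andP[h1 h2].
  by have := lt_trans h1 h2; rewrite ltxx.
move=> /andP[ab pb] lb H rc.
have [c hc] := H 0%N isT; rewrite /= in hc.
have b0 : 0 <= b by rewrite (le_trans a0)// ltW.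
have [|c0 [cs [p1 p2 p3 p4]]] := IH b b0 pb lb _ rc.
  by move=> i si; have := H i.+1 si.
have b1 : b <= 1.
  have := pb; rewrite -lb => /(order_path_min lt_trans)/allP h.
  by have := mem_last b s; rewrite inE => /orP[/eqP ->//|/h /ltW].
have [E|bn1] := eqVneq b 1.
  exists c, [::]; split=> // x; rewrite /jumpfun big_nil addr0 => xx; apply: hc.
  by rewrite E.
have {bn1} b1 : b < 1 by rewrite lt_neqAle bn1.
have nob x : x <= b -> jumpfun cs x = 0.
  move=> xb; rewrite /jumpfun big_seq big1// => d /p1 /andP[bd _].
  by rewrite leNgt (le_lt_trans xb bd).
have tb : t b = c0.
  have h := rc b; rewrite b0 b1 in h; have {}h := h isT.
  apply: (cvg_unique _ h) => //; apply: cvg_near_cst.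
  near=> y; rewrite p4.
    have -> : jumpfun cs y = jumpfun cs b by near: y; exact: jumpfun_right.
    by rewrite nob ?addr0.
  by apply/andP; split; near: y; [exact: nbhs_right_gt|exact: nbhs_right_lt].
exists c, (if c0 == c then cs else (b, c0 - c) :: cs).
have q1 d : d \in (if c0 == c then cs else (b, c0 - c) :: cs) -> a < d.1 < 1.
  have q d' : d' \in cs -> a < d'.1 < 1.
    by move=> /p1/andP[h ->]; rewrite (lt_trans ab h).
  case: eqP => _; first exact: q.
  by rewrite inE => /orP[/eqP ->|/q//]; rewrite /= ab b1.
split=> //.
- move=> d; case: eqVneq => [_|cc]; first exact: p2.
  by rewrite inE => /orP[/eqP ->/=|/p2//]; rewrite subr_eq0.
- case: eqVneq => [//|cc] /=; rewrite p3 andbT; apply/mapP => -[d /p1 /andP[bd _] E].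
  by rewrite -E ltxx in bd.
- move=> x /andP[ax x1].
  have -> : jumpfun (if c0 == c then cs else (b, c0 - c) :: cs) x =
     (if b <= x then c0 - c else 0) + jumpfun cs x.
    case: eqVneq => [->|cc]; first by rewrite subrr if_same add0r.
    by rewrite {1}/jumpfun big_cons.
  case: ltgtP => [bx|xb|<-].
  + by rewrite p4 ?bx//; ring.
  + by rewrite nob ?ltW// !addr0; apply: hc; rewrite ax.
  + by rewrite nob// tb; ring.
Unshelve. all: by end_near. Qed.

Lemma stepU_normal t : stepU t -> exists c0 cs, normal_jumps cs /\
  forall x, 0 < x < 1 -> t x = c0 + jumpfun cs x.
Proof.
move=> [[s [ps /eqP ls] ts] rc _].
by have [c0 [cs [p1 p2 p3 p4]]] := @step_normal t 0 s (lexx _) ps ls ts rc; exists c0, cs.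
Qed.

Lemma stepU_jumpfun c0 cs : (forall c, c \in cs -> 0 < c.1 < 1) ->
  stepU (fun x => c0 + jumpfun cs x).
Proof.
move=> cs01; split.
- pose p := sort <=%R (undup (jumps cs)).
  have pin x : (x \in p) = (x \in jumps cs) by rewrite mem_sort mem_undup.
  have sp : sorted <%R (0 :: rcons p 1).
    rewrite /= rcons_path lt_path_sortedE sort_lt_sorted undup_uniq andbT; apply/andP; split.
      by apply/allP => x; rewrite pin => /(jumps_itv cs01)/andP[].
    have := mem_last 0 p; rewrite inE => /orP[/eqP ->//|].
    by rewrite pin => /(jumps_itv cs01)/andP[].
  exists (rcons p 1); first by split; rewrite ?last_rcons.
  move=> i; rewrite size_rcons => si.
  exists (c0 + jumpfun cs (nth 1 (0 :: rcons p 1) i)) => x /andP[x1 x2]; congr (_ + _).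
  apply/esym/jumpfun_cst; first exact: ltW.
  move=> c cin /andP[c1 c2].
  have : c.1 \in 0 :: rcons p 1 by rewrite inE mem_rcons inE pin mem_jumps// !orbT.
  move=> /(nthP 1)[j sj ej]; rewrite -ej in c1 c2.
  have si1 : (i < size (0%R :: rcons p 1%R))%N by rewrite /= size_rcons ltnS ltnW.
  have si2 : (i.+1 < size (0%R :: rcons p 1%R))%N by rewrite /= size_rcons ltnS.
  have := lt_sorted_ltn_nth 1 sp; move=> mono.
  have ij : (i < j)%N by rewrite -(mono i j).
  have : nth 1 (0 :: rcons p 1) j < nth 1 (0 :: rcons p 1) i.+1 by exact: le_lt_trans c2 x2.
  by rewrite (mono j i.+1)// ltnS leqNgt ij.
- move=> x _; apply: cvg_near_cst; near=> y; congr (_ + _); near: y; exact: jumpfun_right.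
- have n1 : 1 \notin jumps cs by apply/negP => /(jumps_itv cs01)/andP[_]; rewrite ltxx.
  rewrite -(jumpfunl_nojump n1).
  by apply: cvg_near_cst; near=> y; congr (_ + _); near: y; exact: jumpfun_left.
Unshelve. all: by end_near. Qed.

Lemma discontinuity_jumpfun t c0 cs : (forall x, 0 < x < 1 -> t x = c0 + jumpfun cs x) ->
  normal_jumps cs -> [set x | 0 < x < 1 /\ ~ {for x, continuous t}] = [set` jumps cs].
Proof.
move=> tE [p1 p2 p3]; apply/seteqP; split=> x /=.
- move=> [x01 dis]; rewrite -[x \in _]negbK; apply/negP => xn; apply: dis.
  apply: cvg_near_cst; near=> y; rewrite !tE//; last first.
    have : y \in `]0, 1[ by near: y; apply: near_in_itvoo; rewrite in_itv.
    by rewrite in_itv.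
  by congr (_ + _); near: y; exact: jumpfun_near.
- move=> xin; have x01 := jumps_itv p1 xin; split=> // ct.
  have [c cin [_ e]] := jumpfun_size p3 xin.
  have : t x = c0 + jumpfunl cs x.
    apply: (cvg_unique _ (cvg_at_left_filter ct)) => //; apply: cvg_near_cst.
    have x01' : 0 < x <= 1 by case/andP: x01 => -> /ltW.
    near=> y; rewrite tE; last by near: y; exact: near_left01.
    by congr (_ + _); near: y; exact: jumpfun_left.
  rewrite tE// => /addrI E; have := p2 c cin.
  by rewrite -e E subrr eqxx.
Unshelve. all: by end_near. Qed.

Lemma counting_seq s : uniq s -> counting [set` s] = ((size s)%:R%:E : \bar R).
Proof.
move=> us; rewrite /counting; case: asboolP => [_|[]]; last exact: finite_seq.
congr (_%:R%:E)%E; apply: perm_size; apply: uniq_perm; rewrite ?finmap.fset_uniq// => x;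
 rewrite in_fset_set ?inE//=; apply/idP/idP => [/set_mem /=|h] //; exact/mem_set.
Qed.

End stepfun.

(** * Uniqueness of the decomposition into steps and a Sobolev part *)

Section SBV.
Variable R : realType.
Implicit Types (cs : seq (R * R)) (t u v w F : R -> R) (a b x y : R) (s : seq R) (f : L2U R).

Local Notation mu := (@lebesgue_measure R).

Lemma ae_eq_lebU u v : ae_eq (@lebU R) setT u v <-> ae01 (fun x => u x = v x).
Proof.
rewrite /ae01 -ae_lebU; split; case=> N [mN N0 sN]; exists N; split=> // x /= h; apply: sN => /=.
  by move=> h'; apply: h; exact: h'.
by move=> h'; apply: h => _.
Qed.

Lemma ae01_itv (P : set R) a b : ae01 P -> 0 <= a -> a < b -> b <= 1 ->
  exists2 y, a < y < b & P y.
Proof.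
move=> [N [mN N0 sN]] a0 ab b1; apply: contrapT => H.
suff : (mu `]a, b[ <= mu N)%E.
  by rewrite N0 lebesgue_measure_itv/= lte_fin ab -EFinB lee_fin subr_le0 leNgt ab.
apply: le_measure; rewrite ?inE//.
move=> y /=; rewrite in_itv/= => /andP[ay yb]; apply: sN => /= Py.
apply: H; exists y; first by rewrite ay.
by apply: Py; rewrite in_itv/= (le_trans a0 (ltW ay)) (le_trans (ltW yb)).
Qed.

Lemma ae01_right (P Q : set R) x : ae01 P -> 0 <= x < 1 -> (\forall y \near x^'+, Q y) ->
  exists y, [/\ P y, Q y & 0 < y < 1].
Proof.
move=> aP /andP[x0 x1] [e /= e0 he].
have [||y /andP[xy]] := @ae01_itv P x (Num.min (x + e) 1) aP x0.
- by rewrite lt_min x1 ltrDl e0.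
- by rewrite ge_min lexx orbT.
rewrite lt_min => /andP[ye y1] Py; exists y; split=> //; last by rewrite (le_lt_trans x0 xy).
by apply: he => //=; rewrite ltr_distlC (lt_trans _ xy) ?gtrBl.
Qed.

Lemma ae01_left (P Q : set R) x : ae01 P -> 0 < x <= 1 -> (\forall y \near x^'-, Q y) ->
  exists y, [/\ P y, Q y & 0 < y < 1].
Proof.
move=> aP /andP[x0 x1] [e /= e0 he].
have [||y /andP[]] := @ae01_itv P (Num.max (x - e) 0) x aP _ _ x1.
- by rewrite le_max lexx orbT.
- by rewrite gt_max x0 gtrBl e0.
rewrite gt_max => /andP[ye y0] xy Py; exists y; split=> //; last by rewrite y0 (lt_le_trans xy).
by apply: he => //=; rewrite ltr_distlC ye (lt_trans xy) ?ltrDl.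
Qed.

(** Almost everywhere statements hold at points arbitrarily close to the ends
of the interval. *)
Lemma continuous_ae_cst w K a b : continuous w -> 0 <= a -> a < b -> b <= 1 ->
  ae01 (fun x => a < x < b -> w x = K) -> w a = K /\ w b = K.
Proof.
move=> cw a0 ab b1 H; split; apply/eqP/negP => /negP wK.
- have nK : \forall y \near a^'+, w y != K.
    have e0 : 0 < `|w a - K| by rewrite normr_gt0 subr_eq0.
    have /cvgrPdist_lt/(_ _ e0) h := cvg_at_right_filter (cw a).
    by apply: filterS h => y; apply: contraTneq => ->; rewrite ltxx.
  have [||y [/= h [wy yb] _]] := @ae01_right _ (fun y => w y != K /\ a < y < b) a H.
  + by rewrite a0 (lt_le_trans ab b1).
  + near=> y; split; last by apply/andP; split; near: y; [exact: nbhs_right_gt|exact: nbhs_right_lt].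
    by near: y.
  + by move: wy; rewrite h ?eqxx.
- have nK : \forall y \near b^'-, w y != K.
    have e0 : 0 < `|w b - K| by rewrite normr_gt0 subr_eq0.
    have /cvgrPdist_lt/(_ _ e0) h := cvg_at_left_filter (cw b).
    by apply: filterS h => y; apply: contraTneq => ->; rewrite ltxx.
  have [||y [/= h [wy yb] _]] := @ae01_left _ (fun y => w y != K /\ a < y < b) b H.
  + by rewrite b1 (le_lt_trans a0 ab).
  + near=> y; split; last by apply/andP; split; near: y; [exact: nbhs_left_gt|exact: nbhs_left_lt].
    by near: y.
  + by move: wy; rewrite h ?eqxx.
Unshelve. all: by end_near. Qed.

Lemma prim_nsq0 v x : inL2 v -> nsq v = 0 -> 0 <= x <= 1 -> prim v x = 0.
Proof.
move=> vL n0 x01; have := prim_sqr_le vL x01; rewrite n0 => h.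
by apply/eqP; rewrite -sqrf_eq0 eq_le h sqr_ge0.
Qed.

Lemma prim_ae0 v x : inL2 v -> ae01 (fun y => v y = 0) -> 0 <= x <= 1 -> prim v x = 0.
Proof.
move=> vL v0; apply: prim_nsq0 => //.
by rewrite (nsq_ae vL (inL2_cst 0))// nsq_cst expr0n.
Qed.

(** Between consecutive jumps of either side, the primitive of v - v' is almost
everywhere, hence everywhere, equal to a constant; so v = v' by
[prim_locally_cst]. The jump parts then differ by a constant almost
everywhere, and a function that is locally constant around x cannot match the
two one-sided limits of [jumpfun cs'] at one of its jumps. *)
Lemma normal_form_unique c0 cs v c0' cs' v' : normal_jumps cs' -> inL2 v -> inL2 v' ->
  ae01 (fun x => c0 + jumpfun cs x + prim v x = c0' + jumpfun cs' x + prim v' x) ->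
  ae01 (fun x => v x = v' x) /\ {subset jumps cs' <= jumps cs}.
Proof.
move=> [p1 p2 p3] vL vL' H.
have wL := inL2B vL vL'.
have ae_w : ae01 (fun x => (v \- v') x = 0).
  apply: (@prim_locally_cst R (jumps cs ++ jumps cs')); [exact: wL.1|exact: inL2_integ01|].
  move=> a b a0 ab b1 av; rewrite -!cprimE ?a0 ?(ltW a0) ?(ltW b1) ?(ltW (lt_trans a0 ab)) ?(ltW (lt_trans ab b1))//.
  have nj (l : seq (R * R)) x : {subset jumps l <= jumps cs ++ jumps cs'} -> a < x < b -> jumpfun l x = jumpfun l a.
    move=> sl /andP[ax xb]; apply/esym/jumpfun_cst; first exact: ltW.
    move=> c cin /andP[h1 h2]; apply: (av c.1).
      by apply: sl; exact: mem_jumps.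
    by rewrite (ltW h1) (le_trans h2 (ltW xb)).
  have [|-> -> //] := @continuous_ae_cst (cprim (v \- v')) (c0' + jumpfun cs' a - (c0 + jumpfun cs a)) a b
    (cprim_continuous wL) (ltW a0) ab (ltW b1).
  apply: ae01_imp H => x; rewrite /= in_itv/= => x01 h xab; rewrite cprimE// primB_fun//; last by case/andP: x01.
  move: h; rewrite !nj// => [h|y yin|y yin]; [|by rewrite mem_cat yin orbT|by rewrite mem_cat yin].
  by apply/eqP; rewrite subr_eq addrAC -h addrC addKr.
have ae_v : ae01 (fun x => v x = v' x).
  by apply: ae01_imp ae_w => x _ /= /eqP; rewrite subr_eq0 => /eqP.
split=> // x xin; rewrite -[_ \in _]negbK; apply/negP => xn.
have x01 := jumps_itv p1 xin.
have {}H : ae01 (fun x => c0 + jumpfun cs x = c0' + jumpfun cs' x).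
  apply: ae01_imp H => y; rewrite /= in_itv/= => y01.
  have /eqP := prim_ae0 wL ae_w y01; rewrite primB_fun//; last by case/andP: y01.
  by rewrite subr_eq0 => /eqP -> /addIr.
have [||y [h1 [h2 h3] _]] := @ae01_right _ (fun y => jumpfun cs y = jumpfun cs x /\ jumpfun cs' y = jumpfun cs' x) x H.
- by case/andP: x01 => /ltW -> ->.
- by near=> y; split; near: y; exact: jumpfun_right.
have [||z [k1 [k2 k3] _]] := @ae01_left _ (fun y => jumpfun cs y = jumpfunl cs x /\ jumpfun cs' y = jumpfunl cs' x) x H.
- by case/andP: x01 => -> /ltW ->.
- by near=> z; split; near: z; exact: jumpfun_left.
have [c cin [_ e]] := jumpfun_size p3 xin.
move: h1 k1; rewrite h2 h3 k2 k3 jumpfunl_nojump// => -> /addrI E.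
by have := p2 c cin; rewrite -e E subrr eqxx.
Unshelve. all: by end_near. Qed.

Lemma int_sqr_lebU v : inL2 v -> (\int[lebU]_x (`|v x| ^+ 2)%:E = (nsq v)%:E)%E.
Proof.
move=> vL; rewrite nsqE// -sqn_lebU; last exact: vL.1.
by apply: eq_integral => x _; rewrite real_normK ?num_real.
Qed.

(** Evaluates the choices made in [jump_number] and [SBV_derivative]. *)
Lemma SBV_get f : SBV2 f -> exists c0 cs v,
  [/\ normal_jumps cs, inL2 v, ae01 (fun x => f x = c0 + jumpfun cs x + prim v x),
      jump_number f = (size cs)%:R%:E
    & (\int[lebU]_x (`|SBV_derivative f x| ^+ 2)%:E = (nsq v)%:E)%E].
Proof.
move=> /getPex; rewrite /jump_number /SBV_derivative.
set p := get _ => -[/stepU_normal[c0 [cs [nj tE]]] [/inL2_Lfun uL [v0 v0L uv0]] /ae_eq_lebU fE].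
have [|vL uv] := @getPex _ [set v | v \in Lfun lebU 2%:E /\ weak_derivative p.2 v].
  by exists v0.
move/inL2_Lfun: vL => vL; have [c hc] := weak_derivative_primitive uL vL uv.
exists (c0 + c), cs, (sobolev_derivative p.2); split=> //.
- apply: ae01_imp (ae01_and (ae01_oo tE) (ae01_and hc fE)) => x _ /= [e1 [e2 e3]].
  by rewrite e3 e1 e2; ring.
- by rewrite (discontinuity_jumpfun tE nj) counting_seq ?size_map//; case: nj.
- exact: int_sqr_lebU.
Qed.

(** The list cs may contain repetitions and heights that cancel, whence only an
inequality for the number of jumps. *)
Lemma SBV_of f c0 cs v : (forall c, c \in cs -> 0 < c.1 < 1) -> inL2 v ->
  ae01 (fun x => f x = c0 + jumpfun cs x + prim v x) ->
  [/\ SBV2 f, (jump_number f <= (size cs)%:R%:E)%E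
    & (\int[lebU]_x (`|SBV_derivative f x| ^+ 2)%:E = (nsq v)%:E)%E].
Proof.
move=> cs01 vL fE.
have sf : SBV2 f.
  exists (fun x => c0 + jumpfun cs x, cprim v); split=> /=.
  - exact: stepU_jumpfun.
  - split; first by apply/inL2_Lfun; exact: inL2_cprim.
    by exists v; [exact/inL2_Lfun|exact: weak_derivative_cprim].
  - by apply/ae_eq_lebU; apply: ae01_imp fE => x xU -> ; rewrite cprimE.
have [c0' [cs' [v' [nj' vL' fE' -> ->]]]] := SBV_get sf.
have [|ev sub] := @normal_form_unique c0 cs v c0' cs' v' nj' vL vL'.
  by apply: ae01_imp (ae01_and fE fE') => x _ /= [<- <-].
split=> //; last by rewrite (nsq_ae vL vL' ev).
rewrite lee_fin ler_nat -(size_map fst cs) -(size_map fst cs').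
by case: nj' => _ _ u; exact: uniq_leq_size.
Qed.

Lemma stepU_SBV f : of_class (@stepU R) f -> exists c0 cs,
  [/\ normal_jumps cs, ae01 (fun x => f x = c0 + jumpfun cs x)
    & jump_number f = (size cs)%:R%:E].
Proof.
move=> [t /stepU_normal[c0 [cs [nj tE]]] /ae_eq_lebU fE].
have {}fE : ae01 (fun x => f x = c0 + jumpfun cs x).
  by apply: ae01_imp (ae01_and (ae01_oo tE) fE) => x _ /= [<- ->].
exists c0, cs; split=> //; apply/eqP; rewrite eq_le.
have z0 x : U01 x -> prim (cst 0) x = 0 :> R by move=> /= /[!in_itv]/= /andP[x0 _]; rewrite prim_cst ?mul0r.
have fE0 : ae01 (fun x => f x = c0 + jumpfun cs x + prim (cst 0) x).
  by apply: ae01_imp fE => x xU ->; rewrite z0 ?addr0.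
have [sf -> _] := SBV_of (let: And3 h _ _ := nj in h) (inL2_cst 0) fE0.
have [c0' [cs' [v' [_ vL' fE' -> _]]]] := SBV_get sf.
have [|_ sub] := @normal_form_unique c0' cs' v' c0 cs (cst 0) nj vL' (inL2_cst 0).
  by apply: ae01_imp (ae01_and fE' fE0) => x _ /= [<- <-].
rewrite lee_fin ler_nat -(size_map fst cs) -(size_map fst cs').
by case: nj => _ _ u; exact: uniq_leq_size.
Qed.

End SBV.

(** * The functionals on a grid *)

Section discrete.
Variable R : realType.
Implicit Types (h u v : R -> R) (a : nat -> R) (x y gam m d : R) (f g : L2U R) (n k : nat).

Local Notation mu := (@lebesgue_measure R).

Lemma stepU_n_cells n h x : (0 < n)%N -> stepU_n n h -> 0 <= x < 1 -> h x = h (cellpt R n (cell n x)).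
Proof.
move=> n0 [h1 h2] /andP[x0 x1]; have := cell_itv n0 x0; have := cell_lt n0 x0 x1.
set k := cell n x => kn kx; have [kn'|] := ltnP k.+1 n; first exact: h1.
move=> nk; have -> : k = n.-1 by apply/eqP; rewrite eqn_leq -ltnS prednK// kn -ltnS prednK.
apply: h2; rewrite (ltW x1) andbT; have /andP[+ _] := kx.
by rewrite (_ : k = n.-1)//; apply/eqP; rewrite eqn_leq -ltnS prednK// kn -ltnS prednK.
Qed.

Lemma stepU_n_of n a : (0 < n)%N -> stepU_n n (fun x => a (minn (cell n x) n.-1)).
Proof.
move=> n0; split=> [k kn x kx|x /andP[x1 x2]].
  by rewrite (cell_unique n0 kx) cell_cellpt.
rewrite cell_cellpt// minnn; congr a; apply/minn_idPr.
have x0 : 0 <= x by apply: le_trans x1; exact: cellpt_ge0.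
have /andP[_ h] := cell_itv n0 x0; have := le_lt_trans x1 h.
by rewrite /cellpt ltr_pM2r ?invr_gt0 ?ltr0n// ltr_nat ltnS.
Qed.

Lemma step_rep_stepf n a : (0 < n)%N ->
  ae01 (fun x => stepf n a x = a (minn (cell n x) n.-1)).
Proof.
move=> n0; apply: ae01_oo => x /andP[x0 x1].
rewrite stepfE ?(ltW x0)//; congr a; apply/esym/minn_idPl.
by rewrite -ltnS prednK// cell_lt// ltW.
Qed.

Lemma stepf_ae_inj n a b : (0 < n)%N -> ae01 (fun x => stepf n a x = stepf n b x) ->
  forall k, (k < n)%N -> a k = b k.
Proof.
move=> n0 H k kn.
have [|y /andP[y1 y2]] := ae01_itv H (cellpt_ge0 R n k) (cellpt_lt R n0 (ltnSn k)).
  exact: cellpt_le1.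
have y01 : 0 <= y < 1.
  rewrite (le_trans (cellpt_ge0 R n k) (ltW y1)) (lt_le_trans y2)//; exact: cellpt_le1.
have yk : cell n y = k by apply: cell_unique => //; rewrite ltW.
by rewrite !stepfE// yk.
Qed.

Lemma of_class_stepf n f : (0 < n)%N -> of_class (@stepU_n R n) f ->
  exists a, ae01 (fun x => f x = stepf n a x).
Proof.
move=> n0 [h hn /ae_eq_lebU fh]; exists (fun k => h (cellpt R n k)).
have H : ae01 (fun x => h x = stepf n (fun k => h (cellpt R n k)) x).
  apply: ae01_oo => x /andP[x0 x1]; rewrite stepfE ?(ltW x0)//.
  by apply: stepU_n_cells => //; rewrite ltW.
by apply: ae01_imp (ae01_and fh H) => x _ /= [-> ->].
Qed.

Lemma repr_in_stepf n a f : (0 < n)%N -> ae01 (fun x => f x = stepf n a x) ->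
  of_class (@stepU_n R n) f /\
  forall k, (k < n)%N -> repr_in (@stepU_n R n) f (cellpt R n k) = a k.
Proof.
move=> n0 fa; have H : of_class (@stepU_n R n) f.
  exists (fun x => a (minn (cell n x) n.-1)); first exact: stepU_n_of.
  by apply/ae_eq_lebU; apply: ae01_imp (ae01_and fa (step_rep_stepf a n0)) => x _ /= [-> ->].
split=> // k kn; rewrite /repr_in; set S := [set _ | _].
have [hn /ae_eq_lebU fh] : S (get S) by apply: getPex; case: H => h hn fh; exists h.
apply: (@stepf_ae_inj n (fun k => get S (cellpt R n k)) a n0) => //.
have H' : ae01 (fun x => get S x = stepf n (fun k => get S (cellpt R n k)) x).
  apply: ae01_oo => x /andP[x0 x1]; rewrite stepfE ?(ltW x0)//.
  by apply: stepU_n_cells => //; rewrite ltW.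
by apply: ae01_imp (ae01_and fa (ae01_and fh H')) => x _ /= [<- [-> ->]].
Qed.

Lemma cell_meanE g n k : (0 < n)%N -> (k < n)%N -> cell_mean g n k = mean g n k.
Proof.
move=> n0 kn; rewrite /cell_mean /mean; congr (_ * _).
have gL := inL2_L2U g.
have c0 := cellpt_ge0 R n k; have cc := cellpt_lt R n0 (ltnSn k).
have c1 := cellpt_le1 R n0 kn.
rewrite primB//; [|exact: inL2_integ01|exact: ltW].
rewrite [RHS]Rintegral_itv_obnd_cbnd; last by apply: integ01_itv => //; exact: inL2_integ01.
rewrite -/(cellpt R n k) -/(cellpt R n k.+1).
rewrite Rintegral_mkcond RintegralU; last first.
  apply/(measurable_restrictT _ _).1 => //; exact: measurable_funS gL.1.
rewrite [RHS]Rintegral_mkcond [LHS]Rintegral_mkcond; apply: eq_Rintegral => x _.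
rewrite !patchE; case: ifPn => //; rewrite !mem_setE !in_itv/= => /negP h.
case: ifPn => // /andP[h1 h2]; exfalso; apply: h.
by rewrite (le_trans c0 h1) (le_trans h2 c1).
Qed.

(** One formula for the three interactions between neighbours on a grid, so
that limits in gamma and mu may cross the boundaries between the cases. *)
Definition bond gam m n d : R :=
  if gam == 0 then 0 else if m == 0 then gam * (d != 0)%:R
  else Num.min (n%:R / m ^+ 2 * d ^+ 2) gam.

Definition bond_energy gam m n a :=
  \sum_(k < n.-1) bond gam m n (a k.+1 - a k).

Definition vec_fidelity g n a := n%:R^-1 * \sum_(k < n) (a k - mean g n k) ^+ 2.

Lemma vec_fidelityE g n a f : (0 < n)%N -> ae01 (fun x => f x = stepf n a x) ->
  vec_fidelity g n a = nsq (f \- avg g n).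
Proof.
move=> n0 fa; rewrite /vec_fidelity -(nsq_stepf (fun k => a k - mean g n k) n0).
apply: nsq_ae; [exact: inL2_stepf|by apply: inL2B; [exact: inL2_L2U|exact: inL2_stepf]|].
apply: ae01_imp (ae01_and fa (ae01_and (ae01_stepf a n0) (ae01_and (ae01_stepf (fun k => a k - mean g n k) n0)
  (ae01_stepf (mean g n) n0)))) => x _ /= [-> [-> [-> e]]].
by rewrite /avg e.
Qed.

Lemma discrete_fidelityE g n a h : (0 < n)%N -> (forall k, (k < n)%N -> h (cellpt R n k) = a k) ->
  discrete_fidelity g n h = vec_fidelity g n a.
Proof.
move=> n0 ha; congr (_ * _); apply: eq_bigr => k _.
by rewrite cell_meanE// -ha.
Qed.

Lemma mesh_neq0 n : (0 < n)%N -> (n%:R^-1 == 0 :> R) = false.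
Proof. by move=> n0; rewrite invr_eq0 pnatr_eq0 eqn0Ngt n0. Qed.

Lemma Ffun_discrete g gam m n f a : (0 < n)%N -> ae01 (fun x => f x = stepf n a x) ->
  Ffun g (gam, m, n%:R^-1) f = (bond_energy gam m n a + vec_fidelity g n a)%:E.
Proof.
move=> n0 fa; have [fc ha] := repr_in_stepf n0 fa.
have kn (k : 'I_n.-1) : (k.+1 < n)%N by rewrite -ltn_predRL.
rewrite /Ffun mesh_neq0// invrK Num.Theory.natrK /bond_energy /bond.
case: ifP => _; last case: ifP => _.
- rewrite /discrete_projection asboolT// (discrete_fidelityE _ n0 ha).
  by rewrite big1 ?add0r.
- rewrite /discrete_potts asboolT// (discrete_fidelityE _ n0 ha).
  congr ((_ + _)%:E); rewrite -mulr_sumr; congr (_ * _).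
  rewrite -sum1_card natr_sum big_mkcond; apply: eq_bigr => k _.
  rewrite inE (ha k.+1 (kn k)) (ha k (ltnW (kn k))) subr_eq0; by case: ifP.
- rewrite /blake_zisserman asboolT// (discrete_fidelityE _ n0 ha).
  congr ((_ + _)%:E); apply: eq_bigr => k _.
  by rewrite (ha k.+1 (kn k)) (ha k (ltnW (kn k))).
Qed.

Lemma Ffun_discrete_out g gam m n f : (0 < n)%N -> ~ of_class (@stepU_n R n) f ->
  Ffun g (gam, m, n%:R^-1) f = +oo%E.
Proof.
move=> n0 fc.
rewrite /Ffun mesh_neq0// invrK Num.Theory.natrK.
case: ifP => _; last case: ifP => _.
- by rewrite /discrete_projection asboolF.
- by rewrite /discrete_potts asboolF.
- by rewrite /blake_zisserman asboolF.
Qed.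

End discrete.

(** * Upper bounds for the functionals *)

Section bounds.
Variable R : realType.
Implicit Types (h u v A k : R -> R) (a : nat -> R) (x y gam m t d e E : R) (f g : L2U R) (n : nat)
  (cs : seq (R * R)) (p : seq R).

Local Notation mu := (@lebesgue_measure R).

(** g, or its average g_n on a grid: the fidelity term is always the squared
distance to this function. *)
Definition target g t : R -> R := if t == 0 then g : R -> R else avg g (Num.truncn t^-1).

Definition grid t x : R :=
  if t == 0 then x else cellpt R (Num.truncn t^-1) (cell (Num.truncn t^-1) x).

Lemma target_inv g n : (0 < n)%N -> target g n%:R^-1 = avg g n.
Proof. by move=> n0; rewrite /target mesh_neq0// invrK Num.Theory.natrK. Qed.

Lemma grid_inv n x : (0 < n)%N -> grid n%:R^-1 x = cellpt R n (cell n x).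
Proof. by move=> n0; rewrite /grid mesh_neq0// invrK Num.Theory.natrK. Qed.

Lemma inL2_target g t : inL2 (target g t).
Proof. by rewrite /target; case: ifP => _; [exact: inL2_L2U|exact: inL2_stepf]. Qed.

Lemma sqdistE f g : sqdist f g = (nsq (f \- g))%:E.
Proof.
have L := inL2B (inL2_L2U f) (inL2_L2U g).
by rewrite nsqE// -sqn_lebU//; exact: L.1.
Qed.

Lemma Qset_cases gam m t : Qset (gam, m, t) ->
  [/\ 0 <= gam, 0 <= m & t = 0 \/ exists2 n, (0 < n)%N & t = n%:R^-1].
Proof. by case. Qed.

(** The regularity that a finite cost entails. The slack 2 t absorbs the
rounding of x and y to the grid. *)
Definition rough m t E p h A := [/\ {homo A : x y / x <= y}, forall x, 0 <= A x <= E &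
  forall x y, 0 < x -> x < y -> y < 1 -> avoids p x y ->
    (h y - h x) ^+ 2 <= m ^+ 2 * (y - x + 2 * t) * (A y - A x)].

(** The elastic energy is e = nsq v / m^2; written as a product it covers m = 0
as well, where v = 0. *)
Lemma Ffun_continuous_normal g gam m f : 0 < gam -> (Ffun g (gam, m, 0%R) f < +oo)%E ->
  exists c0 cs v e, [/\ normal_jumps cs, inL2 v,
    ae01 (fun x => f x = c0 + jumpfun cs x + prim v x),
    0 <= e /\ nsq v = m ^+ 2 * e
    & Ffun g (gam, m, 0%R) f = (gam * (size cs)%:R + e + nsq (f \- g))%:E].
Proof.
move=> g0; rewrite /Ffun (gt_eqF g0) eqxx; case: eqVneq => [->|m0].
- rewrite /continuous_potts; case: asboolP => // fc _.
  have [c0 [cs [nj fE jE]]] := stepU_SBV fc.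
  exists c0, cs, (cst 0), 0; split=> //.
  + exact: inL2_cst.
  + apply: ae01_imp fE => x; rewrite /= in_itv/= => /andP[x0 _] ->.
    by rewrite prim_cst ?mul0r ?addr0.
  + by rewrite nsq_cst expr0n mul0r.
  + by rewrite jE sqdistE addr0; move: (nsq _) => N; rewrite EFinD EFinM.
- rewrite /mumford_shah; case: asboolP => // fc _.
  have [c0 [cs [v [nj vL fE jE vE]]]] := SBV_get fc.
  exists c0, cs, v, (nsq v / m ^+ 2); split=> //.
  + split; first by rewrite divr_ge0 ?nsq_ge0 ?sqr_ge0.
    by rewrite mulrC divfK// expf_neq0.
  + rewrite jE vE sqdistE; move: (nsq (_ \- _)) (nsq v) => N N'.
    by rewrite [N' / _]mulrC.
Qed.

Lemma Ffun_continuous_le g gam m f c0 cs v : 0 <= gam -> (forall c, c \in cs -> 0 < c.1 < 1) ->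
  inL2 v -> (m = 0 -> nsq v = 0) -> ae01 (fun x => f x = c0 + jumpfun cs x + prim v x) ->
  (Ffun g (gam, m, 0%R) f <= (gam * (size cs)%:R + nsq v / m ^+ 2 + nsq (f \- g))%:E)%E.
Proof.
move=> g0 cs01 vL mv fE; rewrite /Ffun eqxx.
have e0 : 0 <= nsq v / m ^+ 2 by rewrite divr_ge0 ?nsq_ge0 ?sqr_ge0.
have [sf jf vf] := SBV_of cs01 vL fE.
case: eqVneq => [->|gn0].
  by rewrite sqdistE lee_fin mul0r add0r lerDr.
have jf' : (gam%:E * jump_number f <= (gam * (size cs)%:R)%:E)%E.
  by rewrite EFinM lee_pmul2l// lte_fin lt_neqAle eq_sym gn0.
case: eqVneq => [m0|m0].
- rewrite /continuous_potts asboolT ?sqdistE; last first.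
    exists (fun x => c0 + jumpfun cs x); first exact: stepU_jumpfun.
    apply/ae_eq_lebU; apply: ae01_imp fE => x xU ->.
    by rewrite (prim_nsq0 vL (mv m0)) ?addr0.
  rewrite mv// mul0r addr0; move: (nsq _) => N.
  by rewrite EFinD leeD2r.
- rewrite /mumford_shah asboolT// vf sqdistE -EFinM [(_^-1 * _)]mulrC.
  move: (nsq (_ \- _)) (nsq v) => N N'; rewrite !EFinD.
  by rewrite leeD2r// leeD2r.
Qed.

Lemma inL2_jumpfun cs : inL2 (jumpfun cs).
Proof.
have step (c : R * R) : inL2 (fun x => if c.1 <= x then c.2 else 0).
  apply: (@inL2_bounded _ `|c.2|); last first.
    by apply: ae01W => x _; case: ifP => // _; rewrite normr0.
  have -> : (fun x => if c.1 <= x then c.2 else 0) = (fun x => c.2 * \1_(`[c.1, +oo[%classic) x).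
    by apply/funext => x; rewrite indicE mem_setE in_itv/= andbT; case: ifP => _; rewrite ?mulr1 ?mulr0.
  by apply: measurable_funM => //; exact: measurable_indic.
elim: cs => [|c cs IH].
  have -> : jumpfun [::] = cst (0 : R) by apply/funext => x; rewrite /jumpfun big_nil.
  exact: inL2_cst.
have -> : jumpfun (c :: cs) = (fun x => if c.1 <= x then c.2 else 0) \+ jumpfun cs.
  by apply/funext => x; rewrite /jumpfun big_cons.
exact: inL2D.
Qed.

Definition normal_form c0 cs v x := c0 + jumpfun cs x + cprim v x.

Lemma inL2_normal_form c0 cs v : inL2 v -> inL2 (normal_form c0 cs v).
Proof.
move=> vL; apply: (@inL2D _ (fun x => c0 + jumpfun cs x)); last exact: inL2_cprim.
by apply: (@inL2D _ (cst c0)); [exact: inL2_cst|exact: inL2_jumpfun].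
Qed.

Lemma count_itv cs x y : x <= y ->
  count (fun c => c.1 <= y) cs =
    (count (fun c => (c.1 <= x)%R) cs + count (fun c => (x < c.1 <= y)%R) cs)%N.
Proof.
move=> xy; elim: cs => //= c cs ->; rewrite addnACA; congr (_ + _)%N.
by case: (leP c.1 x) => cx; rewrite ?(le_trans cx xy).
Qed.

Lemma bond_le_gam gam m n d : 0 <= gam -> bond gam m n d <= gam.
Proof.
move=> g0; rewrite /bond; case: eqP => // _; case: eqP => _; last by rewrite ge_min lexx orbT.
by case: (d != 0); rewrite ?mulr1 ?mulr0.
Qed.

Lemma bond_ge0 gam m n d : 0 <= gam -> 0 <= bond gam m n d.
Proof.
move=> g0; rewrite /bond; case: eqP => // _; case: eqP => _; first by rewrite mulr_ge0.
by rewrite le_min g0 andbT mulr_ge0 ?sqr_ge0// divr_ge0 ?sqr_ge0.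
Qed.

Lemma bond_le_sqr gam m n d : (m = 0 -> d = 0) -> bond gam m n d <= n%:R / m ^+ 2 * d ^+ 2.
Proof.
move=> md; have h : 0 <= n%:R / m ^+ 2 * d ^+ 2 by rewrite mulr_ge0 ?sqr_ge0// divr_ge0 ?sqr_ge0.
rewrite /bond; case: eqP => // _; case: eqP => [m0|_]; last by rewrite ge_min lexx.
by rewrite md// eqxx expr0n !mulr0.
Qed.

(** A cell that contains a jump is paid for by gamma; on any other cell the
Cauchy-Schwarz inequality bounds the bond by the share of the energy. Both
bounds are increments of a monotone function, and the sum telescopes. *)
Lemma bond_energy_sample gam m n c0 cs v : (0 < n)%N -> 0 <= gam -> inL2 v ->
  (m = 0 -> nsq v = 0) ->
  bond_energy gam m n (fun j => normal_form c0 cs v (cellpt R n j)) <=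
  gam * (size cs)%:R + nsq v / m ^+ 2.
Proof.
move=> n0 g0 vL mv; rewrite /bond_energy.
pose B (j : nat) := gam * (count (fun c => c.1 <= cellpt R n j) cs)%:R + energy v (cellpt R n j) / m ^+ 2.
have m2 : 0 <= (m ^+ 2)^-1 by rewrite invr_ge0 sqr_ge0.
have B1 j : (j < n)%N -> bond gam m n (normal_form c0 cs v (cellpt R n j.+1) -
    normal_form c0 cs v (cellpt R n j)) <= B j.+1 - B j.
  move=> jn; have x0 := cellpt_ge0 R n j; have xy := cellpt_lt R n0 (ltnSn j).
  have y1 := cellpt_le1 R n0 jn.
  have ed : 0 <= energy v (cellpt R n j.+1) - energy v (cellpt R n j).
    by rewrite subr_ge0; apply: energy_homo => //; exact: ltW.
  rewrite /B (count_itv cs (ltW xy)) natrD mulrDr.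
  set N := (count _ cs)%:R; set N' := count _ cs.
  set e1 := energy _ _ in ed *; set e0 := energy _ _ in ed *.
  have -> : gam * N + gam * N'%:R + e1 / m ^+ 2 - (gam * N + e0 / m ^+ 2) =
    gam * N'%:R + (e1 - e0) / m ^+ 2 by ring.
  have ee : 0 <= (e1 - e0) / m ^+ 2 by rewrite mulr_ge0.
  case: (posnP N') => [N0|Npos]; last first.
    apply: (le_trans (bond_le_gam _ _ _ g0)).
    by rewrite -[leLHS]addr0 lerD// -[leLHS]mulr1 ler_wpM2l// ler1n.
  have -> : normal_form c0 cs v (cellpt R n j.+1) - normal_form c0 cs v (cellpt R n j) =
      prim v (cellpt R n j.+1) - prim v (cellpt R n j).
    rewrite /normal_form !cprimE ?(ltW (le_lt_trans x0 xy)) ?x0 ?(ltW (lt_le_trans xy y1))//.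
    rewrite -(@jumpfun_cst _ cs (cellpt R n j) (cellpt R n j.+1)) ?ltW//; first by ring.
    move=> c cin cc; have /hasP : (has (fun c : R * R => cellpt R n j < c.1 <= cellpt R n j.+1) cs) = false.
      by rewrite has_count -/N' N0.
    by apply; exists c.
  rewrite N0 mulr0 add0r; apply: le_trans.
    apply: bond_le_sqr => m0; rewrite !(prim_nsq0 vL (mv m0)) ?subrr//.
      by rewrite x0 (ltW (lt_le_trans xy y1)).
    by rewrite y1 (ltW (le_lt_trans x0 xy)).
  rewrite mulrAC ler_wpM2r// -ler_pdivlMl ?ltr0n//.
  have := prim_cs vL x0 (ltW xy) y1; rewrite -/e1 -/e0.
  by rewrite {2}cellptS// [_ + n%:R^-1]addrC addrK.
apply: (le_trans (y := \sum_(j < n.-1) (B j.+1 - B j))).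
  by apply: ler_sum => j _; apply: B1; rewrite (leq_trans (ltn_ord j))// leq_pred.
rewrite -(big_mkord xpredT (fun j => B j.+1 - B j)) telescope_sumr// /B.
rewrite (le_trans (y := gam * (count (fun c => c.1 <= cellpt R n n.-1) cs)%:R +
  energy v (cellpt R n n.-1) / m ^+ 2))//.
  rewrite gerBl addr_ge0 ?mulr_ge0//.
  by have /andP[] := nsq_energy_ge0 vL (introT andP (conj (cellpt_ge0 R n 0) (cellpt_le1 R n0 (leq0n _)))).
apply: lerD; first by rewrite ler_wpM2l// ler_nat count_size.
rewrite ler_wpM2r//.
by have /andP[] := nsq_energy_ge0 vL (introT andP (conj (cellpt_ge0 R n n.-1) (cellpt_le1 R n0 (leq_pred _)))).
Qed.

Lemma Ffun_recovery g gam m t c0 cs v : Qset (gam, m, t) -> (forall c, c \in cs -> 0 < c.1 < 1) ->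
  inL2 v -> exists2 f : L2U R, ae01 (fun x => f x = normal_form c0 cs v (grid t x)) &
    (m = 0 -> nsq v = 0) -> (Ffun g (gam, m, t) f <= (gam * (size cs)%:R + nsq v / m ^+ 2 + nsq (f \- target g t))%:E)%E.
Proof.
move=> /Qset_cases[g0 m0 [->|[n n0 ->]]] cs01 vL.
- rewrite /grid /target eqxx; have [f fE] := L2U_of (inL2_normal_form c0 cs vL); exists f => // mv.
  apply: (@Ffun_continuous_le g gam m f c0 cs v) => //.
  by apply: ae01_imp fE => x xU ->; rewrite /normal_form cprimE.
- pose a j := normal_form c0 cs v (cellpt R n j).
  have [f fE] := L2U_of (inL2_stepf n a).
  exists f; first by apply: ae01_imp (ae01_and fE (ae01_stepf a n0)) => x _ /= [-> ->]; rewrite grid_inv.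
  move=> mv; rewrite target_inv// (Ffun_discrete g gam m n0 fE) (vec_fidelityE g n0 fE) lee_fin lerD2r.
  exact: bond_energy_sample.
Qed.

End bounds.

(** * Lower bounds for the functionals *)

Section lower.
Variable R : realType.
Implicit Types (h u v A k : R -> R) (a : nat -> R) (x y gam m t d e E : R) (f g : L2U R) (n : nat)
  (cs : seq (R * R)) (p : seq R).

Lemma rough_normal_form m E c0 cs v : inL2 v -> 0 <= E -> nsq v = m ^+ 2 * E ->
  rough m 0 E (jumps cs) (normal_form c0 cs v) (fun x => energy v (clamp x) / m ^+ 2).
Proof.
move=> vL E0 vE; have m2 : 0 <= (m ^+ 2)^-1 by rewrite invr_ge0 sqr_ge0.
have eh x y : x <= y -> energy v (clamp x) <= energy v (clamp y).
  move=> xy; have /andP[h1 h2] := clamp01 x; have /andP[h3 h4] := clamp01 y.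
  by apply: energy_homo => //; exact: clamp_homo.
split.
- by move=> x y xy; rewrite ler_wpM2r// eh.
- move=> x; have /andP[h1 h2] := nsq_energy_ge0 vL (clamp01 x).
  rewrite mulr_ge0//=; have [->|m0] := eqVneq m 0; first by rewrite expr0n invr0 mulr0.
  by rewrite ler_pdivrMr ?exprn_even_gt0//= mulrC -vE.
- move=> x y x0 xy y1 av; rewrite mulr0 addr0 /normal_form.
  rewrite -(@jumpfun_cst _ cs x y (ltW xy)); last first.
    move=> c cin /andP[c1 c2]; apply: (av c.1); first exact: mem_jumps.
    by rewrite (ltW c1).
  rewrite (_ : _ - _ = cprim v y - cprim v x); last by ring.
  have [m0|m0] := eqVneq m 0.
    have v0 : nsq v = 0 by rewrite vE m0 expr0n mul0r.
    by rewrite /cprim !prim_nsq0 ?clamp01// subrr m0 !expr0n/= !mul0r.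
  apply: (le_trans (cprim_cs vL (ltW xy))).
  rewrite -mulrBl [m ^+ 2 * _]mulrC -mulrA [m ^+ 2 * _]mulrC divfK ?expf_neq0//.
Qed.

Section disc.
Variables (gam m : R) (n : nat) (a : nat -> R).
Hypotheses (n0 : (0 < n)%N) (g0 : 0 < gam).

(** Bonds at which the minimum defining [bond] is gamma. *)
Definition broken (j : nat) :=
  if m == 0 then a j.+1 - a j != 0 else gam < n%:R / m ^+ 2 * (a j.+1 - a j) ^+ 2.

Definition tension (j : nat) := if broken j then 0 else n%:R / m ^+ 2 * (a j.+1 - a j) ^+ 2.

Definition broken_pts := [seq cellpt R n j.+1 | j <- index_iota 0 n.-1 & broken j].

Definition tension_sum (x : R) := \sum_(j < minn (cell n x) n.-1) tension j.

Lemma tension_ge0 j : 0 <= tension j.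
Proof.
by rewrite /tension; case: ifP => // _; rewrite mulr_ge0 ?sqr_ge0// divr_ge0 ?sqr_ge0.
Qed.

Lemma bond_energy_split :
  gam * (size broken_pts)%:R + \sum_(j < n.-1) tension j = bond_energy gam m n a.
Proof.
rewrite size_map size_filter -sum1_count natr_sum big_mkcond /= mulr_sumr big_mkord -big_split.
apply: eq_bigr => j _ /=; rewrite /bond /tension /broken (gt_eqF g0).
case: eqVneq => [->|m0].
  by case: eqVneq => [->|_]; rewrite ?expr0n ?mulr0 ?addr0.
by case: ltP => h; rewrite ?mulr0 ?mulr1 ?addr0 ?add0r.
Qed.

Lemma tension_le i j : (i <= j)%N -> \sum_(l < i) tension l <= \sum_(l < j) tension l.
Proof.
apply: (@homo_leq R (fun i : nat => \sum_(l < i) tension l) (fun x y => x <= y)) => //.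
- by move=> b c d; exact: le_trans.
- by move=> l; rewrite big_ord_recr /= lerDl tension_ge0.
Qed.

Lemma tension_sum_homo : {homo tension_sum : x y / x <= y}.
Proof.
move=> x y xy; rewrite /tension_sum.
have le : (minn (cell n x) n.-1 <= minn (cell n y) n.-1)%N.
  have : (cell n x <= cell n y)%N by apply: le_truncn; rewrite ler_wpM2l.
  by move=> h; rewrite leq_min geq_minr andbT (leq_trans (geq_minl _ _)).
exact: tension_le.
Qed.

(** Cauchy-Schwarz along a chain of unbroken bonds. *)
Lemma chain_bound i j : (i <= j)%N -> (forall l, (i <= l)%N -> (l < j)%N -> ~~ broken l) ->
  (a j - a i) ^+ 2 <= (m ^+ 2 * ((j%:R - i%:R) / n%:R)) *
     (\sum_(l < j) tension l - \sum_(l < i) tension l).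
Proof.
elim: j => [|j IH].
  by rewrite leqn0 => /eqP -> _; rewrite !subrr expr0n mulr0.
rewrite leq_eqVlt => /orP[/eqP -> _|]; first by rewrite !subrr expr0n mulr0.
rewrite ltnS => ij nb; have {}IH := IH ij (fun l il lj => nb l il (ltnW lj)).
have nbj : ~~ broken j by apply: nb.
have sge : 0 <= \sum_(l < j) tension l - \sum_(l < i) tension l.
  by rewrite subr_ge0 tension_le.
rewrite (_ : a j.+1 - a i = (a j.+1 - a j) + (a j - a i)); last by ring.
rewrite (_ : _ * (_ / _) = m ^+ 2 / n%:R + m ^+ 2 * ((j%:R - i%:R) / n%:R)); last first.
  by rewrite -natr1; ring.
have -> : \sum_(l < j.+1) tension l - \sum_(l < i) tension l =
    tension j + (\sum_(l < j) tension l - \sum_(l < i) tension l).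
  by rewrite big_ord_recr /= [_ + tension j]addrC -addrA.
apply: sqr_sum_le => //.
- by rewrite divr_ge0 ?sqr_ge0.
- exact: tension_ge0.
- by rewrite mulr_ge0 ?sqr_ge0// divr_ge0// subr_ge0 ler_nat.
- rewrite /tension (negPf nbj); move: nbj; rewrite /broken; case: eqVneq => [->|m1].
    by rewrite negbK => /eqP ->; rewrite !expr0n !mul0r.
  move=> _; rewrite mulrA [_ / n%:R]mulrC mulrA.
  rewrite (_ : n%:R^-1 * m ^+ 2 * _ = 1) ?mul1r//.
  rewrite -mulrA [m ^+ 2 * _]mulrCA divff ?expf_neq0// mulr1 mulVf// pnatr_eq0.
  by rewrite -lt0n.
Qed.

Lemma rough_discrete : rough m n%:R^-1 (\sum_(j < n.-1) tension j) broken_pts (stepf n a) tension_sum.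
Proof.
split; first exact: tension_sum_homo.
- move=> x; rewrite sumr_ge0 => [/=|j _]; last exact: tension_ge0.
  by apply: tension_le; exact: geq_minr.
- move=> x y x0 xy y1 av.
  have y0 := lt_trans x0 xy; have x1 := lt_trans xy y1.
  have xi := cell_itv n0 (ltW x0); have yj := cell_itv n0 (ltW y0).
  have iN := cell_lt n0 (ltW x0) x1; have jN := cell_lt n0 (ltW y0) y1.
  rewrite !stepfE ?(ltW x0) ?(ltW y0)// /tension_sum.
  have [-> ->] : minn (cell n x) n.-1 = cell n x /\ minn (cell n y) n.-1 = cell n y.
    by split; apply/minn_idPl; rewrite -ltnS prednK.
  have ij : (cell n x <= cell n y)%N by apply: le_truncn; rewrite ler_wpM2l// ltW.
  have nb l : (cell n x <= l)%N -> (l < cell n y)%N -> ~~ broken l.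
    move=> il lj; apply/negP => bl; apply: (av (cellpt R n l.+1)).
      apply/mapP; exists l => //; rewrite mem_filter bl mem_index_iota /=.
      by rewrite (leq_trans lj)// -ltnS prednK.
    case/andP: xi => _ /ltW xi; case/andP: yj => yj _.
    by rewrite (le_trans xi) ?cellpt_le//= (le_trans _ yj)// cellpt_le.
  apply: (le_trans (chain_bound ij nb)); rewrite ler_wpM2r//.
    by rewrite subr_ge0 tension_le.
  rewrite ler_wpM2l ?sqr_ge0// mulrBl -/(cellpt R n (cell n y)) -/(cellpt R n (cell n x)).
  case/andP: xi => _; rewrite cellptS// => xi; case/andP: yj => yj _.
  by have n1 : 0 <= (n%:R^-1 : R) by []; lra.
Qed.

End disc.

Lemma Ffun_lower g gam m t f (c : R) : 0 < gam -> Qset (gam, m, t) -> (Ffun g (gam, m, t) f <= c%:E)%E ->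
  exists h A p E, [/\ rough m t E p h A, inL2 h, ae01 (fun x => f x = h x),
    forall z, z \in p -> 0 < z < 1 &
    gam * (size p)%:R + E + nsq (f \- target g t) <= c].
Proof.
move=> g0 /Qset_cases[_ m0 [->|[n n0 ->]]] Fc.
- have Foo : (Ffun g (gam, m, 0%R) f < +oo)%E by rewrite (le_lt_trans Fc) ?ltry.
  have [c0 [cs [v [e [nj vL fE [e0 vE] FE]]]]] := Ffun_continuous_normal g0 Foo.
  exists (normal_form c0 cs v), (fun x => energy v (clamp x) / m ^+ 2), (jumps cs), e; split.
  + exact: rough_normal_form.
  + exact: inL2_normal_form.
  + by apply: ae01_imp fE => x xU ->; rewrite /normal_form cprimE.
  + by case: nj => h _ _ z; exact: jumps_itv.
  + by move: Fc; rewrite FE lee_fin /target eqxx size_map.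
- have [fc|fc] := pselect (of_class (@stepU_n R n) f); last first.
    by move: Fc; rewrite Ffun_discrete_out.
  have [a fE] := of_class_stepf n0 fc.
  move: Fc; rewrite (Ffun_discrete g gam m n0 fE) lee_fin => Fc.
  exists (stepf n a), (tension_sum gam m n a), (broken_pts gam m n a),
    (\sum_(j < n.-1) tension gam m n a j); split=> //.
  + exact: rough_discrete.
  + exact: inL2_stepf.
  + move=> z /mapP[j]; rewrite mem_filter mem_index_iota => /andP[_ /= jn ->].
    rewrite (le_lt_trans (cellpt_ge0 R n 0)) ?cellpt_lt//= -(cellpt_nn R n0) cellpt_lt//.
    by rewrite -ltn_predRL.
  + rewrite bond_energy_split// target_inv//.
    by rewrite -(vec_fidelityE g n0 fE).
Qed.

End lower.

(** * Recovery of a competitor as the mesh vanishes *)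

Section converging.
Variable R : realType.
Implicit Types (h u v A k : R -> R) (x y d e E : R) (f g : L2U R) (n : nat)
  (cs : seq (R * R)) (p : seq R).

Local Notation mu := (@lebesgue_measure R).

Lemma nsq_dominated (u_ : nat -> R -> R) u (M : R) : (forall s, inL2 (u_ s)) -> inL2 u ->
  ae01 (fun x => u_ s x @[s --> \oo] --> u x) ->
  (forall s, ae01 (fun x => `|u_ s x - u x| <= M)) ->
  nsq (u_ s \- u) @[s --> \oo] --> 0.
Proof.
move=> uL vL cu bu; have dL s := inL2B (uL s) vL.
pose f_ (s : nat) x := ((u_ s x - u x) ^+ 2)%:E.
have mf_ s : measurable_fun (U01 : set R) (f_ s) by apply: measurable_sqrU; exact: (dL s).1.
have mf : measurable_fun (U01 : set R) (cst 0%E : R -> \bar R) by exact: measurable_cst.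
have cf : \forall x \ae mu, U01 x -> f_ s x @[s --> \oo] --> (cst 0%E : R -> \bar R) x.
  apply: ae01_imp cu => x _ h; apply: cvg_EFin; first exact: nearW.
  have h0 : u_ s x - u x @[s --> \oo] --> 0 by rewrite -(subrr (u x)); apply: cvgB => //; exact: cvg_cst.
  by rewrite -[X in _ --> X](expr0n R 2); exact: cvg_sqr.
have bf : \forall x \ae mu, forall s, U01 x -> (`|f_ s x| <= (cst (M ^+ 2)%:E : R -> \bar R) x)%E.
  have := ae01_all bu; case=> N [mN N0 sN]; exists N; split=> // x /= hx; apply: sN => /= h'.
  apply: hx => s xU; have {}h' := h' xU s.
  by rewrite /f_ /= lee_fin normrX lerXn2r ?nnegrE ?(le_trans _ h').
have iM : mu.-integrable U01 (cst (M ^+ 2)%:E : R -> \bar R) by exact: (integ01_cst (M ^+ 2)).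
have [_ _] := @dominated_convergence _ _ R mu U01 (measurable_itv _) f_ (cst 0%E) _ mf_ mf cf iM bf.
rewrite integral0 => cv.
have -> : (fun s => nsq (u_ s \- u)) = fine \o (fun s => (\int[mu]_(x in U01) f_ s x)%E) by [].
exact: (@fine_cvg _ _ _ _ _ 0 cv).
Qed.

Lemma jumpfun_bound cs x : `|jumpfun cs x| <= \sum_(c <- cs) `|c.2|.
Proof.
apply: (le_trans (ler_norm_sum _ _ _)); apply: ler_sum => c _.
by case: ifP => // _; rewrite normr0.
Qed.

Lemma normal_form_bound c0 cs v x : inL2 v ->
  `|normal_form c0 cs v x| <= `|c0| + \sum_(c <- cs) `|c.2| + (nsq v + 1).
Proof.
move=> vL; rewrite /normal_form (le_trans (ler_normD _ _))// lerD ?cprim_bound//.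
by rewrite (le_trans (ler_normD _ _))// lerD2l jumpfun_bound.
Qed.

Lemma normal_form_continuous c0 cs v x : inL2 v -> x \notin jumps cs ->
  {for x, continuous (normal_form c0 cs v)}.
Proof.
move=> vL xn; apply: cvgD; last exact: cprim_continuous.
by apply: cvgD; [exact: cvg_cst|apply: cvg_near_cst; exact: jumpfun_near].
Qed.

Section meshes.
Variable t_ : nat -> R.
Hypothesis tT : forall s, t_ s = 0 \/ exists2 n, (0 < n)%N & t_ s = n%:R^-1.
Hypothesis t0 : t_ s @[s --> \oo] --> 0.

Lemma mesh_ge0 s : 0 <= t_ s.
Proof. by case: (tT s) => [->|[n _ ->]]. Qed.

(** A mesh tending to 0 takes the value 0 and values 1/n with n larger and
larger. *)
Lemma mesh_cvg (phi : nat -> R) (l : R) : phi n @[n --> \oo] --> l ->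
  (if t_ s == 0 then l else phi (Num.truncn (t_ s)^-1)) @[s --> \oo] --> l.
Proof.
move=> cphi; apply/cvgrPdist_lt => e e0.
have /cvgrPdist_lt/(_ _ e0)[N _ hN] := cphi.
have N1 : 0 < N.+1%:R^-1 :> R by rewrite invr_gt0.
have /cvgrPdist_lt/(_ _ N1)[M _ hM] := t0.
exists M => // s /= Ms; have := hM s Ms; rewrite sub0r normrN ger0_norm ?mesh_ge0//.
case: eqVneq => [_ _|]; first by rewrite subrr normr0.
case: (tT s) => [->|[n n0 ->] _]; first by rewrite eqxx.
rewrite ltf_pV2 ?posrE ?ltr0n// ltr_nat => Nn; rewrite invrK Num.Theory.natrK.
by apply: hN; exact: ltnW (ltnW Nn).
Qed.

Lemma target_cvg_ae g : ae01 (fun x => target g (t_ s) x @[s --> \oo] --> g x).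
Proof.
have gL := inL2_L2U g; have := lebesgue_diff gL.1 (inL2_integ01 gL).
move=> /(ae01_and (ae01_oo (fun x => id))); apply: ae01_imp => x _ /= [x01 cx].
have : avg g n x @[n --> \oo] --> g x.
  apply: cvg_trans cx; apply: near_eq_cvg; exists 1%N => // n /= n0.
  by rewrite /avg stepfE//; case/andP: x01 => /ltW -> ->.
move=> /mesh_cvg; apply: cvg_trans; apply: near_eq_cvg; apply: nearW => s.
by rewrite /target; case: ifP.
Qed.

Lemma target_cvg g : nsq (target g (t_ s) \- g) @[s --> \oo] --> 0.
Proof.
have gL := inL2_L2U g.
have : nsq (avg g n \- g) @[n --> \oo] --> 0 by rewrite -cvg_shiftS /=; exact: avg_cvg.
move=> /mesh_cvg; apply: cvg_trans; apply: near_eq_cvg; apply: nearW => s.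
rewrite /target; case: ifP => // _.
rewrite (@nsq_ae _ (g \- g) (cst 0)) ?nsq_cst ?expr0n//; first exact: inL2B.
  exact: inL2_cst.
by apply: ae01W => x _; rewrite /= subrr.
Qed.

Lemma nsq_target_le g s : nsq (target g (t_ s)) <= nsq g.
Proof.
case: (tT s) => [->|[n n0 ->]]; first by rewrite /target eqxx.
by rewrite target_inv//; apply: nsq_avg_le => //; exact: inL2_L2U.
Qed.

Lemma grid_near x s : 0 <= x -> `|grid (t_ s) x - x| <= t_ s.
Proof.
move=> x0; case: (tT s) => [->|[n n0 ->]].
  by rewrite /grid eqxx subrr normr0.
rewrite grid_inv//.
have /andP[h1 h2] := cell_itv n0 x0; rewrite cellptS// in h2.
by rewrite distrC ger0_norm ?subr_ge0// lerBlDr addrC ltW.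
Qed.

Lemma grid_cvg x : 0 <= x -> grid (t_ s) x @[s --> \oo] --> x.
Proof.
move=> x0; apply/cvgrPdist_lt => e e0; have /cvgrPdist_lt/(_ _ e0) := t0.
apply: filterS => s; rewrite sub0r normrN ger0_norm ?mesh_ge0// => h.
by rewrite distrC (le_lt_trans (grid_near s x0)).
Qed.

(** The points of the grid tend to x and the function is continuous off its
jumps, so dominated convergence applies. *)
Lemma sample_cvg (K : nat -> L2U R) c0 cs v : inL2 v ->
  (forall s, ae01 (fun x => K s x = normal_form c0 cs v (grid (t_ s) x))) ->
  nsq (K s \- normal_form c0 cs v) @[s --> \oo] --> 0.
Proof.
move=> vL KE; have kL := inL2_normal_form c0 cs vL.
apply: (@nsq_dominated _ _ ((`|c0| + \sum_(c <- cs) `|c.2| + (nsq v + 1)) *+ 2)) => //.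
- by move=> s; exact: inL2_L2U.
- apply: ae01_imp (ae01_and (ae01_seq (jumps cs)) (ae01_all KE)) => x /=.
  rewrite in_itv/= => /andP[x0 _] [xn Kx].
  have -> : (fun s => K s x) = (fun s => normal_form c0 cs v (grid (t_ s) x)).
    by apply/funext => s; rewrite Kx.
  apply: continuous_cvg; last exact: grid_cvg.
  exact: normal_form_continuous.
- move=> s; apply: ae01_imp (KE s) => x _ ->.
  by rewrite (le_trans (ler_normB _ _))// mulr2n lerD ?normal_form_bound.
Qed.

Lemma nsq_near_le (u_ : nat -> R -> R) u (e : R) : (forall s, inL2 (u_ s)) -> inL2 u ->
  nsq (u_ s \- u) @[s --> \oo] --> 0 -> 0 < e -> \forall s \near \oo, nsq (u_ s) <= nsq u + e.
Proof.
move=> uL vL cu e0; have [d d0 hd] := nsq_perturb (nsq_ge0 u) e0.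
have /cvgrPdist_lt/(_ _ d0) := cu; apply: filterS => s.
rewrite sub0r normrN ger0_norm ?nsq_ge0// => /ltW h.
have -> : u_ s = u \+ (u_ s \- u) by apply/funext => x /=; rewrite addrC subrK.
by apply: hd => //; exact: inL2B.
Qed.

Variables (gam_ m_ : nat -> R) (gam m : R).
Hypothesis Q : forall s, Qset (gam_ s, m_ s, t_ s).
Hypothesis gam_cvg : gam_ s @[s --> \oo] --> gam.
Hypothesis m_cvg : m_ s @[s --> \oo] --> m.

Lemma recovery g c0 cs v (e : R) : (forall c, c \in cs -> 0 < c.1 < 1) -> inL2 v ->
  (m = 0 -> nsq v = 0) -> 0 < e ->
  \forall s \near \oo, exists K, (Ffun g (gam_ s, m_ s, t_ s) K <=
    (gam * (size cs)%:R + nsq v / m ^+ 2 + nsq (normal_form c0 cs v \- g) + e)%:E)%E.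
Proof.
move=> cs01 vL mv e0; have gL := inL2_L2U g; have kL := inL2_normal_form c0 cs vL.
have /choice[K HK] : forall s, exists K : L2U R, ae01 (fun x => K x = normal_form c0 cs v (grid (t_ s) x)) /\
    ((m_ s = 0 -> nsq v = 0) -> (Ffun g (gam_ s, m_ s, t_ s) K <=
      (gam_ s * (size cs)%:R + nsq v / (m_ s) ^+ 2 + nsq (K \- target g (t_ s)))%:E)%E).
  by move=> s; have [K h1 h2] := Ffun_recovery g c0 (Q s) cs01 vL; exists K.
have Kk := sample_cvg vL (fun s => (HK s).1).
have tg := target_cvg g.
have d3 : 0 < e / 3 by rewrite divr_gt0.
have c1 : gam_ s * (size cs)%:R @[s --> \oo] --> gam * (size cs)%:R.
  by apply: cvgM => //; exact: cvg_cst.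
have c2 : nsq v / (m_ s) ^+ 2 @[s --> \oo] --> nsq v / m ^+ 2.
  have [m0|m0] := eqVneq m 0.
    rewrite mv// mul0r; apply: cvg_near_cst; apply: nearW => s; rewrite mul0r//.
  apply: cvgM; first exact: cvg_cst.
  by apply: cvgV; [rewrite expf_neq0|exact: cvg_sqr].
have c3 : nsq ((K s \- target g (t_ s)) \- (normal_form c0 cs v \- g)) @[s --> \oo] --> 0.
  apply: (@squeeze_cvgr _ _ _ _ (fun=> 0) (fun s => 2 * nsq (K s \- normal_form c0 cs v) + 2 * nsq (target g (t_ s) \- g))).
  - apply: nearW => s; rewrite nsq_ge0 /=.
    have l1 := inL2B (inL2_L2U (K s)) kL; have l2 := inL2B (inL2_target g (t_ s)) gL.
    have l2' := inL2Z (-1) l2.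
    have := nsqD_le2 l1 l2'; rewrite (nsqZ _ l2) sqrrN expr1n mul1r.
    apply: le_trans; rewrite le_eqVlt; apply/orP; left; apply/eqP; congr nsq.
    by apply/funext => x /=; ring.
  - exact: cvg_cst.
  - rewrite -[X in _ --> X](addr0 (0 : R)) -{1}(mulr0 (2 : R)) -{2}(mulr0 (2 : R)).
    by apply: cvgD; apply: cvgM => //; exact: cvg_cst.
have c4 := nsq_near_le (fun s => inL2B (inL2_L2U (K s)) (inL2_target g (t_ s))) (inL2B kL gL) c3 d3.
have c5 : \forall s \near \oo, m_ s = 0 -> nsq v = 0.
  have [m0|m0] := eqVneq m 0; first by apply: nearW => s _; exact: mv.
  have e1 : 0 < `|m| by rewrite normr_gt0.
  have /cvgrPdist_lt/(_ _ e1) := m_cvg; apply: filterS => s h ms0.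
  by move: h; rewrite ms0 subr0 ltxx.
have /cvgrPdist_lt/(_ _ d3) c1' := c1; have /cvgrPdist_lt/(_ _ d3) c2' := c2.
near=> s; exists (K s).
have h5 : m_ s = 0 -> nsq v = 0 by near: s.
apply: (le_trans ((HK s).2 h5)); rewrite lee_fin.
have h1 : `|gam * (size cs)%:R - gam_ s * (size cs)%:R| < e / 3 by near: s.
have h2 : `|nsq v / m ^+ 2 - nsq v / (m_ s) ^+ 2| < e / 3 by near: s.
have h4 : nsq (K s \- target g (t_ s)) <= nsq (normal_form c0 cs v \- g) + e / 3 by near: s.
move: h1 h2; rewrite !ltr_distlC => /andP[_ h1] /andP[_ h2].
apply: (le_trans (lerD (lerD (ltW h1) (ltW h2)) h4)).
have key (a b c : R) : a + e / 3 + (b + e / 3) + (c + e / 3) <= a + b + c + e by lra.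
exact: key.
Unshelve. all: by end_near. Qed.

End meshes.

End converging.

(** * Compactness under a cost bound *)

Section compactness.
Variable R : realType.
Implicit Types (h u v A : R -> R) (x y d e E : R) (n : nat) (cs : seq (R * R)) (p : seq R).

(** Otherwise h^2 would have too large an integral over ]a, b]. *)
Lemma small_value h (C a b : R) : inL2 h -> nsq h <= C -> 0 <= a -> a < b -> b <= 1 ->
  exists2 y, a < y <= b & h y ^+ 2 <= C / (b - a) + 1.
Proof.
move=> hL hC a0 ab b1; apply: contrapT => H.
have ba : 0 < b - a by rewrite subr_gt0.
have ih := inL2_sqr hL.
have e1 : energy h b - energy h a <= C.
  apply: le_trans hC; rewrite -(energy1 hL).
  have h1 : energy h b <= energy h 1 by apply: energy_homo => //; rewrite (le_trans a0)// ltW.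
  have h2 : 0 <= energy h a.
    have : energy h 0 <= energy h a by apply: energy_homo => //; rewrite (le_trans _ b1)// ltW.
    by rewrite /energy prim0.
  by rewrite lerBlDr (le_trans h1)// lerDl.
have : C < energy h b - energy h a.
  rewrite /energy primB ?(ltW ab)//.
  apply: (lt_le_trans (y := \int[@lebesgue_measure R]_(x in `]a, b]) (cst (C / (b - a) + 1) x))).
    rewrite Rintegral_cst//= lebesgue_itv_oc ?(ltW ab)//= mulrDl mul1r divfK ?gt_eqF//.
    by rewrite ltrDl.
  apply: le_Rintegral => //.
  - by apply: integ01_itv => //; exact: integ01_cst.
  - by apply: integ01_itv => //.
  - move=> x /=; rewrite in_itv/= => xab; rewrite leNgt; apply/negP => hx; apply: H.
    by exists x => //; exact: ltW.
by move/(lt_le_trans)/(_ e1); rewrite ltxx.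
Qed.

Lemma filter_forall_lt (F : set_system nat) {FF : Filter F} (N : nat) (P : nat -> set nat) :
  (forall i, (i < N)%N -> F (P i)) -> F [set s | forall i, (i < N)%N -> P i s].
Proof.
elim: N => [|N IH] H; first exact: filterE.
have H1 := IH (fun i iN => H i (ltnW iN)); have H2 := H N (ltnSn N).
apply: filterS2 H1 H2 => s h1 h2 i; rewrite ltnS leq_eqVlt => /orP[/eqP ->//|]; exact: h1.
Qed.

Lemma avoids_eventually (F : set_system nat) {FF : Filter F} (p_ : nat -> seq R) p x y :
  (forall i, (i < size p)%N -> nth 0 (p_ s) i @[s --> F] --> nth 0 p i) ->
  F [set s | size (p_ s) = size p] -> avoids p x y -> F [set s | avoids (p_ s) x y].
Proof.
move=> cp sp av.
have H i : (i < size p)%N -> F [set s | ~ (x <= nth 0 (p_ s) i <= y)].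
  move=> ip; have ni := av _ (mem_nth 0 ip); have cv := cp i ip.
  have [xi|xi] := leP x (nth 0 p i); last first.
    by have /cvgr_lt/(_ _ xi) := cv; apply: filterS => s h /andP[h' _]; move: h; rewrite /= ltNge h'.
  have [iy|iy] := leP (nth 0 p i) y; first by exfalso; apply: ni; rewrite xi.
  by have /cvgr_gt/(_ _ iy) := cv; apply: filterS => s h /andP[_ h']; move: h; rewrite /= ltNge h'.
apply: filterS (filterI (filter_forall_lt H) sp) => s /= [h1 h2] z /(nthP 0)[i ip <-].
by apply: h1; rewrite -h2.
Qed.

Lemma cvg_by_inv (u : nat -> R) (l : R) : (forall j, `|u j - l| < j.+1%:R^-1) -> u j @[j --> \oo] --> l.
Proof.
move=> H; apply/cvgrPdist_lt => e e0; have := near_infty_natSinv_lt (PosNum e0).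
by apply: filterS => j /= hj; rewrite distrC (lt_trans (H j)).
Qed.

Lemma dense_seq : exists d : nat -> R, forall a b, a < b -> exists i, a < d i < b.
Proof.
exists (fun i => ratr (odflt 0 (unpickle i : option rat))) => a b ab.
have [q] := rat_in_itvoo ab; rewrite in_itv/= => qab.
by exists (pickle q); rewrite pickleK.
Qed.

Variables (t_ m_ E_ : nat -> R) (m C C' : R) (M : nat).
Variables (h_ A_ : nat -> R -> R) (p_ : nat -> seq R).
Hypothesis t_ge0 : forall s, 0 <= t_ s.
Hypothesis t_cvg : t_ s @[s --> \oo] --> 0.
Hypothesis m_cvg : m_ s @[s --> \oo] --> m.
Hypothesis Hrough : forall s, rough (m_ s) (t_ s) (E_ s) (p_ s) (h_ s) (A_ s).
Hypothesis E_le : forall s, E_ s <= C.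
Hypothesis p_le : forall s, (size (p_ s) <= M)%N.
Hypothesis p01 : forall s z, z \in p_ s -> 0 < z < 1.
Hypothesis hL : forall s, inL2 (h_ s).
Hypothesis h_le : forall s, nsq (h_ s) <= C'.

Lemma A_bound s x : 0 <= A_ s x <= C.
Proof. by have [_ /(_ x)/andP[-> h] _] := Hrough s; rewrite (le_trans h). Qed.

Lemma C_ge0 : 0 <= C.
Proof. by have /andP[h1 h2] := A_bound 0 0; exact: le_trans h2. Qed.

Lemma E_bound s : 0 <= E_ s <= C.
Proof. by have [_ /(_ 0)/andP[h h'] _] := Hrough s; rewrite E_le (le_trans h). Qed.

Lemma m_bound : \forall s \near \oo, m_ s ^+ 2 <= m ^+ 2 + 1.
Proof.
have c : m_ s ^+ 2 @[s --> \oo] --> m ^+ 2 by exact: cvg_sqr.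
by have /cvgr_le := c; apply; rewrite ltrDl.
Qed.

Lemma m_sqr_cvg (F : set_system nat) {FF : Filter F} : \oo `<=` F -> m_ s ^+ 2 @[s --> F] --> m ^+ 2.
Proof.
move=> ooF; by apply: cvg_sqr => B /m_cvg; exact: ooF.
Qed.

Lemma osc_bound s x y : 0 < x -> x < y -> y < 1 -> avoids (p_ s) x y -> m_ s ^+ 2 <= m ^+ 2 + 1 ->
  (h_ s y - h_ s x) ^+ 2 <= (m ^+ 2 + 1) * (y - x + 2 * t_ s) * C.
Proof.
move=> x0 xy y1 av mb; have [hom Ab hb] := Hrough s.
have a0 : 0 <= y - x + 2 * t_ s by rewrite addr_ge0 ?subr_ge0 ?(ltW xy)// mulr_ge0.
apply: (le_trans (hb x y x0 xy y1 av)); apply: ler_pM.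
- by rewrite mulr_ge0 ?sqr_ge0.
- by rewrite subr_ge0 hom// ltW.
- by rewrite ler_wpM2r.
- by have /andP[h1 _] := A_bound s x; have /andP[_ h2] := A_bound s y; rewrite lerBlDr (le_trans h2)// lerDl.
Qed.

Section ultralimit.
Variable U : set_system nat.
Hypothesis UU : UltraFilter U.
Hypothesis Uoo : \oo `<=` U.

Lemma ultra_jumps : exists p, U [set s | size (p_ s) = size p] /\
  forall i, (i < size p)%N -> nth 0 (p_ s) i @[s --> U] --> nth 0 p i.
Proof.
have [N UN] : exists N, U [set s | size (p_ s) = N].
  by apply: (@ultra_nat U UU (fun s => size (p_ s)) M); apply: filterE.
pose p := mkseq (fun i => ulim U (fun s => nth 0 (p_ s) i)) N.
exists p; rewrite size_mkseq; split=> // i iN; rewrite nth_mkseq//.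
apply: (@ulimP R U UU _ 1); apply: filterS UN => s /= sN.
have : nth 0 (p_ s) i \in p_ s by rewrite mem_nth// sN.
by move=> /p01/andP[h1 h2]; rewrite ger0_norm ?ltW.
Qed.

Variable p : seq R.
Hypothesis sizep : U [set s | size (p_ s) = size p].
Hypothesis limp : forall i, (i < size p)%N -> nth 0 (p_ s) i @[s --> U] --> nth 0 p i.

(** The values h_s x are bounded: some nearby point has a value bounded by the
norm of h_s, and the oscillation in between is bounded by the cost. *)
Lemma ultra_value x : 0 < x < 1 -> x \notin p -> h_ s x @[s --> U] --> ulim U (fun s => h_ s x).
Proof.
move=> /andP[x0 x1] xn; have [d d0 hd] := avoids_near xn.
pose y0 := Num.max (x - d) (x / 2).
have y0x : y0 < x by rewrite gt_max gtrBl d0 ltr_pdivrMr// ltr_pMr// ltr1n.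
have y00 : 0 < y0 by rewrite lt_max [X in _ || X]divr_gt0 ?orbT.
have av : avoids p y0 x.
  move=> z zp /andP[h1 h2]; apply: (hd z zp); move: h1; rewrite ge_max => /andP[-> _].
  by rewrite (le_trans h2)// lerDl ltW.
pose B := C' / (x - y0) + 1.
pose D := (m ^+ 2 + 1) * (x - y0 + 2 * 1) * C.
apply: (@ulimP R U UU _ ((B + 1) + (D + 1))).
have t1 : \forall s \near \oo, t_ s <= 1 by have /cvgr_le := t_cvg; apply; exact: ltr01.
have ev : U [set s | avoids (p_ s) y0 x] by exact: (avoids_eventually limp sizep av).
apply: filterS (filterI ev (filterI (Uoo t1) (Uoo m_bound))) => s [/= avs [ts ms]].
have [y /andP[yy yx] hy] := small_value (hL s) (h_le s) (ltW y00) y0x (ltW x1).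
have B0 : 0 <= B by apply: le_trans hy; exact: sqr_ge0.
have D0 : 0 <= D.
  have xy0 : 0 <= x - y0 by rewrite subr_ge0 ltW.
  apply: mulr_ge0; last exact: C_ge0.
  by apply: mulr_ge0; rewrite addr_ge0 ?sqr_ge0 ?mulr1.
have n1 : `|h_ s y| <= B + 1.
  apply: sqr_le_norm; first by rewrite addr_ge0.
  by apply: (le_trans hy); rewrite -/B sqrrD expr1n; nra.
have n2 : `|h_ s x - h_ s y| <= D + 1.
  move: yx; rewrite le_eqVlt => /orP[/eqP ->|yx]; first by rewrite subrr normr0 addr_ge0.
  apply: sqr_le_norm; first by rewrite addr_ge0.
  have avy : avoids (p_ s) y x.
    by move=> z zp /andP[h1 h2]; apply: (avs z zp); rewrite h2 (le_trans (ltW yy)).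
  apply: (le_trans (osc_bound (lt_trans y00 yy) yx x1 avy ms)).
  apply: (le_trans (y := D)); last by rewrite sqrrD expr1n; nra.
  rewrite /D ler_wpM2r ?C_ge0// ler_wpM2l ?addr_ge0 ?sqr_ge0// lerD ?lerB ?(ltW yy)//.
  by rewrite ler_wpM2l.
rewrite /= -[h_ s x](subrK (h_ s y)) addrC (le_trans (ler_normD _ _))// lerD//.
Qed.

Definition ulim_A x := ulim U (fun s => A_ s x).

Definition ulim_h x := ulim U (fun s => h_ s x).

Lemma ulim_AP x : A_ s x @[s --> U] --> ulim_A x.
Proof.
apply: (@ulimP R U UU _ C); apply: filterE => s /=.
by have /andP[h1 h2] := A_bound s x; rewrite ger0_norm.
Qed.

Lemma ulim_EP : E_ s @[s --> U] --> ulim U E_.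
Proof.
apply: (@ulimP R U UU _ C); apply: filterE => s /=.
by have /andP[h1 h2] := E_bound s; rewrite ger0_norm.
Qed.

Lemma ulim_A_homo : {homo ulim_A : x y / x <= y}.
Proof.
move=> x y xy; apply: (ler_cvg_to (ulim_AP (x := x)) (ulim_AP (x := y))).
by apply: filterE => s; have [h _ _] := Hrough s; exact: h.
Qed.

Lemma ulim_A_bound x : 0 <= ulim_A x <= ulim U E_.
Proof.
apply/andP; split.
  apply: (cvgr_to_ge (ulim_AP (x := x))); apply: filterE => s.
  by have /andP[] := A_bound s x.
apply: (ler_cvg_to (ulim_AP (x := x)) ulim_EP); apply: filterE => s.
by have [_ /(_ x)/andP[] _] := Hrough s.
Qed.

Lemma ulim_ctrl x y : 0 < x -> x < y -> y < 1 -> avoids p x y ->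
  ctrl (m ^+ 2) ulim_h ulim_A x y.
Proof.
move=> x0 xy y1 av; rewrite /ctrl.
have xn : x \notin p by apply/negP => /av; apply; rewrite lexx ltW.
have yn : y \notin p by apply/negP => /av; apply; rewrite lexx ltW.
have cx := ultra_value (introT andP (conj x0 (lt_trans xy y1))) xn.
have cy := ultra_value (introT andP (conj (lt_trans x0 xy) y1)) yn.
have ct : t_ s @[s --> U] --> 0 by move=> B /t_cvg; exact: Uoo.
have c1 : (h_ s y - h_ s x) ^+ 2 @[s --> U] --> (ulim_h y - ulim_h x) ^+ 2.
  by apply: cvg_sqr; apply: cvgB.
have c2 : m_ s ^+ 2 * (y - x + 2 * t_ s) * (A_ s y - A_ s x) @[s --> U] -->
    m ^+ 2 * (y - x) * (ulim_A y - ulim_A x).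
  apply: cvgM; last by apply: cvgB; exact: ulim_AP.
  apply: cvgM; first exact: m_sqr_cvg.
  rewrite -[X in _ --> X]addr0 -(mulr0 2); apply: cvgD; first exact: cvg_cst.
  by apply: cvgM => //; exact: cvg_cst.
apply: (ler_cvg_to c1 c2).
apply: filterS (avoids_eventually limp sizep av) => s /= avs.
by have [_ _ h] := Hrough s; exact: h.
Qed.

End ultralimit.

Lemma sub_ge (sub : nat -> nat) j : {homo sub : i j / (i < j)%N} -> (j <= sub j)%N.
Proof. by move=> hs; elim: j => // j IH; apply: leq_ltn_trans IH _; exact: hs. Qed.

Lemma near_sub (sub : nat -> nat) (P : set nat) : {homo sub : i j / (i < j)%N} ->
  (\forall s \near \oo, P s) -> \forall j \near \oo, P (sub j).
Proof.
move=> hs [N _ hN]; exists N => // j /= Nj; apply: hN => /=.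
by apply: leq_trans Nj _; exact: sub_ge.
Qed.

(** The limits along an ultrafilter of the values, energies and jump points
satisfy the same estimate with t = 0, so they are described by
[jump_removal] and [ctrl_density]. The subsequence is chosen to converge at a
dense sequence of points off the limit jumps; the estimate makes it
equicontinuous there, which gives convergence at every point off these jumps. *)
Lemma rough_compact : exists (sub : nat -> nat) c0 cs v E p,
  [/\ {homo sub : i j / (i < j)%N}, forall c, c \in cs -> 0 < c.1 < 1 & inL2 v] /\
  [/\ nsq v <= m ^+ 2 * E, (size cs <= size p)%N, forall j, size (p_ (sub j)) = size p,
      E_ (sub j) @[j --> \oo] --> E &
      ae01 (fun x => h_ (sub j) x @[j --> \oo] --> normal_form c0 cs v x)].
Proof.
have [U [UU Uoo]] := ultraFilterLemma eventually_filter.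
have [p [szp limp]] := ultra_jumps UU.
pose h := ulim_h U; pose A := ulim_A U.
have Ahomo : {homo A : x y / x <= y} by exact: ulim_A_homo.
have m2 : 0 <= m ^+ 2 by exact: sqr_ge0.
have hctrl := @ulim_ctrl U UU Uoo p szp limp.
have [cs [F [scs cs01 hF cF]]] := @jump_removal R (m ^+ 2) h A p Ahomo m2 hctrl.
have [F' [F'F cF']] := ctrl_endpoints Ahomo m2 cF.
have [v [vL vE Fv]] := ctrl_density Ahomo m2 cF'.
have hk x : 0 < x < 1 -> x \notin p -> h x = normal_form (F' 0) cs v x.
  move=> x01 xn; have x01' : 0 <= x <= 1 by case/andP: x01 => /ltW -> /ltW ->.
  rewrite hF// /normal_form cprimE// -F'F// Fv//.
  by rewrite [F' 0 + _ in RHS]addrC addrA.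
have [d hd] := dense_seq.
pose P (k : nat) : set nat := [set s | size (p_ s) = size p] `&` [set s | `|E_ s - ulim U E_| < k.+1%:R^-1] `&`
  [set s | forall i, (i < size p)%N -> `|nth 0 (p_ s) i - nth 0 p i| < k.+1%:R^-1] `&`
  [set s | forall i, (i < k)%N -> 0 < d i < 1 -> d i \notin p -> `|h_ s (d i) - h (d i)| < k.+1%:R^-1].
have UP k : U (P k).
  have k0 : 0 < k.+1%:R^-1 :> R by rewrite invr_gt0.
  apply: filterI; [apply: filterI; [apply: filterI => //|]|].
  - have /cvgrPdist_lt/(_ _ k0) := @ulim_EP U UU; apply: filterS => s /=.
    by rewrite distrC.
  - apply: filter_forall_lt => i ip; have /cvgrPdist_lt/(_ _ k0) := limp i ip.
    by apply: filterS => s /=; rewrite distrC.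
  - apply: filter_forall_lt => i _.
    have [d01|d01] := pselect (0 < d i < 1 /\ d i \notin p); last first.
      by apply: filterE => s h1 h2; exfalso; apply: d01.
    have /cvgrPdist_lt/(_ _ k0) := @ultra_value U UU Uoo p szp limp _ d01.1 d01.2.
    by apply: filterS => s /= hs _ _; rewrite distrC.
have [sub [hsub Psub]] := ultra_extract UU Uoo UP.
exists sub, (F' 0), cs, v, (ulim U E_), p; split; first by [].
have pcv i : (i < size p)%N -> nth 0 (p_ (sub j)) i @[j --> \oo] --> nth 0 p i.
  by move=> ip; apply: cvg_by_inv => j; have [[[_ _] h3] _] := Psub j; exact: h3.
split=> //.
- apply: (le_trans vE); rewrite ler_wpM2l//.
  have /andP[_ a1] := @ulim_A_bound U UU 1; have /andP[a0 _] := @ulim_A_bound U UU 0.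
  by rewrite lerBlDr (le_trans a1)// lerDl.
- by move=> j; have [[[h1 _] _] _] := Psub j.
- by apply: cvg_by_inv => j; have [[[_ h2] _] _] := Psub j.
apply: ae01_imp (ae01_and (ae01_seq p) (ae01_oo (fun x => id))) => x _ /= [xn x01].
rewrite -hk//; have [x0 x1] := andP x01.
apply/cvgrPdist_le => e e0.
have e40 : 0 < e / 4 by rewrite divr_gt0.
have [dl dl0 hdl] := avoids_near xn.
pose K := (m ^+ 2 + 1) * C + 1.
have K0 : 0 < K by rewrite ltr_wpDl// mulr_ge0 ?C_ge0// addr_ge0.
pose r := (e / 4) ^+ 2 / (3 * K).
have r0 : 0 < r by rewrite divr_gt0 ?exprn_gt0// mulr_gt0.
have rK : 3 * r * K = (e / 4) ^+ 2 by rewrite mulrAC /r mulrC divfK// gt_eqF ?mulr_gt0.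
have [i /andP[xd]] : exists i, x < d i < Num.min (Num.min (x + dl) (x + r)) 1.
  by apply: hd; rewrite !lt_min x1 !ltrDl dl0 r0.
rewrite !lt_min => /andP[/andP[ddl dr] d1].
have av : avoids p x (d i).
  move=> z zp /andP[z1 z2]; apply: (hdl z zp).
  by rewrite (le_trans _ z1) ?gerBl ?ltW//= (le_lt_trans z2).
have d01 : 0 < d i < 1 by rewrite d1 (lt_trans x0 xd).
have dn : d i \notin p by apply/negP => /av; apply; rewrite lexx (ltW xd).
have dx : 0 <= d i - x <= r.
  by rewrite subr_ge0 (ltW xd) lerBlDr addrC ltW.
have b1 : `|h (d i) - h x| <= e / 4.
  apply: sqr_le_norm; first exact: ltW.
  apply: (le_trans (hctrl x (d i) x0 xd d1 av)).
  have AC : A (d i) - A x <= C.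
    have /andP[_ a1] := @ulim_A_bound U UU (d i); have /andP[a0 _] := @ulim_A_bound U UU x.
    have EC : ulim U E_ <= C by apply: (cvgr_to_le (@ulim_EP U UU)); apply: filterE => s.
    by rewrite lerBlDr (le_trans a1)// (le_trans EC)// lerDl.
  have A0 : 0 <= A (d i) - A x by rewrite subr_ge0 Ahomo// ltW.
  rewrite -rK /K; case/andP: dx => dx1 dx2; have C0 := C_ge0.
  apply: (le_trans (y := m ^+ 2 * r * C)).
    by apply: ler_pM => //; [exact: mulr_ge0|rewrite ler_wpM2l].
  have := mulr_ge0 (mulr_ge0 m2 (ltW r0)) C0; have := mulr_ge0 (ltW r0) C0; nra.
have t_r : \forall s \near \oo, t_ s <= r by have /cvgr_le := t_cvg; apply.
have sz : \forall j \near \oo, size (p_ (sub j)) = size p.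
  by apply: nearW => j; have [[[h1 _] _] _] := Psub j.
have avs : \forall j \near \oo, avoids (p_ (sub j)) x (d i) by exact: (avoids_eventually pcv sz).
near=> j.
have b2 : `|h_ (sub j) (d i) - h_ (sub j) x| <= e / 4.
  apply: sqr_le_norm; first exact: ltW.
  have ts : t_ (sub j) <= r by near: j; exact: (near_sub hsub t_r).
  have ms : m_ (sub j) ^+ 2 <= m ^+ 2 + 1 by near: j; exact: (near_sub hsub m_bound).
  have avj : avoids (p_ (sub j)) x (d i) by near: j.
  apply: (le_trans (osc_bound x0 xd d1 avj ms)); rewrite -rK /K mulrAC.
  have mC : 0 <= (m ^+ 2 + 1) * C by rewrite mulr_ge0 ?C_ge0// addr_ge0.
  case/andP: dx => dx1 dx2; have tg := t_ge0 (sub j).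
  rewrite mulrC; apply: ler_pM => //; last by rewrite lerDl.
  - by rewrite addr_ge0// mulr_ge0.
  - by lra.
have b3 : `|h_ (sub j) (d i) - h (d i)| < e / 4.
  have [_ h4] := Psub j.
  have ij : (i < j)%N by near: j; exists i.+1.
  apply: (lt_trans (h4 i ij d01 dn)).
  by near: j; exact: (near_infty_natSinv_lt (PosNum e40)).
rewrite (_ : _ - _ = (h_ (sub j) (d i) - h_ (sub j) x) - (h_ (sub j) (d i) - h (d i)) - (h (d i) - h x)); last by ring.
rewrite (le_trans (ler_normB _ _))//.
have := ler_normB (h_ (sub j) (d i) - h_ (sub j) x) (h_ (sub j) (d i) - h (d i)).
move: b1 b2 b3; lra.
Unshelve. all: by end_near. Qed.

End compactness.

(** * Almost minimizers as the mesh vanishes *)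

Section cases.
Variable R : realType.
Implicit Types (h u v A : R -> R) (x y d e E : R) (n : nat) (cs : seq (R * R)) (p : seq R) (f g : L2U R).

Lemma Ffun_finite g gam m t f : 0 < gam -> Qset (gam, m, t) -> (Ffun g (gam, m, t) f < +oo)%E ->
  exists c : R, Ffun g (gam, m, t) f = c%:E.
Proof.
move=> g0 /Qset_cases[_ m0 [->|[n n0 ->]]] Foo.
- have [c0 [cs [v [e [_ _ _ _ ->]]]]] := Ffun_continuous_normal g0 Foo.
  by eexists.
- have [fc|fc] := pselect (of_class (@stepU_n R n) f); last first.
    by move: Foo; rewrite Ffun_discrete_out// ltxx.
  have [a fE] := of_class_stepf n0 fc.
  by rewrite (Ffun_discrete g gam m n0 fE); eexists.
Qed.

Lemma bond_energy_ge0 gam m n (a : nat -> R) : 0 <= gam -> 0 <= bond_energy gam m n a.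
Proof. by move=> g0; apply: sumr_ge0 => k _; exact: bond_ge0. Qed.

(** The other terms of the cost are nonnegative. *)
Lemma fidelity_le_Ffun g gam m t f (c : R) : Qset (gam, m, t) -> (Ffun g (gam, m, t) f <= c%:E)%E ->
  nsq (f \- target g t) <= c.
Proof.
move=> Q Fc; have [g0 m0 tt] := Qset_cases Q.
move: (g0); rewrite le_eqVlt => /orP[/eqP ge|gp]; last first.
  have [h [A [p [E [[_ Ab _] _ _ _ hc]]]]] := Ffun_lower gp Q Fc.
  have /andP[E1 E2] := Ab 0; apply: le_trans hc; rewrite lerDr addr_ge0 ?mulr_ge0//.
  exact: le_trans E2.
case: tt => [t0|[n n0 tn]].
  by move: Fc; rewrite t0 -ge /Ffun eqxx sqdistE lee_fin /target eqxx.
rewrite tn in Fc *; have [fc|fc] := pselect (of_class (@stepU_n R n) f); last first.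
  by move: Fc; rewrite Ffun_discrete_out.
have [a fE] := of_class_stepf n0 fc.
move: Fc; rewrite (Ffun_discrete g gam m n0 fE) lee_fin (vec_fidelityE g n0 fE).
rewrite target_inv//.
by apply: le_trans; rewrite lerDr bond_energy_ge0.
Qed.

Lemma nsqB_le2 (u v w : R -> R) : inL2 u -> inL2 v -> inL2 w ->
  nsq (u \- w) <= 2 * nsq (u \- v) + 2 * nsq (v \- w).
Proof.
move=> uL vL wL; have -> : u \- w = (u \- v) \+ (v \- w).
  by apply/funext => x /=; rewrite addrA subrK.
exact: nsqD_le2 (inL2B uL vL) (inL2B vL wL).
Qed.

Lemma nsq_cvg_trans (u_ v_ : nat -> R -> R) (w : R -> R) :
  (forall s, inL2 (u_ s)) -> (forall s, inL2 (v_ s)) -> inL2 w ->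
  nsq (u_ s \- v_ s) @[s --> \oo] --> 0 -> nsq (v_ s \- w) @[s --> \oo] --> 0 ->
  nsq (u_ s \- w) @[s --> \oo] --> 0.
Proof.
move=> uL vL wL c1 c2.
apply: (@squeeze_cvgr _ _ _ _ (fun=> 0) (fun s => 2 * nsq (u_ s \- v_ s) + 2 * nsq (v_ s \- w))).
- by apply: nearW => s; rewrite nsq_ge0/= nsqB_le2.
- exact: cvg_cst.
- rewrite -[X in _ --> X](addr0 (0 : R)) -{1}(mulr0 (2 : R)) -{2}(mulr0 (2 : R)).
  by apply: cvgD; apply: cvgM => //; exact: cvg_cst.
Qed.

Lemma budget_le (a b w w' z a' x x' z' e : R) : a <= b -> w <= w' -> x <= x' ->
  z <= a' + x + z' - b - w' + e -> a + w + z <= a' + x' + z' + e.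
Proof. lra. Qed.

Section zero_mesh.
Variables (g : L2U R) (gam_ m_ t_ : nat -> R) (gam m : R).
Hypothesis Q : forall s, Qset (gam_ s, m_ s, t_ s).
Hypothesis gam_cvg : gam_ s @[s --> \oo] --> gam.
Hypothesis m_cvg : m_ s @[s --> \oo] --> m.
Hypothesis t_cvg : t_ s @[s --> \oo] --> 0.
Variables (f_ : nat -> L2U R) (eps : nat -> R).
Hypothesis eps_cvg : eps s @[s --> \oo] --> 0.
Hypothesis f_min : forall s K,
  (Ffun g (gam_ s, m_ s, t_ s) (f_ s) <= Ffun g (gam_ s, m_ s, t_ s) K + (eps s)%:E)%E.

Let tT s : t_ s = 0 \/ exists2 n, (0 < n)%N & t_ s = n%:R^-1.
Proof. by have [_ _] := Qset_cases (Q s). Qed.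

Lemma value_near_le (B e : R) : 0 < e ->
  (forall d, 0 < d -> \forall s \near \oo, exists K, (Ffun g (gam_ s, m_ s, t_ s) K <= (B + d)%:E)%E) ->
  \forall s \near \oo, (Ffun g (gam_ s, m_ s, t_ s) (f_ s) <= (B + e)%:E)%E.
Proof.
move=> e0 H; have e20 : 0 < e / 2 by rewrite divr_gt0.
have H1 := H _ e20; have /cvgr_le/(_ _ e20) H2 := eps_cvg.
apply: filterS2 H1 H2 => s [K FK] es.
apply: (le_trans (f_min s K)).
apply: (le_trans (y := ((B + e / 2)%:E + (e / 2)%:E)%E)); first by rewrite leeD// lee_fin.
by rewrite -EFinD lee_fin; lra.
Qed.

(** A step function close to g has a fixed number of jumps, so its cost tends
to its distance to g as gamma_s tends to 0. *)
Lemma zero_gam_case : gam = 0 -> L2cvg f_ g.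
Proof.
move=> gam0; apply/L2cvgP; have gL := inL2_L2U g.
apply: (@nsq_cvg_trans f_ (fun s => target g (t_ s))) => //; last exact: target_cvg.
- by move=> s; exact: inL2_L2U.
- by move=> s; exact: inL2_target.
apply/cvgrPdist_le => e e0.
have e20 : 0 < e / 2 by rewrite divr_gt0.
have /cvgrPdist_lt/(_ _ e20)/filter_ex[n hn] := avg_cvg gL.
pose a := mean g n.+1.
pose cs := [seq (cellpt R n.+1 j.+1, a j.+1 - a j) | j <- index_iota 0 n].
have cs01 c : c \in cs -> 0 < c.1 < 1.
  move=> /mapP[j]; rewrite mem_index_iota => /= jn ->.
  have n0 : (0 < n.+1)%N by [].
  rewrite (le_lt_trans (cellpt_ge0 R n.+1 0)) ?cellpt_lt//= -(cellpt_nn R n0) cellpt_lt//.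
have kE x : 0 < x < 1 -> normal_form (a 0%N) cs (cst 0) x = avg g n.+1 x.
  move=> /andP[x0 x1]; rewrite /avg stepfE ?(ltW x0)// /normal_form cprimE ?(ltW x0) ?(ltW x1)//.
  rewrite prim_cst ?(ltW x0)// mul0r addr0 /jumpfun big_map.
  have fn : (cell n.+1 x <= n)%N by rewrite -ltnS cell_lt// ltW.
  rewrite big_mkord.
  rewrite (eq_bigr (fun j : 'I_n => if (j < cell n.+1 x)%N then a j.+1 - a j else 0)); last first.
    move=> j _ /=; congr (if _ then _ else _); apply/idP/idP => [h|h].
      rewrite ltnNge; apply/negP => h'.
      have /andP[_ h2] := @cell_itv R n.+1 x (ltn0Sn n) (ltW x0).
      have := lt_le_trans h2 (le_trans (cellpt_le R (ltn0Sn n) (_ : (cell n.+1 x).+1 <= j.+1)%N) h).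
      by rewrite ltxx => /(_ h').
    have /andP[h2 _] := @cell_itv R n.+1 x (ltn0Sn n) (ltW x0).
    by apply: le_trans h2; exact: cellpt_le.
  rewrite -big_mkcond -(big_ord_widen _ (fun j => a j.+1 - a j) fn).
  by rewrite -(big_mkord xpredT (fun j => a j.+1 - a j)) telescope_sumr// addrC subrK.
have zL : inL2 (cst (0 : R)) by exact: inL2_cst.
have kg : nsq (normal_form (a 0%N) cs (cst 0) \- g) <= e / 2.
  rewrite (@nsq_ae _ _ (avg g n.+1 \- g)).
  - by move: hn; rewrite sub0r normrN ger0_norm ?nsq_ge0// => /ltW.
  - by apply: inL2B => //; exact: inL2_normal_form.
  - by apply: inL2B => //; exact: inL2_stepf.
  - by apply: ae01_oo => x x01 /=; rewrite kE.
have z0 : nsq (cst (0 : R)) = 0 by rewrite nsq_cst expr0n.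
have H := @value_near_le (nsq (normal_form (a 0%N) cs (cst 0) \- g)) (e / 2) e20.
have : \forall s \near \oo, (Ffun g (gam_ s, m_ s, t_ s) (f_ s) <= (nsq (normal_form (a 0%N) cs (cst 0) \- g) + e / 2)%:E)%E.
  apply: H => d d0.
  have := @recovery R t_ tT t_cvg gam_ m_ gam m Q gam_cvg m_cvg g (a 0%N) cs (cst 0) d cs01 zL (fun=> z0) d0.
  by rewrite gam0 mul0r add0r z0 mul0r add0r.
apply: filterS => s /(fidelity_le_Ffun (Q s)) hs.
rewrite sub0r normrN ger0_norm ?nsq_ge0//.
by move: hs kg; set u := nsq _; set w := nsq _; lra.
Qed.

Hypothesis gam0 : 0 < gam.
Hypothesis gam_ge : forall s, gam / 2 <= gam_ s.
Variable C : R.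
Hypothesis f_le : forall s, (Ffun g (gam_ s, m_ s, t_ s) (f_ s) <= C%:E)%E.

(** The limit found by [rough_compact] is compared with itself to get
convergence in L2, and then with an arbitrary competitor to get minimality. *)
Lemma zero_mesh_case : exists (sub : nat -> nat) f, [/\ {homo sub : i j / (i < j)%N},
  L2cvg (fun i => f_ (sub i)) f & minimizer (Ffun g (gam, m, 0%R)) f].
Proof.
have gs0 s : 0 < gam_ s by apply: lt_le_trans (gam_ge s); rewrite divr_gt0.
have gL := inL2_L2U g.
have /choice[c cE] : forall s, exists c : R, Ffun g (gam_ s, m_ s, t_ s) (f_ s) = c%:E.
  by move=> s; apply: Ffun_finite => //; rewrite (le_lt_trans (f_le s)) ?ltry.
have cC s : c s <= C by have := f_le s; rewrite cE lee_fin.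
have /choice[D HD] : forall s, exists D : (R -> R) * (R -> R) * seq R * R,
   [/\ rough (m_ s) (t_ s) D.2 D.1.2 D.1.1.1 D.1.1.2, inL2 D.1.1.1, ae01 (fun x => f_ s x = D.1.1.1 x),
     forall z, z \in D.1.2 -> 0 < z < 1 &
     gam_ s * (size D.1.2)%:R + D.2 + nsq (f_ s \- target g (t_ s)) <= c s].
  move=> s; have Fc : (Ffun g (gam_ s, m_ s, t_ s) (f_ s) <= (c s)%:E)%E by rewrite cE.
  have [h [A [p [E H]]]] := Ffun_lower (gs0 s) (Q s) Fc.
  by exists (h, A, p, E).
pose h_ s := (D s).1.1.1; pose A_ s := (D s).1.1.2; pose p_ s := (D s).1.2; pose E_ s := (D s).2.
have Hrough s : rough (m_ s) (t_ s) (E_ s) (p_ s) (h_ s) (A_ s) by have [] := HD s.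
have hL s : inL2 (h_ s) by have [] := HD s.
have fh s : ae01 (fun x => f_ s x = h_ s x) by have [] := HD s.
have p01 s z : z \in p_ s -> 0 < z < 1 by have [_ _ _ H _] := HD s; exact: H.
have costs s : gam_ s * (size (p_ s))%:R + E_ s + nsq (f_ s \- target g (t_ s)) <= c s.
  by have [] := HD s.
have E_ge0 s : 0 <= E_ s.
  by have [_ /(_ 0)/andP[h1 h2] _] := Hrough s; exact: le_trans h2.
have gp0 s : 0 <= gam_ s * (size (p_ s))%:R by rewrite mulr_ge0 ?(ltW (gs0 s)).
have E_le s : E_ s <= C.
  apply: le_trans (cC s); apply: le_trans (costs s).
  by have := nsq_ge0 (f_ s \- target g (t_ s)); have := gp0 s; lra.
have fid_le s : nsq (f_ s \- target g (t_ s)) <= C.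
  apply: le_trans (cC s); apply: le_trans (costs s).
  by have := E_ge0 s; have := gp0 s; lra.
have [M HM] : exists M : nat, C / (gam / 2) <= M%:R.
  by exists (Num.truncn (C / (gam / 2))).+1; apply/ltW/truncnS_gt.
have p_le s : (size (p_ s) <= M)%N.
  rewrite -(ler_nat R); apply: le_trans HM; rewrite ler_pdivlMr ?divr_gt0// mulrC.
  apply: (le_trans (y := gam_ s * (size (p_ s))%:R)); first by rewrite ler_wpM2r.
  apply: le_trans (cC s); apply: le_trans (costs s).
  by have := E_ge0 s; have := nsq_ge0 (f_ s \- target g (t_ s)); lra.
have h_le s : nsq (h_ s) <= 2 * C + 2 * nsq g.
  rewrite -(nsq_ae (inL2_L2U (f_ s)) (hL s) (fh s)).
  have tL := inL2_target g (t_ s).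
  rewrite (_ : (f_ s : R -> R) = (f_ s \- target g (t_ s)) \+ target g (t_ s)); last first.
    by apply/funext => x /=; rewrite subrK.
  apply: (le_trans (nsqD_le2 (inL2B (inL2_L2U _) tL) tL)).
  by apply: lerD; rewrite ler_wpM2l// nsq_target_le.
have [sub [c0 [cs [v [E [p [[hsub cs01 vL] [vE scs sp cE' ch]]]]]]]] :=
  rough_compact (mesh_ge0 tT) t_cvg m_cvg Hrough E_le p_le p01 hL h_le.
pose k := normal_form c0 cs v.
have kL : inL2 k by exact: inL2_normal_form.
have E0 : 0 <= E by apply: (cvgr_to_ge cE'); apply: nearW.
have m0v : m = 0 -> nsq v = 0.
  move=> m0; apply/eqP; rewrite eq_le nsq_ge0 andbT; move: vE.
  by rewrite m0 expr0n mul0r.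
have vmE : nsq v / m ^+ 2 <= E.
  have [m0|m0] := eqVneq m 0; first by rewrite m0v// mul0r.
  by rewrite ler_pdivrMr ?exprn_even_gt0//= mulrC.
pose N : R := (size p)%:R.
have csN : gam * (size cs)%:R <= gam * N by rewrite ler_wpM2l ?(ltW gam0)// ler_nat.
pose u_ j := h_ (sub j) \- target g (t_ (sub j)).
have uL j : inL2 (u_ j) by apply: inL2B => //; exact: inL2_target.
have uf j : nsq (u_ j) = nsq (f_ (sub j) \- target g (t_ (sub j))).
  apply: nsq_ae => //; first by apply: inL2B; [exact: inL2_L2U|exact: inL2_target].
  by apply: ae01_imp (fh (sub j)) => x _ /= ->.
(* a competitor of cost B leaves at most B - gam |p| - E to the fidelity *)
have key (B e : R) : 0 < e ->
  (forall d, 0 < d -> \forall s \near \oo, exists K, (Ffun g (gam_ s, m_ s, t_ s) K <= (B + d)%:E)%E) ->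
  \forall j \near \oo, nsq (u_ j) <= B - gam * N - E + e.
  move=> e0 H; have e30 : 0 < e / 3 by rewrite divr_gt0.
  have H1 := near_sub hsub (value_near_le e30 H).
  have /cvgrPdist_lt/(_ _ e30) H2 := cE'.
  have gN : gam_ s * N @[s --> \oo] --> gam * N by apply: cvgM => //; exact: cvg_cst.
  have /cvgrPdist_lt/(_ _ e30)/(near_sub hsub) H3 := gN.
  apply: filterS3 H1 H2 H3 => j; rewrite cE lee_fin => h1.
  rewrite !ltr_distlC => /andP[h2 _] /andP[h3 _].
  have := costs (sub j); rewrite sp -/N -uf; move: h1 h2 h3.
  by move: (nsq _) (gam * N) (_ * N) => a b b'; lra.
have tsub : t_ (sub j) @[j --> \oo] --> 0.
  by move=> V /t_cvg; exact: near_sub.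
have ku : nsq (u_ j \- (k \- g)) @[j --> \oo] --> 0.
  apply: radon_riesz => //; first exact: inL2B.
    have := target_cvg_ae (fun j => tT (sub j)) tsub g.
    move=> /(ae01_and ch); apply: ae01_imp => x _ [h1 h2].
    by apply: cvgB.
  move=> e e0; have := key (gam * (size cs)%:R + nsq v / m ^+ 2 + nsq (k \- g)) e e0.
  have H d (d0 : 0 < d) := @recovery R t_ tT t_cvg gam_ m_ gam m Q gam_cvg m_cvg g c0 cs v d cs01 vL m0v d0.
  move=> /(_ H); apply: filterS => j h; apply: (le_trans h).
  have ar (a b w w' z : R) : a <= b -> w <= w' -> a + w + z - b - w' + e <= z + e by lra.
  exact: ar csN vmE.
have [f fE] := L2U_of kL.
exists sub, f; split=> //.
- apply/L2cvgP.
  have hk : nsq (h_ (sub j) \- k) @[j --> \oo] --> 0.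
    apply: (@nsq_cvg_trans _ (fun j => (k \+ (target g (t_ (sub j)) \- g)))) => //.
    + by move=> j; apply: inL2D => //; apply: inL2B => //; exact: inL2_target.
    + apply: cvg_trans ku; apply: near_eq_cvg; apply: nearW => j.
      by congr nsq; apply/funext => x; rewrite /u_ /=; ring.
    + apply: cvg_trans (target_cvg (fun j => tT (sub j)) tsub g).
      apply: near_eq_cvg; apply: nearW => j.
      by congr nsq; apply/funext => x /=; ring.
  apply: cvg_trans hk; apply: near_eq_cvg; apply: nearW => j.
  apply: nsq_ae; [exact: inL2B|by apply: inL2B; exact: inL2_L2U|].
  by apply: ae01_imp (ae01_and (fh (sub j)) fE) => x _ /= [-> ->].
- move=> K; have [Koo|Koo] := pselect (Ffun g (gam, m, 0%R) K < +oo)%E; last first.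
    by move/negP: Koo; rewrite -leNgt leye_eq => /eqP ->; rewrite leey.
  have fE' : ae01 (fun x => f x = c0 + jumpfun cs x + prim v x).
    by apply: ae01_imp fE => x xU ->; rewrite /k /normal_form cprimE.
  apply: (le_trans (Ffun_continuous_le g (ltW gam0) cs01 vL m0v fE')).
  have [c0' [cs' [v' [e' [[cs01' _ _] vL' KE [e0' vE'] ->]]]]] := Ffun_continuous_normal gam0 Koo.
  have fk : nsq (f \- g) = nsq (k \- g).
    apply: nsq_ae; [by apply: inL2B; exact: inL2_L2U|exact: inL2B|].
    by apply: ae01_imp fE => x _ /= ->.
  have Kk : nsq (normal_form c0' cs' v' \- g) = nsq (K \- g).
    apply: (nsq_ae (inL2B (inL2_normal_form c0' cs' vL') gL) (inL2B (inL2_L2U K) gL)).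
    by apply: ae01_imp KE => x xU /= ->; rewrite /normal_form cprimE.
  rewrite lee_fin fk; apply/ler_addgt0Pr => e e0.
  have m0v' : m = 0 -> nsq v' = 0 by move=> m0; rewrite vE' m0 expr0n mul0r.
  have vm' : nsq v' / m ^+ 2 <= e'.
    have [m0|m0] := eqVneq m 0; first by rewrite m0v'// mul0r.
    by rewrite ler_pdivrMr ?exprn_even_gt0//= mulrC vE'.
  have := key (gam * (size cs')%:R + nsq v' / m ^+ 2 + nsq (normal_form c0' cs' v' \- g)) e e0.
  have H d (d0 : 0 < d) := @recovery R t_ tT t_cvg gam_ m_ gam m Q gam_cvg m_cvg g c0' cs' v' d cs01' vL' m0v' d0.
  move=> /(_ H) hj.
  have := @nsq_cvg_le R \oo _ u_ _ _ uL (inL2B kL gL) ku hj; rewrite Kk.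
  by move=> hk; exact: budget_le csN vmE vm' (hk _).
Qed.

End zero_mesh.

End cases.

(** * Almost minimizers on a fixed mesh *)

Section fixed_mesh.
Variable R : realType.
Implicit Types (h u v A : R -> R) (x y d e E : R) (n : nat) (a b : nat -> R) (f g : L2U R).

(** Elements are classes together with a proof of finiteness, so equality almost
everywhere is equality. *)
Lemma L2U_ae_eq f1 f2 : ae01 (fun x => f1 x = f2 x) -> f1 = f2.
Proof.
case: f1 f2 => q1 c1 [q2 c2] H.
have E : q1 = q2.
  have /ae_eqP/eqP : ae_eq (@lebU R) setT q1 q2 by apply/ae_eq_lebU; exact: H.
  by rewrite !reprK.
subst q2; congr (LebesgueSpace.Pack _).
case: c1 c2 H => [[p1]] [[p2]] _; congr (LebesgueSpace.Class _); congr isFinLebesgue.Axioms_.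
exact: Prop_irrelevance.
Qed.

Section bond_limits.
Variables (n : nat) (gam_ m_ d_ : nat -> R) (gam m d : R).
Hypothesis n0 : (0 < n)%N.
Hypothesis gam_ge0 : forall j, 0 <= gam_ j.
Hypothesis gam_cvg : gam_ j @[j --> \oo] --> gam.
Hypothesis m_cvg : m_ j @[j --> \oo] --> m.
Hypothesis d_cvg : d_ j @[j --> \oo] --> d.

Lemma gam_lim_ge0 : 0 <= gam.
Proof. by apply: (cvgr_to_ge gam_cvg); apply: nearW. Qed.

Lemma stiffness_cvg (u_ : nat -> R) (l : R) : u_ j @[j --> \oo] --> l -> m != 0 ->
  n%:R / m_ j ^+ 2 * u_ j ^+ 2 @[j --> \oo] --> n%:R / m ^+ 2 * l ^+ 2.
Proof.
move=> cu m0; apply: cvgM; last first.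
  exact: cvg_sqr.
apply: cvgM; first exact: cvg_cst.
by apply: cvgV; [rewrite expf_neq0|exact: cvg_sqr].
Qed.

Lemma near_neq0 (u_ : nat -> R) (l : R) : u_ j @[j --> \oo] --> l -> l != 0 -> \forall j \near \oo, u_ j != 0.
Proof.
move=> cu l0; have l1 : 0 < `|l| by rewrite normr_gt0.
have /cvgrPdist_lt/(_ _ l1) := cu; apply: filterS => j.
by apply: contraTneq => ->; rewrite subr0 ltxx.
Qed.

(** The only discontinuity is at m = 0: if d is not 0 the elastic energy then
blows up and the truncation leaves gamma; if d is 0 there is nothing to
prove. *)
Lemma bond_liminf e : 0 < e -> \forall j \near \oo, bond gam m n d <= bond (gam_ j) (m_ j) n (d_ j) + e.
Proof.
move=> e0; have g0 := gam_lim_ge0.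
have pos j : 0 <= bond (gam_ j) (m_ j) n (d_ j) + e by rewrite addr_ge0 ?bond_ge0 ?(ltW e0).
have [ge|gn] := eqVneq gam 0.
  by apply: nearW => j; have := pos j; rewrite {2}/bond ge eqxx.
have gp : 0 < gam by rewrite lt_neqAle eq_sym gn.
have ge : gam - e < gam by rewrite gtrBl.
have G0 := near_neq0 gam_cvg gn; have /cvgr_gt/(_ _ ge) G1 := gam_cvg.
have [m0|m0] := eqVneq m 0; last first.
  have S0 : n%:R / m ^+ 2 * d ^+ 2 - e < n%:R / m ^+ 2 * d ^+ 2 by rewrite gtrBl.
  have /cvgr_gt/(_ _ S0) S1 := stiffness_cvg d_cvg m0.
  have M0 := near_neq0 m_cvg m0.
  near=> j; rewrite /bond (negPf gn) (negPf m0).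
  have -> : (gam_ j == 0) = false by apply/negbTE; near: j.
  have -> : (m_ j == 0) = false by apply/negbTE; near: j.
  rewrite -lerBlDr le_min !lerBlDr !ge_min; apply/andP; split; apply/orP; [left|right].
  - by rewrite -lerBlDr ltW//; near: j.
  - by rewrite -lerBlDr ltW//; near: j.
have [d0|d0] := eqVneq d 0.
  apply: nearW => j; apply: le_trans (pos j); rewrite d0.
  by apply: (le_trans (bond_le_sqr _ _ (fun=> erefl))); rewrite expr0n mulr0.
have D0 := near_neq0 d_cvg d0.
have D1 : \forall j \near \oo, gam_ j * m_ j ^+ 2 <= n%:R * d_ j ^+ 2.
  have c1 : n%:R * d_ j ^+ 2 - gam_ j * m_ j ^+ 2 @[j --> \oo] --> n%:R * d ^+ 2 - gam * m ^+ 2.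
    apply: cvgB; apply: cvgM => //; [exact: cvg_cst|exact: cvg_sqr|exact: cvg_sqr].
  have p0 : 0 < n%:R * d ^+ 2 - gam * m ^+ 2.
    by rewrite m0 expr0n mulr0 subr0 mulr_gt0 ?ltr0n// exprn_even_gt0.
  have /cvgr_gt/(_ _ p0) := c1; apply: filterS => j h.
  by rewrite -subr_ge0 ltW.
near=> j.
have b1 : gam <= gam_ j + e by rewrite -lerBlDr ltW//; near: j.
apply: (le_trans (bond_le_gam _ _ _ g0)); rewrite /bond.
have -> : (gam_ j == 0) = false by apply/negbTE; near: j.
have -> : d_ j != 0 by near: j.
case: eqVneq => [_|mj]; first by rewrite mulr1.
rewrite -lerBlDr le_min !lerBlDr b1 andbT; apply: (le_trans b1); rewrite lerD2r.
rewrite mulrAC ler_pdivlMr ?exprn_even_gt0//.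
by near: j.
Unshelve. all: by end_near. Qed.

(** With d fixed, at m = 0 the truncation bounds the bond by gamma_j when d is
not 0, and the bond vanishes when d is 0. *)
Lemma bond_limsup e : 0 < e -> \forall j \near \oo, bond (gam_ j) (m_ j) n d <= bond gam m n d + e.
Proof.
move=> e0; have g0 := gam_lim_ge0.
have ge : gam < gam + e by rewrite ltrDl.
have /cvgr_le/(_ _ ge) G1 := gam_cvg.
have ej j : gam_ j <= gam + e -> bond gam m n d = gam -> bond (gam_ j) (m_ j) n d <= bond gam m n d + e.
  by move=> h ->; apply: le_trans h; exact: bond_le_gam.
have [g0'|gn] := eqVneq gam 0.
  by apply: filterS G1 => j h; apply: ej => //; rewrite /bond g0' eqxx.
have [dz|dz] := eqVneq d 0.
  apply: nearW => j; apply: (@le_trans _ _ 0); last by rewrite addr_ge0 ?bond_ge0 ?(ltW e0).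
  rewrite dz; apply: (le_trans (bond_le_sqr _ _ (fun=> erefl))).
  by rewrite expr0n mulr0.
have [m0|m0] := eqVneq m 0.
  by apply: filterS G1 => j h; apply: ej => //; rewrite /bond (negPf gn) m0 eqxx dz mulr1.
have dc : (fun=> d) j @[j --> \oo] --> d by exact: cvg_cst.
have S0 : n%:R / m ^+ 2 * d ^+ 2 < n%:R / m ^+ 2 * d ^+ 2 + e by rewrite ltrDl.
have /cvgr_le/(_ _ S0) S1 := stiffness_cvg dc m0.
have M0 := near_neq0 m_cvg m0; have G0 := near_neq0 gam_cvg gn.
near=> j; rewrite /bond (negPf gn) (negPf m0).
have -> : (gam_ j == 0) = false by apply/negbTE; near: j.
have -> : (m_ j == 0) = false by apply/negbTE; near: j.
rewrite -lerBlDr le_min !lerBlDr !ge_min; apply/andP; split; apply/orP; [left|right].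
- by near: j.
- by near: j.
Unshelve. all: by end_near. Qed.

End bond_limits.

Section fixed.
Variables (g : L2U R) (n : nat) (gam_ m_ : nat -> R) (gam m : R).
Hypothesis n0 : (0 < n)%N.
Hypothesis gam_ge0 : forall s, 0 <= gam_ s.
Hypothesis gam_cvg : gam_ s @[s --> \oo] --> gam.
Hypothesis m_cvg : m_ s @[s --> \oo] --> m.
Variables (f_ : nat -> L2U R) (eps : nat -> R).
Hypothesis eps_cvg : eps s @[s --> \oo] --> 0.
Hypothesis f_min : forall s K,
  (Ffun g (gam_ s, m_ s, (n%:R^-1)%R) (f_ s) <= Ffun g (gam_ s, m_ s, (n%:R^-1)%R) K + (eps s)%:E)%E.

Lemma sum_near_le (N : nat) (u_ v_ : nat -> nat -> R) e : 0 < e ->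
  (forall k d, 0 < d -> \forall j \near \oo, u_ j k <= v_ j k + d) ->
  \forall j \near \oo, \sum_(k < N) u_ j k <= \sum_(k < N) v_ j k + e.
Proof.
elim: N e => [|N IH] e e0 H.
  by apply: nearW => j; rewrite !big_ord0 add0r ltW.
have e20 : 0 < e / 2 by rewrite divr_gt0.
apply: filterS2 (IH _ e20 H) (H N _ e20) => j h1 h2.
rewrite !big_ord_recr /=; apply: (le_trans (lerD h1 h2)).
by rewrite addrACA -splitr.
Qed.

Lemma sum_cvg (N : nat) (u_ : nat -> nat -> R) (l : nat -> R) :
  (forall k, (k < N)%N -> u_ j k @[j --> \oo] --> l k) ->
  \sum_(k < N) u_ j k @[j --> \oo] --> \sum_(k < N) l k.
Proof.
elim: N => [|N IH] H.
  rewrite big_ord0 (_ : (fun j => _) = fun=> 0); first exact: cvg_cst.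
  by apply/funext => j; rewrite big_ord0.
rewrite big_ord_recr (_ : (fun j => _) = (fun j => \sum_(k < N) u_ j k + u_ j N)) /=.
  by apply: cvgD; [apply: IH => k kN; apply: H; exact: ltnW|exact: H].
by apply/funext => j; rewrite big_ord_recr.
Qed.

(** On a fixed grid a function is a vector, which the fidelity term keeps
bounded. A convergent subsequence of vectors then passes to the limit through
[bond_liminf], and constant competitors through [bond_limsup]. *)
Lemma fixed_mesh_case : exists (sub : nat -> nat) f, [/\ {homo sub : i j / (i < j)%N},
  L2cvg (fun i => f_ (sub i)) f & minimizer (Ffun g (gam, m, n%:R^-1)) f].
Proof.
pose Phi s a := bond_energy (gam_ s) (m_ s) n a + vec_fidelity g n a.
have comp s a b : ae01 (fun x => f_ s x = stepf n a x) -> Phi s a <= Phi s b + eps s.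
  move=> fa; have [K KE] := L2U_of (inL2_stepf n b).
  have := f_min s K; rewrite (Ffun_discrete g (gam_ s) (m_ s) n0 fa).
  by rewrite (Ffun_discrete g (gam_ s) (m_ s) n0 KE) -EFinD lee_fin.
have /choice[a_ aE] : forall s, exists a, ae01 (fun x => f_ s x = stepf n a x).
  move=> s; apply: of_class_stepf => //; apply: contrapT => fc.
  have [K KE] := L2U_of (inL2_stepf n (fun=> 0 : R)).
  have := f_min s K; rewrite Ffun_discrete_out// (Ffun_discrete g (gam_ s) (m_ s) n0 KE).
  by rewrite -EFinD leye_eq.
have bound : \forall s \near \oo, forall k, (k < n)%N -> `|a_ s k| <= `|mean g n k| + (n%:R * (vec_fidelity g n (fun=> 0) + 1) + 1).
  have /cvgr_le/(_ _ ltr01) := eps_cvg; apply: filterS => s es k kn.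
  have h1 := comp s (a_ s) (fun=> 0) (aE s).
  have z0 : bond_energy (gam_ s) (m_ s) n (fun=> 0) <= 0.
    apply: sumr_le0 => j _; rewrite subrr; apply: (le_trans (bond_le_sqr _ _ (fun=> erefl))).
    by rewrite expr0n mulr0.
  have b0 := bond_energy_ge0 (m_ s) n (a_ s) (gam_ge0 s).
  have h2 : vec_fidelity g n (a_ s) <= vec_fidelity g n (fun=> 0) + 1.
    by move: h1 z0 b0 es; rewrite /Phi; move: (bond_energy _ _ _ _) (bond_energy _ _ _ _) (vec_fidelity _ _ _) (vec_fidelity _ _ _) => u v w z; lra.
  have h3 : (a_ s k - mean g n k) ^+ 2 <= n%:R * (vec_fidelity g n (fun=> 0) + 1).
    apply: (le_trans (y := n%:R * vec_fidelity g n (a_ s))); last by rewrite ler_wpM2l.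
    rewrite /vec_fidelity mulrA divff ?pnatr_eq0 -?lt0n// mul1r.
    rewrite (bigD1 (Ordinal kn))//= lerDl; apply: sumr_ge0 => j _; exact: sqr_ge0.
  rewrite -[a_ s k](subrK (mean g n k)) addrC (le_trans (ler_normD _ _))// lerD2l.
  set B := n%:R * _ in h3 *; have B0 : 0 <= B by apply: le_trans h3; exact: sqr_ge0.
  apply: sqr_le_norm; first by rewrite addr_ge0.
  by apply: (le_trans h3); nra.
have [U [UU Uoo]] := ultraFilterLemma eventually_filter.
have Ua k : (k < n)%N -> a_ s k @[s --> U] --> ulim U (fun s => a_ s k).
  move=> kn; apply: (@ulimP R U UU _ (`|mean g n k| + (n%:R * (vec_fidelity g n (fun=> 0) + 1) + 1))).
  by apply: filterS (Uoo _ bound) => s h; exact: h.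
pose a k := ulim U (fun s => a_ s k).
pose P (j : nat) := [set s | forall k, (k < n)%N -> `|a_ s k - a k| < j.+1%:R^-1].
have UP j : U (P j).
  apply: filter_forall_lt => k kn.
  have j0 : 0 < j.+1%:R^-1 :> R by rewrite invr_gt0.
  have /cvgrPdist_lt/(_ _ j0) := Ua k kn; apply: filterS => s.
  by rewrite distrC.
have [sub [hsub Psub]] := ultra_extract UU Uoo UP.
have asub k : (k < n)%N -> a_ (sub j) k @[j --> \oo] --> a k.
  by move=> kn; apply: cvg_by_inv => j; exact: Psub.
have [f fE] := L2U_of (inL2_stepf n a).
exists sub, f; split=> //.
- apply/L2cvgP.
  have E j : nsq (f_ (sub j) \- f) = n%:R^-1 * \sum_(k < n) (a_ (sub j) k - a k) ^+ 2.
    rewrite -(nsq_stepf (fun k => a_ (sub j) k - a k) n0); apply: nsq_ae.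
    - by apply: inL2B; exact: inL2_L2U.
    - exact: inL2_stepf.
    - apply: ae01_imp (ae01_and (ae01_and (aE (sub j)) fE) (ae01_and (ae01_stepf a n0)
        (ae01_and (ae01_stepf (a_ (sub j)) n0) (ae01_stepf (fun k => a_ (sub j) k - a k) n0)))).
      by move=> x _ /= [[-> ->] [-> [-> ->]]].
  rewrite (_ : (fun j => _) = (fun j => n%:R^-1 * \sum_(k < n) (a_ (sub j) k - a k) ^+ 2)); last first.
    by apply/funext => j; exact: E.
  rewrite -[X in _ --> X](mulr0 n%:R^-1); apply: cvgM; first exact: cvg_cst.
  have Z : \sum_(k < n) (0 : R) = 0 by rewrite big1.
  rewrite -[X in _ --> X]Z.
  apply: (@sum_cvg n (fun j k => (a_ (sub j) k - a k) ^+ 2) (fun=> 0)) => k kn.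
  have c0 : a_ (sub j) k - a k @[j --> \oo] --> 0.
    by rewrite -(subrr (a k)); apply: cvgB; [exact: asub|exact: cvg_cst].
  by rewrite -[X in _ --> X](expr0n R 2); exact: cvg_sqr.
- move=> K; have [fc|fc] := pselect (of_class (@stepU_n R n) K); last first.
    by rewrite [leRHS]Ffun_discrete_out// leey.
  have [b bE] := of_class_stepf n0 fc.
  rewrite (Ffun_discrete g gam m n0 fE) (Ffun_discrete g gam m n0 bE) lee_fin.
  apply/ler_addgt0Pr => e e0; have e40 : 0 < e / 4 by rewrite divr_gt0.
  have tosub (w_ : nat -> R) (w : R) : w_ s @[s --> \oo] --> w -> w_ (sub j) @[j --> \oo] --> w.
    by move=> cw V /cw; exact: near_sub.
  have low : \forall j \near \oo, bond_energy gam m n a <= bond_energy (gam_ (sub j)) (m_ (sub j)) n (a_ (sub j)) + e / 4.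
    have H k d : 0 < d -> \forall j \near \oo,
        (if (k.+1 < n)%N then bond gam m n (a k.+1 - a k) else 0) <=
        (if (k.+1 < n)%N then bond (gam_ (sub j)) (m_ (sub j)) n (a_ (sub j) k.+1 - a_ (sub j) k) else 0) + d.
      move=> d0; case: ifP => kn; last by apply: nearW => j; rewrite add0r ltW.
      apply: (bond_liminf (gam_ := fun j => gam_ (sub j))) => //; [exact: tosub|exact: tosub|].
      by apply: cvgB; apply: asub => //; exact: ltnW.
    apply: filterS (@sum_near_le n.-1 (fun _ k => _) (fun j k => _) _ e40 H) => j.
    rewrite /bond_energy; congr (_ <= _ + _); apply: eq_bigr => k _.
      by have -> : (k.+1 < n)%N by rewrite -ltn_predRL.
    by have -> : (k.+1 < n)%N by rewrite -ltn_predRL.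
  have upp : \forall j \near \oo, bond_energy (gam_ (sub j)) (m_ (sub j)) n b <= bond_energy gam m n b + e / 4.
    apply: (@sum_near_le n.-1 (fun j k => bond (gam_ (sub j)) (m_ (sub j)) n (b k.+1 - b k)) (fun _ k => bond gam m n (b k.+1 - b k)) _ e40).
    by move=> k d d0; apply: (@bond_limsup n (fun j => gam_ (sub j)) (fun j => m_ (sub j)) gam m) => //; exact: tosub.
  have fid : \forall j \near \oo, vec_fidelity g n a <= vec_fidelity g n (a_ (sub j)) + e / 4.
    have c0 : vec_fidelity g n (a_ (sub j)) @[j --> \oo] --> vec_fidelity g n a.
      apply: cvgM; first exact: cvg_cst.
      apply: (@sum_cvg n (fun j k => (a_ (sub j) k - mean g n k) ^+ 2) (fun k => (a k - mean g n k) ^+ 2)) => k kn.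
      by apply: cvg_sqr; apply: cvgB; [exact: asub|exact: cvg_cst].
    have v0 : vec_fidelity g n a - e / 4 < vec_fidelity g n a by rewrite gtrBl.
    have /cvgr_gt/(_ _ v0) := c0; apply: filterS => j h.
    by rewrite -lerBlDr ltW.
  have /cvgr_le/(_ _ e40) ep := tosub _ _ eps_cvg.
  have [j [h1 [h2 [h3 h4]]]] : exists j, bond_energy gam m n a <= bond_energy (gam_ (sub j)) (m_ (sub j)) n (a_ (sub j)) + e / 4 /\
    bond_energy (gam_ (sub j)) (m_ (sub j)) n b <= bond_energy gam m n b + e / 4 /\
    vec_fidelity g n a <= vec_fidelity g n (a_ (sub j)) + e / 4 /\ eps (sub j) <= e / 4.
    exact: (filter_ex (filterI low (filterI upp (filterI fid ep)))).
  have := comp (sub j) (a_ (sub j)) b (aE (sub j)); rewrite /Phi.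
  move: h1 h2 h3 h4; clear.
  move: (bond_energy _ _ _ _) (bond_energy _ _ _ _) (bond_energy _ _ _ _) (bond_energy _ _ _ _)
    (vec_fidelity _ _ _) (vec_fidelity _ _ _) (vec_fidelity _ _ _) (eps _) => u1 u2 u3 u4 u5 u6 u7 u8; lra.
Qed.

End fixed.
End fixed_mesh.

(** * Existence and convergence of minimizers *)

Section main.
Variable R : realType.
Implicit Types (q : R * R * R) (f g : L2U R).

(** A negative value would bound the fidelity by a negative number. *)
Lemma Ffun_ge0 g q f : Qset q -> (0 <= Ffun g q f)%E.
Proof.
case: q => [[gam m] t] Q; rewrite leNgt; apply/negP => F0.
have [c c0 Fc] : exists2 c : R, c < 0 & (Ffun g (gam, m, t) f <= c%:E)%E.
  move: F0; case: (Ffun _ _ _) => [r| |] // F0; first by exists r.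
  by exists (-1); rewrite ?oppr_lt0 ?leNye.
by have := le_trans (nsq_ge0 _) (fidelity_le_Ffun Q Fc); rewrite leNgt c0.
Qed.

Lemma Ffun_proper g q : Qset q -> exists f, (Ffun g q f < +oo)%E.
Proof.
case: q => [[gam m] t] Q.
have z0 : nsq (cst (0 : R)) = 0 by rewrite nsq_cst expr0n.
have [|f _ Ff] := @Ffun_recovery R g gam m t 0 [::] (cst 0) Q _ (inL2_cst 0); first by [].
by exists f; rewrite (le_lt_trans (Ff (fun=> z0))) ?ltry.
Qed.

Lemma almost_minimizer g q (e : R) : Qset q -> 0 < e ->
  exists f, forall K, (Ffun g q f <= Ffun g q K + e%:E)%E.
Proof.
move=> Q e0; have [f0 F0] := Ffun_proper g Q.
set S := [set Ffun g q f | f in [set: L2U R]].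
have Sfin : ereal_inf S \is a fin_num.
  rewrite fin_numE; apply/andP; split.
    rewrite -ltNye; apply: (@lt_le_trans _ _ 0%E); first exact: ltNyr.
    by apply: le_ereal_inf_tmp => _ [f _ <-]; exact: Ffun_ge0.
  by rewrite -ltey; apply: le_lt_trans F0; apply: ereal_inf_lbound; exists f0.
have [_ [f _ <-] hf] := lb_ereal_inf_adherent e0 Sfin.
exists f => K; apply: (le_trans (ltW hf)); rewrite leeD2r//.
by apply: ereal_inf_lbound; exists K.
Qed.

Lemma coords_cvg (q_ : nat -> R * R * R) q : q_ @ \oo --> q ->
  [/\ (q_ s).1.1 @[s --> \oo] --> q.1.1, (q_ s).1.2 @[s --> \oo] --> q.1.2
    & (q_ s).2 @[s --> \oo] --> q.2].
Proof.
case: q => [[a b] c] h; split.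
- by apply: (cvg_comp _ _ (cvg_comp _ _ h cvg_fst)); exact: cvg_fst.
- by apply: (cvg_comp _ _ (cvg_comp _ _ h cvg_fst)); exact: cvg_snd.
- by apply: (cvg_comp _ _ h); exact: cvg_snd.
Qed.

(** The inverses of the meshes are integers, or 0, that tend to n. *)
Lemma mesh_eventually_cst (t_ : nat -> R) n : (0 < n)%N ->
  (forall s, t_ s = 0 \/ exists2 n, (0 < n)%N & t_ s = n%:R^-1) ->
  t_ s @[s --> \oo] --> (n%:R^-1 : R) -> \forall s \near \oo, t_ s = n%:R^-1.
Proof.
move=> n0 tT ct; have nz : n%:R^-1 != 0 :> R by rewrite invr_eq0 pnatr_eq0 -lt0n.
have ci : (t_ s)^-1 @[s --> \oo] --> (n%:R : R) by rewrite -[n%:R]invrK; exact: cvgV.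
have /cvgrPdist_lt/(_ _ ltr01) h1 := ci.
apply: filterS2 h1 (near_neq0 ct nz) => s.
case: (tT s) => [->|[k k0 ->]]; first by rewrite eqxx.
rewrite invrK => h _; congr (_%:R^-1).
move: h; rewrite ltr_distlC => /andP[h2 h3].
have kn : (k < n.+1)%N by rewrite -(ltr_nat R) -natr1.
have nk : (n < k.+1)%N by rewrite -(ltr_nat R) -natr1 -ltrBlDr.
by apply/eqP; rewrite eqn_leq; apply/andP.
Qed.

Lemma shift_homo (sub : nat -> nat) N : {homo sub : i j / (i < j)%N} ->
  {homo (fun i => sub i + N)%N : i j / (i < j)%N}.
Proof. by move=> h i j ij; rewrite ltn_add2r; exact: h. Qed.

(** Finitely many terms are dropped so that the bounds valid for large s hold
for all s. *)
Lemma almost_minimizers_coords g (gam_ m_ t_ : nat -> R) (gam m t : R) (f_ : nat -> L2U R) (eps : nat -> R) :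
  (forall s, Qset (gam_ s, m_ s, t_ s)) -> Qset (gam, m, t) ->
  gam_ s @[s --> \oo] --> gam -> m_ s @[s --> \oo] --> m -> t_ s @[s --> \oo] --> t ->
  eps s @[s --> \oo] --> 0 ->
  (forall s K, (Ffun g (gam_ s, m_ s, t_ s) (f_ s) <= Ffun g (gam_ s, m_ s, t_ s) K + (eps s)%:E)%E) ->
  exists (sub : nat -> nat) f, [/\ {homo sub : i j / (i < j)%N},
    L2cvg (fun i => f_ (sub i)) f & minimizer (Ffun g (gam, m, t)) f].
Proof.
move=> Q_ Qq cg cm ct ce fmin.
have tT s : t_ s = 0 \/ exists2 n, (0 < n)%N & t_ s = n%:R^-1 by have [] := Qset_cases (Q_ s).
have gam_ge0 s : 0 <= gam_ s by have [] := Qset_cases (Q_ s).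
have sh (T : topologicalType) (u : nat -> T) (l : T) N : u s @[s --> \oo] --> l -> u (s + N)%N @[s --> \oo] --> l.
  by move=> cu V /cu; apply: (@near_sub (fun s => s + N)%N) => i j; rewrite ltn_add2r.
have [g0 m0 [t0|[n n0 tn]]] := Qset_cases Qq; last first.
  rewrite tn in ct *.
  have [N _ HN] := mesh_eventually_cst n0 tT ct.
  have fmin' s K : (Ffun g (gam_ (s + N)%N, m_ (s + N)%N, (n%:R^-1)%R) (f_ (s + N)%N) <=
      Ffun g (gam_ (s + N)%N, m_ (s + N)%N, (n%:R^-1)%R) K + (eps (s + N)%N)%:E)%E.
    by have := fmin (s + N)%N K; rewrite (HN (s + N)%N (leq_addl _ _)).
  have [sub [f [hs cf mf]]] := fixed_mesh_case n0 (fun s => gam_ge0 (s + N)%N) (sh _ _ _ N cg) (sh _ _ _ N cm) (sh _ _ _ N ce) fmin'.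
  by exists (fun i => sub i + N)%N, f; split=> //; exact: shift_homo.
rewrite t0 in ct *; have [gz|gn] := eqVneq gam 0.
  exists id, g; split=> //.
    exact: (zero_gam_case Q_ cg cm ct ce fmin gz).
  move=> K; rewrite gz /Ffun eqxx !sqdistE lee_fin (@nsq_ae _ (g \- g) (cst 0)).
  - by rewrite nsq_cst expr0n nsq_ge0.
  - by apply: inL2B; exact: inL2_L2U.
  - exact: inL2_cst.
  - by apply: ae01W => x _ /=; rewrite subrr.
have gp : 0 < gam by rewrite lt_neqAle eq_sym gn.
have g2 : gam / 2 < gam by rewrite ltr_pdivrMr// ltr_pMr// ltr1n.
have zL : inL2 (cst (0 : R)) by exact: inL2_cst.
have z0 : nsq (cst (0 : R)) = 0 by rewrite nsq_cst expr0n.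
have near_le := @value_near_le R g gam_ m_ t_ f_ eps ce fmin
  (nsq (normal_form 0 [::] (cst 0) \- g)) 1 ltr01.
have [N _ HN] : \forall s \near \oo, gam / 2 <= gam_ s /\
    (Ffun g (gam_ s, m_ s, t_ s) (f_ s) <= (nsq (normal_form 0 [::] (cst 0%R) \- g) + 1)%:E)%E.
  have /cvgr_ge/(_ _ g2) h1 := cg; apply: filterS2 h1 (near_le _) => // d d0.
  have := @recovery R t_ tT ct gam_ m_ gam m Q_ cg cm g 0 [::] (cst 0) d _ zL (fun=> z0) d0.
  by rewrite mulr0 add0r z0 mul0r add0r; apply.
have [sub [f [hs cf mf]]] := zero_mesh_case (fun s => Q_ (s + N)%N) (sh _ _ _ N cg) (sh _ _ _ N cm)
  (sh _ _ _ N ct) (sh _ _ _ N ce) (fun s => fmin (s + N)%N) gp (fun s => (HN (s + N)%N (leq_addl _ _)).1)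
  (fun s => (HN (s + N)%N (leq_addl _ _)).2).
by exists (fun i => sub i + N)%N, f; split=> //; exact: shift_homo.
Qed.

Lemma almost_minimizers_compact g (q_ : nat -> R * R * R) q (f_ : nat -> L2U R) (eps : nat -> R) :
  (forall s, Qset (q_ s)) -> Qset q -> q_ @ \oo --> q -> eps s @[s --> \oo] --> 0 ->
  (forall s K, (Ffun g (q_ s) (f_ s) <= Ffun g (q_ s) K + (eps s)%:E)%E) ->
  exists (sub : nat -> nat) f, [/\ {homo sub : i j / (i < j)%N},
    L2cvg (fun i => f_ (sub i)) f & minimizer (Ffun g q) f].
Proof.
move=> Q_ Qq /coords_cvg[cg cm ct] ce fmin; case: q Qq cg cm ct => [[gam m] t] Qq cg cm ct.
apply: (almost_minimizers_coords _ Qq cg cm ct ce) => [s|s K].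
  by have := Q_ s; case: (q_ s) => [[? ?] ?].
by have := fmin s K; case: (q_ s) => [[? ?] ?].
Qed.

(** All primitives of v vanish. *)
Lemma nsq0_ae v : inL2 v -> nsq v = 0 -> ae01 (fun x => v x = 0 :> R).
Proof.
move=> vL n0; apply: (@prim_locally_cst R [::]); [exact: vL.1|exact: inL2_integ01|].
move=> a b a0 ab b1 _; rewrite !prim_nsq0// ?(ltW a0) ?(ltW b1) ?(ltW (lt_trans a0 ab))//.
by rewrite (ltW (lt_trans ab b1)).
Qed.

Lemma L2cvg_unique (f_ : nat -> L2U R) f1 f2 : L2cvg f_ f1 -> L2cvg f_ f2 -> f1 = f2.
Proof.
move=> /L2cvgP c1 /L2cvgP c2; apply: L2U_ae_eq.
have L1 := inL2_L2U f1; have L2 := inL2_L2U f2.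
suff z : nsq (f1 \- f2) <= 0.
  have z' : nsq (f1 \- f2) = 0 by apply/eqP; rewrite eq_le z nsq_ge0.
  by apply: ae01_imp (nsq0_ae (inL2B L1 L2) z') => x _ /eqP; rewrite /= subr_eq0 => /eqP.
have c : 2 * nsq (f_ s \- f1) + 2 * nsq (f_ s \- f2) @[s --> \oo] --> (0 : R).
  rewrite -[X in _ --> X](addr0 (0 : R)) -{1}(mulr0 (2 : R)) -{2}(mulr0 (2 : R)).
  by apply: cvgD; apply: cvgM => //; exact: cvg_cst.
apply: (cvgr_to_ge c); apply: nearW => s.
have Ls := inL2_L2U (f_ s); have D1 := inL2B Ls L1; have D2 := inL2B Ls L2.
have -> : f1 \- f2 = (fun x => -1 * (f_ s \- f1) x) \+ (f_ s \- f2).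
  by apply/funext => x /=; ring.
by apply: (le_trans (nsqD_le2 (inL2Z (-1) D1) D2)); rewrite nsqZ// sqrrN expr1n mul1r.
Qed.

End main.

Theorem theorem1 (R : realType) (g : L2U R) :
  (forall q : R * R * R, Qset q ->
     exists f : L2U R, minimizer (Ffun g q) f) /\
  (forall (q_ : nat -> R * R * R) (q : R * R * R) (f_ : nat -> L2U R),
     (forall s, Qset (q_ s)) -> Qset q ->
     q_ @ \oo --> q ->
     (forall s, minimizer (Ffun g (q_ s)) (f_ s)) ->
     (forall (sub : nat -> nat) (f : L2U R),
        {homo sub : i j / (i < j)%N} ->
        L2cvg (fun i => f_ (sub i)) f -> minimizer (Ffun g q) f) /\
     (exists (sub : nat -> nat) (f : L2U R),
        {homo sub : i j / (i < j)%N} /\ L2cvg (fun i => f_ (sub i)) f)).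
Proof.
split.
- move=> q Q.
  have e0 s : 0 < s.+1%:R^-1 :> R by rewrite invr_gt0.
  have /choice[f_ hf] : forall s, exists f, forall K,
      (Ffun g q f <= Ffun g q K + (s.+1%:R^-1)%:E)%E by move=> s; exact: almost_minimizer.
  have ce : (s.+1%:R^-1 : R) @[s --> \oo] --> 0 by exact: cvg_harmonic.
  have [sub [f [_ _ hm]]] := @almost_minimizers_compact R g (fun=> q) q f_ _ (fun=> Q) Q (cvg_cst _) ce hf.
  by exists f.
move=> q_ q f_ Q_ Q cq hmin.
have hmin' s K : (Ffun g (q_ s) (f_ s) <= Ffun g (q_ s) K + (0 : R)%:E)%E by rewrite adde0; exact: hmin.
have c0 : (fun=> 0 : R) s @[s --> \oo] --> (0 : R) by exact: cvg_cst.
split=> [sub f hsub cf|].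
- have cqs : (fun i => q_ (sub i)) @ \oo --> q by move=> V /cq; exact: near_sub.
  have [sub' [f' [hsub' cf' mf']]] :=
    almost_minimizers_compact (fun s => Q_ (sub s)) Q cqs c0 (fun s => hmin' (sub s)).
  rewrite (_ : f = f')//; apply: L2cvg_unique cf'.
  by apply/L2cvgP => V; move/L2cvgP: cf => cf /cf; exact: near_sub.
- have [sub [f [hs cf _]]] := almost_minimizers_compact Q_ Q cq c0 hmin'.
  by exists sub, f.
Qed.
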